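(* Let $(\mathcal{E},\mathcal{D}(\mathcal{E}))$ be a symmetric, regular, strongly local Dirichlet form on $L^2(X,m)$ admitting a carré du champ operator $\Gamma$, and let $p>2$. Suppose that $(\mathcal{E},\mathcal{D}(\mathcal{E}))$ is coercive, i.e. there is a constant $k$ such that $\|u\|_2^2\le k\,\mathcal{E}(u,u)$ for all $u\in\mathcal{D}(\mathcal{E})$. Then the associated nonlinear $p$-form $\mathcal{E}^p(u,v)=\int_X\Gamma(u)^{\frac{p-2}{2}}\Gamma(u,v)\,dm=\langle \mathsf{L}_pu,v\rangle$, $u,v\in\mathcal{D}_p$, is a nonlinear Dirichlet form (with $B=\mathbf{K}=\mathcal{D}_p$ and $A=\mathsf{L}_p$).
   Context: Setting. $X$ is a locally compact separable metric space, $m$ is a finite positive Radon measure on $X$ with full support. A Dirichlet form $(\mathcal{E},\mathcal{D}(\mathcal{E}))$ on $L^2(X,m)$ is strongly local if $\mathcal{E}(u,v)=0$ whenever $u,v\in\mathcal{D}(\mathcal{E})$ have compact support and $v$ is constant on a neighbourhood of $\operatorname{supp}u$. It admits a carré du champ operator if there is a positive symmetric bilinear map $\Gamma:\mathcal{D}(\mathcal{E})\times\mathcal{D}(\mathcal{E})\to L^1(X,m)$ with $\mathcal{E}(uf,v)+\mathcal{E}(vf,u)-\mathcal{E}(uv,f)=\int_X f\,\Gamma(u,v)\,dm$ for all $u,v,f\in\mathcal{D}(\mathcal{E})\cap L^\infty(X,m)$; in the strongly local case $\mathcal{E}(u,v)=\frac12\int_X\Gamma(u,v)\,dm$ for all $u,v\in\mathcal{D}(\mathcal{E})$.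 Write $\Gamma(u):=\Gamma(u,u)$. The space $\mathcal{D}_p:=\{u\in\mathcal{D}(\mathcal{E})\cap L^p(X,m):\Gamma(u)^{1/2}\in L^p(X,m)\}$ carries the norm $\|u\|_{\mathcal{D}_p}:=\big(\int_X|u|^p\,dm+\int_X\Gamma(u)^{p/2}\,dm\big)^{1/p}$. The operator $\mathsf{L}_p:\mathcal{D}_p\to\mathcal{D}_p'$ (topological dual) is defined by $\langle\mathsf{L}_pu,v\rangle:=\mathcal{E}^p(u,v):=\int_X\Gamma(u)^{\frac{p-2}{2}}\Gamma(u,v)\,dm$. Nonlinear Dirichlet form (van Beusekom). Let $B$ be a real Banach space continuously embedded in $L^1(X,m)$, with dual $B'$ and duality $\langle\cdot,\cdot\rangle$. Let $\mathbf{K}\subset B$ be a closed convex cone with $0\in\mathbf{K}$ such that $u,v\in\mathbf{K}$ implies $u\wedge v\in\mathbf{K}$, and $u,v\in\mathbf{K}$, $\alpha\ge0$ imply $u\wedge(v+\alpha)\in\mathbf{K}$. Let $A:\mathbf{K}\to B'$ satisfy: (1) $A0=0$; (2) coercivity: there are constants $c,q>0$ with $\langle Au,u\rangle\ge c\|u\|_B^q$ for all $u\in\mathbf{K}$; (3) strict monotonicity: $\langle Au-Av,u-v\rangle>0$ for all $u,v\in\mathbf{K}$, $u\ne v$; (4) Browder property: for each $f\in B'$ and each nonempty closed convex subset $W$ of $\mathbf{K}$ there is $u\in W$ with $\langle Au-f,v-u\rangle\ge0$ for all $v\in W$. Then the map $(u,v)\mapsto\langle Au,v\rangle$, $u\in\mathbf{K}$,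 $v\in B$, is called a monotone form. An element $u\in\mathbf{K}$ is a (pure) potential if $\langle Au,v\rangle\ge0$ for all $v\in\mathbf{K}$ with $v\ge0$. A monotone form is a nonlinear Dirichlet form if for all potentials $u,v$ and every constant $\alpha>0$: (D1) $\langle A(u\wedge v),u-u\wedge v\rangle\ge0$; (D2) $\langle A(u\wedge(v+\alpha)),u-u\wedge(v+\alpha)\rangle\ge0$. *)

(* Defs.v *)
From HB Require Import structures.
From mathcomp Require Import all_boot all_order all_algebra.
From mathcomp Require Import all_classical all_reals all_analysis.

Set Implicit Arguments.
Unset Strict Implicit.
Unset Printing Implicit Defensive.

Import Order.TTheory GRing.Theory Num.Theory.
Import numFieldNormedType.Exports.

Local Open Scope classical_set_scope.
Local Open Scope ring_scope.

(* Metric and measurable structures on one carrier; compatibility of the two is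
   the separate hypothesis [borel_sigma_algebra]. *)
#[short(type="metricMeasurableType")]
HB.structure Definition MetricMeasurable (R : realType) (d : measure_display) :=
  {X of Metric R X & Measurable d X}.

Section Space.
Context {R : realType} {d : measure_display} (X : metricMeasurableType R d).

Definition separable_space : Prop := exists2 S : set X, countable S & dense S.

Definition borel_sigma_algebra : Prop :=
  (measurable : set (set X)) = <<s [set U : set X | open U] >>.

Definition radon_measure (m : {measure set X -> \bar R}) : Prop :=
  (forall K : set X, compact K -> (m K < +oo)%E) /\
  (forall A : set X, measurable A ->
     m A = ereal_sup [set m K | K in [set K : set X | compact K /\ K `<=` A]]).

Definition full_support (m : {measure set X -> \bar R}) : Prop :=
  forall U : set X, open U -> U !=set0 -> (0 < m U)%E.

End Space.

(* Elements of the spaces L^p(X, m) are represented by functions X -> R, taken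
   up to m-a.e. equality.  Spaces of classes are therefore sets of measurable
   functions stable under a.e. equality, and maps between them must respect
   a.e. equality. *)
Section FunctionSpaces.
Context {R : realType} {d : measure_display} {X : measurableType d}.
Variable m : {measure set X -> \bar R}.
Implicit Types (V : set (X -> R)) (N : (X -> R) -> R) (u v w : X -> R).

Record function_space V : Prop := FunctionSpace {
  fs_meas : forall u, V u -> measurable_fun setT u ;
  fs_ae : forall u v, V u -> measurable_fun setT v -> u = v %[ae m] -> V v ;
  fs_0 : V (cst 0) ;
  fs_lin : forall (a : R) u v, V u -> V v -> V ((a \*o u) \+ v)
}.

Definition cauchy_seq N (u_ : nat -> X -> R) : Prop :=
  forall e : R, 0 < e ->
    exists n0, forall i j, (n0 <= i)%N -> (n0 <= j)%N -> N (u_ i \- u_ j) < e.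

Definition cvg_seq N (u_ : nat -> X -> R) u : Prop :=
  (fun n => N (u_ n \- u)) @ \oo --> (0 : R).

Definition complete_space V N : Prop :=
  forall u_ : nat -> X -> R, (forall n, V (u_ n)) -> cauchy_seq N u_ ->
    exists2 u, V u & cvg_seq N u_ u.

Record banach_in_L1 V N : Prop := BanachInL1 {
  bn_space : function_space V ;
  bn_ge0 : forall u, V u -> 0 <= N u ;
  bn_eq0 : forall u, V u -> (N u = 0 <-> u = cst 0 %[ae m]) ;
  bn_scale : forall (a : R) u, V u -> N (a \*o u) = `|a| * N u ;
  bn_triangle : forall u v, V u -> V v -> N (u \+ v) <= N u + N v ;
  bn_complete : complete_space V N ;
  bn_embed : exists C : R, forall u, V u ->
    u \in Lfun m 1 /\ ('N[m]_1[EFin \o u] <= (C * N u)%:E)%E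
}.

(* [F] represents an element of the topological dual of (V, N). *)
Definition in_dual V N (F : (X -> R) -> R) : Prop :=
  (forall (a : R) u v, V u -> V v -> F ((a \*o u) \+ v) = a * F u + F v) /\
  (exists C : R, forall u, V u -> `|F u| <= C * N u).

Definition norm_closed V N (W : set (X -> R)) : Prop :=
  forall (u_ : nat -> X -> R) u,
    (forall n, W (u_ n)) -> V u -> cvg_seq N u_ u -> W u.

Definition convex_subset (W : set (X -> R)) : Prop :=
  forall (t : R) u v, 0 <= t <= 1 -> W u -> W v ->
    W ((t \*o u) \+ ((1 - t) \*o v)).

(* [A u v] stands for <A u, v>; [N] is the norm of the Banach space [B]. *)
Record monotone_form (B : set (X -> R)) N (K : set (X -> R))
    (A : (X -> R) -> (X -> R) -> R) : Prop := MonotoneForm {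
  mf_banach : banach_in_L1 B N ;
  mf_sub : K `<=` B ;
  mf_closed : norm_closed B N K ;
  mf_convex : convex_subset K ;
  mf_cone : forall (t : R) u, 0 <= t -> K u -> K (t \*o u) ;
  mf_K0 : K (cst 0) ;
  mf_min : forall u v, K u -> K v -> K (u \min v) ;
  mf_min_cst : forall u v (a : R), K u -> K v -> 0 <= a -> K (u \min (v \+ cst a)) ;
  mf_dual : forall u, K u -> in_dual B N (A u) ;
  mf_ae : forall u u' v, K u -> K u' -> B v -> u = u' %[ae m] ->
    A u v = A u' v ;
  mf_A0 : forall v, B v -> A (cst 0) v = 0 ;
  mf_coercive : exists c q : R,
    [/\ 0 < c, 0 < q & forall u, K u -> c * N u `^ q <= A u u] ;
  mf_strict_mono : forall u v, K u -> K v -> ~ (u = v %[ae m]) ->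
    0 < A u (u \- v) - A v (u \- v) ;
  mf_browder : forall (F : (X -> R) -> R) (W : set (X -> R)),
    in_dual B N F -> W !=set0 -> W `<=` K -> norm_closed B N W ->
    convex_subset W ->
    exists2 u, W u & forall v, W v -> 0 <= A u (v \- u) - F (v \- u)
}.

Definition potential (K : set (X -> R)) (A : (X -> R) -> (X -> R) -> R) u
    : Prop :=
  K u /\ forall v, K v -> (\forall x \ae m, 0 <= v x) -> 0 <= A u v.

Record nonlinear_dirichlet_form (B : set (X -> R)) N (K : set (X -> R))
    (A : (X -> R) -> (X -> R) -> R) : Prop := NonlinearDirichletForm {
  ndf_monotone : monotone_form B N K A ;
  ndf_D1 : forall u v, potential K A u -> potential K A v ->
    0 <= A (u \min v) (u \- (u \min v)) ;
  ndf_D2 : forall u v (a : R), potential K A u -> potential K A v -> 0 < a ->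
    0 <= A (u \min (v \+ cst a)) (u \- (u \min (v \+ cst a)))
}.

End FunctionSpaces.

Section DirichletForms.
Context {R : realType} {d : measure_display} {X : metricMeasurableType R d}.
Variable m : {measure set X -> \bar R}.
Variables (D : set (X -> R)) (E : (X -> R) -> (X -> R) -> R).
Implicit Types (u v f : X -> R).

Definition energy_norm u : R := Num.sqrt (E u u + \int[m]_x (u x ^+ 2)).

Record symmetric_dirichlet_form : Prop := SymmetricDirichletForm {
  df_space : function_space m D ;
  df_L2 : forall u, D u -> u \in Lfun m 2%:E ;
  df_dense : forall f (e : R), f \in Lfun m 2%:E -> 0 < e ->
    exists2 u, D u & ('N[m]_2%:E[EFin \o (f \- u)%R] < e%:E)%E ;
  df_ae : forall u u' v, D u -> D u' -> D v -> u = u' %[ae m] ->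
    E u v = E u' v ;
  df_sym : forall u v, D u -> D v -> E u v = E v u ;
  df_lin : forall (a : R) u u' v, D u -> D u' -> D v ->
    E ((a \*o u) \+ u') v = a * E u v + E u' v ;
  df_ge0 : forall u, D u -> 0 <= E u u ;
  df_closed : complete_space D energy_norm ;
  df_markov : forall u, D u ->
    let w := (u \max cst 0) \min cst 1 in D w /\ E w w <= E u u
}.

Definition Cc u : Prop :=
  continuous u /\ compact (closure [set x | u x != 0]).

Definition regular_form : Prop :=
  (forall u (e : R), D u -> 0 < e ->
     exists2 f, D f /\ Cc f & energy_norm (u \- f) < e) /\
  (forall u (e : R), Cc u -> 0 < e ->
     exists2 f, D f /\ Cc f & forall x, `|u x - f x| < e).

(* The support of the measure |u| m, which only depends on the class of u:
   the complement of the union of all open sets on which u = 0 a.e. *)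
Definition ae_supp u : set X :=
  [set x | forall U : set X, open U -> U x ->
     ~ (\forall y \ae m, U y -> u y = 0)].

Definition strongly_local : Prop :=
  forall u v, D u -> D v -> compact (ae_supp u) -> compact (ae_supp v) ->
    (exists (U : set X) (c : R), [/\ open U, ae_supp u `<=` U &
       \forall x \ae m, U x -> v x = c]) ->
    E u v = 0.

Variable G : (X -> R) -> (X -> R) -> (X -> R).

(* [cdc_energy] is the representation of the energy in the strongly local case.
   It has to be a clause of the definition: [cdc_leibniz] says nothing about
   [G u v] for unbounded u or v, and no continuity of [G] is required. *)
Record carre_du_champ : Prop := CarreDuChamp {
  cdc_L1 : forall u v, D u -> D v -> G u v \in Lfun m 1 ;
  cdc_ae : forall u u' v, D u -> D u' -> D v -> u = u' %[ae m] ->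
    G u v = G u' v %[ae m] ;
  cdc_sym : forall u v, D u -> D v -> G u v = G v u %[ae m] ;
  cdc_lin : forall (a : R) u u' v, D u -> D u' -> D v ->
    G ((a \*o u) \+ u') v = (a \*o G u v) \+ G u' v %[ae m] ;
  cdc_ge0 : forall u, D u -> \forall x \ae m, 0 <= G u u x ;
  cdc_leibniz : forall u v f, D u -> D v -> D f ->
    u \in Lfun m +oo%E -> v \in Lfun m +oo%E -> f \in Lfun m +oo%E ->
    E (u \* f) v + E (v \* f) u - E (u \* v) f = \int[m]_x (f x * G u v x) ;
  cdc_energy : strongly_local -> forall u v, D u -> D v ->
    E u v = 2^-1 * \int[m]_x (G u v x)
}.

Definition coercive_form : Prop :=
  exists k : R, forall u, D u ->
    ('N[m]_2%:E[EFin \o u] ^+ 2 <= (k * E u u)%:E)%E.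

Definition Dp (p : R) : set (X -> R) :=
  [set u | [/\ D u, u \in Lfun m p%:E &
     (fun x => Num.sqrt (G u u x)) \in Lfun m p%:E]].

Definition Dp_norm (p : R) u : R :=
  (\int[m]_x (`|u x| `^ p) + \int[m]_x (G u u x `^ (p / 2))) `^ p^-1.

Definition p_form (p : R) u v : R :=
  \int[m]_x (G u u x `^ ((p - 2) / 2) * G u v x).

End DirichletForms.

(* Main.v *)
Require Import Defs.
From HB Require Import structures.
From mathcomp Require Import all_boot all_order all_algebra.
From mathcomp Require Import all_classical all_reals all_analysis.
From mathcomp Require Import measurable_realfun ess_sup_inf convex hoelder.
From mathcomp Require Import ring lra.

Set Implicit Arguments.
Unset Strict Implicit.
Unset Printing Implicit Defensive.

Import Order.TTheory GRing.Theory Num.Theory.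
Import numFieldNormedType.Exports.

Local Open Scope classical_set_scope.
Local Open Scope ring_scope.

(* By density, strong locality and the Leibniz formula for Gamma show that
   Gamma((z - a)^+) is Gamma(z) on [a < z] and 0 on [z <= a], for every z in the
   domain and a >= 0: first for continuous compactly supported z, by testing with
   truncations of z itself, then in general by lower semicontinuity of
   \int_A Gamma. Hence truncations stay in D_p; for w = (u - v - a)^+ one gets
   <A (u - w), w> = <A v, w>, which gives (D1) and (D2) since v is a potential;
   and summing the L^2 coercivity inequality over the dyadic truncations of u
   yields the L^p inequality \int |u|^p <= C \int Gamma(u)^(p/2), hence coercivity.
   For the Browder property one minimises p^-1 \int Gamma(u)^(p/2) - f(u) over W:
   Clarkson's inequality makes minimising sequences Cauchy, and the variational
   inequality follows from convexity and hemicontinuity. *)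

(** * Integrals and almost everywhere equality *)

(** Each rule for [G] holds only off a null set depending on its arguments, so a pointwise argument
    may combine at most countably many of them. Strong locality asks for a neighbourhood on which
    one function is constant; hence the truncation levels must at first be separated by a gap, which
    is closed afterwards by approximation. The Leibniz formula involves squares of truncations,
    whose membership in the domain is itself a limit statement. In these limits only energies and
    L^2 distances are controlled: the parallelogram law takes the place of weak compactness, and
    carrying \int_A Gamma along the approximation preserves the information that a slope vanishes on
    A. The L^p inequality does not go through a chain rule for |u|^(p/2): only the slopes of (u -
    l)^+ are at hand, and the weights l^(p-2) rebuild the power from them. Over dyadic levels these
    weights grow geometrically because p > 2, so that their sum up to height z is comparable to
    z^(p-2). *)

Section IntegralAe.
Context {R : realType} {d : measure_display} {X : measurableType d}.
Variable m : {measure set X -> \bar R}.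
Implicit Types f g h : X -> R.

Definition intg f : Prop := m.-integrable setT (EFin \o f).

Lemma intg_meas f : intg f -> measurable_fun setT f.
Proof. by move=> /integrableP[/measurable_EFinP]. Qed.

Lemma ae_imp2 (P1 P2 Q : X -> Prop) :
  (\forall x \ae m, P1 x) -> (\forall x \ae m, P2 x) ->
  (forall x, P1 x -> P2 x -> Q x) -> \forall x \ae m, Q x.
Proof. by move=> h1 h2 PQ; apply: filterS2 h1 h2. Qed.

Lemma ae_imp3 (P1 P2 P3 Q : X -> Prop) :
  (\forall x \ae m, P1 x) -> (\forall x \ae m, P2 x) ->
  (\forall x \ae m, P3 x) ->
  (forall x, P1 x -> P2 x -> P3 x -> Q x) -> \forall x \ae m, Q x.
Proof. by move=> h1 h2 h3 PQ; apply: filterS3 h1 h2 h3. Qed.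

Lemma eq_aeP f g : f = g %[ae m] <-> \forall x \ae m, f x = g x.
Proof. by split; apply: filterS => x //; exact. Qed.

Lemma Rint_ae_eq f g : measurable_fun setT f -> measurable_fun setT g ->
  (\forall x \ae m, f x = g x) -> \int[m]_x f x = \int[m]_x g x.
Proof.
move=> mf mg fg; congr fine; apply: ae_eq_integral => //.
- exact/measurable_EFinP.
- exact/measurable_EFinP.
- by apply: filterS fg => x /= ->.
Qed.

Lemma intg_ae_dom f g : measurable_fun setT f -> intg g ->
  (\forall x \ae m, `|f x| <= g x) -> intg f.
Proof.
move=> mf ig fg; apply/integrableP; split; first exact/measurable_EFinP.
have /integrableP[mg] := ig; apply: le_lt_trans.
apply: ae_ge0_le_integral => //.
- by apply/measurable_EFinP; exact: measurableT_comp.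
- by apply: measurableT_comp.
- apply: filterS fg => x /= fg _; rewrite lee_fin (le_trans fg)//.
  exact: ler_norm.
Qed.

Lemma intg_dom f g : measurable_fun setT f -> intg g ->
  (forall x, `|f x| <= g x) -> intg f.
Proof. by move=> mf ig fg; apply: (intg_ae_dom mf ig); exact: aeW. Qed.

Lemma intg_ae_eq f g : measurable_fun setT f -> intg g ->
  (\forall x \ae m, f x = g x) -> intg f.
Proof.
move=> mf ig fg.
have ig' : intg (fun x => `|g x|).
  by have := integrable_norm ig.
by apply: (intg_ae_dom mf ig'); apply: filterS fg => x ->.
Qed.

Lemma intgD f g : intg f -> intg g -> intg (fun x => f x + g x).
Proof. by move=> hf hg; have := integrableD measurableT hf hg. Qed.

Lemma intgZ (a : R) f : intg f -> intg (fun x => a * f x).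
Proof. by move=> hf; have := integrableZl measurableT a hf. Qed.

Lemma intgN f : intg f -> intg (fun x => - f x).
Proof.
move=> /(intgZ (-1)).
by rewrite /intg; under [_ \o _]funext => x /= do rewrite mulN1r.
Qed.

Lemma intgB f g : intg f -> intg g -> intg (fun x => f x - g x).
Proof. by move=> hf /intgN; exact: intgD. Qed.

Lemma RintD f g : intg f -> intg g ->
  \int[m]_x (f x + g x) = \int[m]_x f x + \int[m]_x g x.
Proof. by move=> hf hg; rewrite RintegralD. Qed.

Lemma RintB f g : intg f -> intg g ->
  \int[m]_x (f x - g x) = \int[m]_x f x - \int[m]_x g x.
Proof. by move=> hf hg; rewrite RintegralB. Qed.

Lemma RintZ (a : R) f : intg f ->
  \int[m]_x (a * f x) = a * \int[m]_x f x.
Proof. by move=> hf; rewrite RintegralZl. Qed.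

Lemma Rint_ae_ge0 f : measurable_fun setT f ->
  (\forall x \ae m, 0 <= f x) -> 0 <= \int[m]_x f x.
Proof.
move=> mf f0.
have -> : \int[m]_x f x = \int[m]_x `|f x|.
  apply: Rint_ae_eq => //; first exact: measurableT_comp.
  by apply: filterS f0 => x /ger0_norm ->.
by apply: Rintegral_ge0.
Qed.

Lemma Rint_ae_le f g : intg f -> intg g ->
  (\forall x \ae m, f x <= g x) -> \int[m]_x f x <= \int[m]_x g x.
Proof.
move=> hf hg fg; rewrite -subr_ge0 -RintB//.
apply: Rint_ae_ge0; first exact/intg_meas/intgB.
by apply: filterS fg => x; rewrite subr_ge0.
Qed.

Lemma Rint_le f g : intg f -> intg g ->
  (forall x, f x <= g x) -> \int[m]_x f x <= \int[m]_x g x.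
Proof. by move=> hf hg fg; apply: Rint_ae_le => //; exact: aeW. Qed.

Lemma Rint_ae0 f : intg f -> (\forall x \ae m, 0 <= f x) ->
  \int[m]_x f x <= 0 -> \forall x \ae m, f x = 0.
Proof.
move=> hf f0 f_le0.
have mf := intg_meas hf.
have : \int[m]_x `|f x| = 0.
  apply/eqP; rewrite eq_le Rintegral_ge0 ?andbT//.
  rewrite (le_trans _ f_le0)// le_eqVlt; apply/orP; left; apply/eqP.
  apply: Rint_ae_eq => //; first exact: measurableT_comp.
  by apply: filterS f0 => x /ger0_norm ->.
have /integrableP[mF iF] := hf.
move=> If; have : (\int[m]_x `|(EFin \o f) x| = 0)%E.
  rewrite -[LHS]fineK; first by congr EFin.
  by rewrite ge0_fin_numE// integral_ge0.
move=> /(ae_eq_integral_abs m measurableT mF).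
by apply: filterS => x /= /(_ I) [].
Qed.

Lemma intgM_bdd (a : R) f g : measurable_fun setT g -> intg f ->
  (\forall x \ae m, `|g x| <= a) -> intg (fun x => g x * f x).
Proof.
move=> mg hf ga.
have hf' : intg (fun x => a * `|f x|) by apply: intgZ; exact: integrable_norm.
apply: (intg_ae_dom _ hf').
  by apply: measurable_funM => //; exact: intg_meas hf.
by apply: filterS ga => x ga; rewrite normrM ler_wpM2r.
Qed.

Lemma intg0 : intg (fun=> 0).
Proof. exact: integrable0. Qed.

Lemma intg_cvg (f_ : nat -> X -> R) f g : (forall n, measurable_fun setT (f_ n)) ->
  measurable_fun setT f -> intg g ->
  (\forall x \ae m, (fun n => f_ n x) @ \oo --> f x) ->
  (forall n, \forall x \ae m, `|f_ n x| <= g x) ->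
  (fun n => \int[m]_x f_ n x) @ \oo --> \int[m]_x f x.
Proof.
move=> mf_ mf hg cf dom.
have mF n : measurable_fun setT (EFin \o f_ n) by exact/measurable_EFinP.
have mF' : measurable_fun setT (EFin \o f) by exact/measurable_EFinP.
have [||ig _ h] := @dominated_convergence _ _ _ m setT measurableT
   (fun n => EFin \o f_ n) (EFin \o f) (EFin \o g) mF mF' _ hg.
- apply: filterS cf => x h _; apply/fine_cvgP; split; first exact: nearW.
  exact: h.
- move/ae_foralln : dom; apply: filterS => x h n _; rewrite /= lee_fin; exact: h.
have : (fun n => \int[m]_x (f_ n x)%:E)%E @ \oo --> (\int[m]_x f x)%:E.
  by rewrite fineK//; exact: integrable_fin_num.
by move=> /fine_cvg.
Qed.

(** Monotone convergence in which integrability of the limit is a conclusion, drawn from the uniform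
    bound [c]. It serves to remove the cut-off of a truncated power. *)
Lemma intg_trunc (h : X -> R) (F : nat -> X -> R) (c : R) :
  measurable_fun setT h -> (forall n, intg (F n)) ->
  (forall n x, 0 <= F n x) -> (forall n x, F n x <= F n.+1 x) ->
  (forall x, (fun n => F n x) @ \oo --> h x) ->
  (forall n, \int[m]_x F n x <= c) ->
  intg h /\ \int[m]_x h x <= c.
Proof.
move=> mh hF F0 Fi Fc Fle.
have h0 x : 0 <= h x.
  by rewrite -(cvg_lim _ (Fc x))//; apply: limr_ge; [exact: (cvgP _ (Fc x))|exact: nearW].
have mono := @cvg_monotone_convergence _ _ _ m setT measurableT
   (fun n => EFin \o F n) (fun n => (measurable_EFinP _ _).2 (intg_meas (hF n))).
have {}mono : (\int[m]_x (F n x)%:E @[n --> \oo] --> \int[m]_x (h x)%:E)%E.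
  have -> : (\int[m]_x (h x)%:E = \int[m]_x limn (fun n => (EFin \o F n) x))%E.
    apply: eq_integral => x _; apply/esym/cvg_lim => //.
    apply: cvg_EFin; first exact: nearW.
    exact: Fc.
  apply: mono => //.
  - by move=> n x _; rewrite /= lee_fin.
  - move=> x _; apply/nondecreasing_seqP => n; rewrite /= lee_fin; exact: Fi.
have hle : (\int[m]_x (h x)%:E <= c%:E)%E.
  rewrite -(cvg_lim _ mono)//; apply: lime_le; first exact: (cvgP _ mono).
  apply: nearW => n; have := Fle n; rewrite -lee_fin /Rintegral fineK//.
  exact: integrable_fin_num (hF n).
have hfin : (\int[m]_x (h x)%:E)%E \is a fin_num.
  rewrite ge0_fin_numE ?(le_lt_trans hle) ?ltry//.
  by apply: integral_ge0 => x _; rewrite lee_fin h0.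
split; last by rewrite -lee_fin fineK.
apply/integrableP; split; first exact/measurable_EFinP.
rewrite (le_lt_trans _ (ltry c))// (le_trans _ hle)//.
by rewrite le_eqVlt; apply/orP; left; apply/eqP/eq_integral => x _ /=; rewrite ger0_norm.
Qed.

End IntegralAe.

(** * Energy forms and limits *)

Section L2.
Context {R : realType} {d : measure_display} {X : metricMeasurableType R d}.
Variable m : {finite_measure set X -> \bar R}.
Implicit Types f g h : X -> R.

Definition L2 f : Prop := measurable_fun setT f /\ intg m (fun x => f x ^+ 2).

Definition sqn f : R := \int[m]_x (f x ^+ 2).

Lemma sqn_ge0 f : 0 <= sqn f.
Proof. by apply: Rintegral_ge0 => x _; exact: sqr_ge0. Qed.

Lemma L2_dom f g : measurable_fun setT f -> L2 g ->
  (forall x, `|f x| <= `|g x|) -> L2 f.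
Proof.
move=> mf [mg ig] fg; split => //.
apply: (intg_dom _ ig); first exact: measurable_funX.
move=> x; rewrite normrX -[leRHS]real_normK ?num_real//.
by rewrite lerXn2r ?nnegrE.
Qed.

Lemma L2D f g : L2 f -> L2 g -> L2 (f \+ g).
Proof.
move=> [mf If] [mg Ig]; split; first exact: measurable_funD.
apply: (intg_dom _ (intgD (intgZ 2 If) (intgZ 2 Ig))).
  by apply: measurable_funX; exact: measurable_funD.
move=> x /=; rewrite ger0_norm ?sqr_ge0//.
by have := sqr_ge0 (f x - g x); lra.
Qed.

Lemma L2Z (a : R) f : L2 f -> L2 (a \*o f).
Proof.
move=> [mf If]; split; first by apply: measurable_funM.
have -> : (fun x => (a \*o f) x ^+ 2) = (fun x => a ^+ 2 * f x ^+ 2).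
  by apply/funext => x /=; rewrite exprMn.
exact: intgZ.
Qed.

Lemma sub_fun_lin f g : f \- g = ((-1) \*o g) \+ f.
Proof. by apply/funext => x /=; lra. Qed.

Lemma L2B f g : L2 f -> L2 g -> L2 (f \- g).
Proof. by move=> hf hg; rewrite sub_fun_lin; apply: L2D => //; exact: L2Z. Qed.

Lemma sqnZ (a : R) f : L2 f -> sqn (a \*o f) = a ^+ 2 * sqn f.
Proof.
move=> [mf If]; rewrite /sqn -RintZ//; congr Rintegral.
by apply/funext => x /=; rewrite exprMn.
Qed.

Lemma sqnD_le f g : L2 f -> L2 g -> sqn (f \+ g) <= 2 * sqn f + 2 * sqn g.
Proof.
move=> hf hg; have [_ i] := L2D hf hg; case: hf => mf If; case: hg => mg Ig.
rewrite /sqn -!RintZ// -RintD; try exact: intgZ.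
apply: Rint_le => //; first by apply: intgD; exact: intgZ.
by move=> x /=; have := sqr_ge0 (f x - g x); lra.
Qed.

Lemma sqn_ae0 f g : L2 f -> L2 g -> sqn (f \- g) <= 0 -> \forall x \ae m, f x = g x.
Proof.
move=> hf hg h; have [_ i] := L2B hf hg.
have := Rint_ae0 i _ h; have h0 : \forall x \ae m, 0 <= (f \- g) x ^+ 2.
  by apply: aeW => x; exact: sqr_ge0.
move=> /(_ h0); apply: filterS => x /= /eqP.
by rewrite sqrf_eq0 subr_eq0 => /eqP.
Qed.

Lemma sqn_triangle f g h : L2 f -> L2 g -> L2 h ->
  sqn (f \- h) <= 2 * sqn (f \- g) + 2 * sqn (g \- h).
Proof.
move=> hf hg hh.
have -> : f \- h = (f \- g) \+ (g \- h) by apply/funext => x /=; lra.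
by apply: sqnD_le; exact: L2B.
Qed.

Lemma sqnC f g : sqn (f \- g) = sqn (g \- f).
Proof. by congr Rintegral; apply/funext => x /=; rewrite -sqrrN opprB. Qed.

Lemma intg_cst (c : R) : intg m (fun=> c).
Proof.
apply/integrableP; split; first exact/measurable_EFinP.
rewrite integral_cst// lte_mul_pinfty//.
exact: fin_num_fun_lty (fin_num_measure m).
Qed.

Lemma L2_bdd (c : R) f : measurable_fun setT f -> (forall x, `|f x| <= c) -> L2 f.
Proof.
move=> mf fc; split => //; apply: (intg_dom _ (intg_cst (c ^+ 2))).
  exact: measurable_funX.
by move=> x; rewrite normrX lerXn2r ?nnegrE// (le_trans _ (fc x)).
Qed.

End L2.

Lemma inv_small {R : realType} (e : R) : 0 < e ->
  exists N : nat, forall n, (N <= n)%N -> harmonic n < e.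
Proof.
rewrite /harmonic/= => e0; exists (Num.truncn e^-1) => n hn.
rewrite invf_plt ?posrE ?ltr0n//.
have := truncnS_gt e^-1; move/lt_le_trans; apply.
by rewrite ler_nat.
Qed.

(** No sign of [C] is assumed: if x were positive, e = 1 would force C > 0, and then e = x / (2 * C)
    gives a contradiction. *)
Lemma le0_addgt0 {R : realType} (x C : R) : (forall e, 0 < e -> x <= C * e) -> x <= 0.
Proof.
move=> h; rewrite leNgt; apply/negP => x0.
have C0 : 0 < C + x.
  have := h 1 ltr01; lra.
have C1 : 0 < C by have := h 1 ltr01; lra.
have /h : 0 < x / (2 * C) by rewrite divr_gt0// mulr_gt0.
have -> : C * (x / (2 * C)) = x / 2 by field; rewrite gt_eqF.
lra.
Qed.

(** * Quadratic calculus of a Dirichlet form and limits under bounded energy *)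

Section Form.
Context {R : realType} {d : measure_display} {X : metricMeasurableType R d}.
Variable m : {finite_measure set X -> \bar R}.
Variables (D : set (X -> R)) (E : (X -> R) -> (X -> R) -> R).
Hypothesis hdf : symmetric_dirichlet_form m D E.
Implicit Types (u v w f : X -> R).
Local Notation sqn := (sqn m).
Local Notation L2 := (L2 m).

Lemma DL2 u : D u -> L2 u.
Proof.
move=> Du; split; first exact: (fs_meas (df_space hdf)).
exact: Lfun2_integrable_sqr (df_L2 hdf Du).
Qed.

Lemma Dmeas u : D u -> measurable_fun setT u.
Proof. exact: (fs_meas (df_space hdf)). Qed.

Lemma D0 : D (cst 0). Proof. exact: (fs_0 (df_space hdf)). Qed.

Lemma DD u v : D u -> D v -> D (u \+ v).
Proof.
move=> Du Dv; have := fs_lin (df_space hdf) 1 Du Dv.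
by congr D; apply/funext => x /=; rewrite mul1r.
Qed.

Lemma DZ (a : R) u : D u -> D (a \*o u).
Proof.
move=> Du; have := fs_lin (df_space hdf) a Du D0.
by congr D; apply/funext => x /=; rewrite addr0.
Qed.

Lemma DB u v : D u -> D v -> D (u \- v).
Proof. by move=> Du Dv; rewrite sub_fun_lin; apply: DD => //; exact: DZ. Qed.

Lemma EDl u v w : D u -> D v -> D w -> E (u \+ v) w = E u w + E v w.
Proof.
move=> Du Dv Dw; rewrite -[E u w]mul1r -(df_lin hdf)//; congr E.
by apply/funext => x /=; rewrite mul1r.
Qed.

Lemma E0l w : D w -> E (cst 0) w = 0.
Proof.
move=> Dw; have := EDl D0 D0 Dw.
have -> : cst 0 \+ cst 0 = cst 0 :> (X -> R) by apply/funext => x /=; rewrite addr0.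
lra.
Qed.

Lemma EZl (a : R) u w : D u -> D w -> E (a \*o u) w = a * E u w.
Proof.
move=> Du Dw; rewrite -[RHS]addr0 -(E0l Dw) -(df_lin hdf)//; last exact: D0.
by congr E; apply/funext => x /=; rewrite addr0.
Qed.

Lemma EDr u v w : D u -> D v -> D w -> E w (u \+ v) = E w u + E w v.
Proof.
move=> Du Dv Dw; rewrite (df_sym hdf) ?EDl//; last exact: DD.
by rewrite [E u w](df_sym hdf)// [E v w](df_sym hdf).
Qed.

Lemma EZr (a : R) u w : D u -> D w -> E w (a \*o u) = a * E w u.
Proof.
by move=> Du Dw; rewrite (df_sym hdf) ?EZl//; [rewrite (df_sym hdf)|exact: DZ].
Qed.

Lemma EZZ (a : R) u : D u -> E (a \*o u) (a \*o u) = a ^+ 2 * E u u.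
Proof. by move=> Du; rewrite EZl// ?EZr//; [ring|exact: DZ]. Qed.

Lemma EDD u v : D u -> D v -> E (u \+ v) (u \+ v) = E u u + 2 * E u v + E v v.
Proof.
move=> Du Dv; rewrite EDl// ?EDr//; try exact: DD.
by rewrite (df_sym hdf Dv Du); ring.
Qed.

Lemma EBB u v : D u -> D v -> E (u \- v) (u \- v) = E u u - 2 * E u v + E v v.
Proof.
move=> Du Dv; rewrite sub_fun_lin EDD//; last exact: DZ.
by rewrite EZZ// EZl// (df_sym hdf Dv Du); ring.
Qed.

Lemma EC u v : D u -> D v -> E (u \- v) (u \- v) = E (v \- u) (v \- u).
Proof. by move=> Du Dv; rewrite !EBB// (df_sym hdf Dv Du); ring. Qed.

Lemma EDD_le u v : D u -> D v -> E (u \+ v) (u \+ v) <= 2 * E u u + 2 * E v v.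
Proof.
move=> Du Dv; rewrite EDD//; have := df_ge0 hdf (DB Du Dv); rewrite EBB//; lra.
Qed.

Lemma EBB_le u v : D u -> D v -> E (u \- v) (u \- v) <= 2 * E u u + 2 * E v v.
Proof.
move=> Du Dv; rewrite EBB//; have := df_ge0 hdf (DD Du Dv); rewrite EDD//; lra.
Qed.

Lemma E_ae u v : D u -> D v -> (\forall x \ae m, u x = v x) -> E u u = E v v.
Proof.
move=> Du Dv uv; have uv' := (eq_aeP _ _ _).2 uv.
by rewrite (df_ae hdf Du Dv Du uv') (df_sym hdf)// (df_ae hdf Du Dv Dv uv').
Qed.

Lemma energy_lt u (e : R) : 0 < e -> D u -> energy_norm m E u < e ->
  E u u < e ^+ 2 /\ sqn u < e ^+ 2.
Proof.
move=> e0 Du; rewrite /energy_norm -/(sqn u) => h.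
have hE := df_ge0 hdf Du; have hs := sqn_ge0 m u.
have : E u u + sqn u < e ^+ 2.
  rewrite -(@sqr_sqrtr _ (E u u + sqn u)) ?addr_ge0//.
  by rewrite ltrXn2r// ?nnegrE ?sqrtr_ge0// ltW.
by move=> {}h; split; lra.
Qed.

Lemma lt_energy u (e : R) : 0 < e -> D u -> E u u + sqn u < e ^+ 2 ->
  energy_norm m E u < e.
Proof.
move=> e0 Du h; rewrite /energy_norm -/(sqn u).
have hE := df_ge0 hdf Du; have hs := sqn_ge0 m u.
rewrite -(@ltr_pXn2r _ 2) ?nnegrE ?sqrtr_ge0 ?(ltW e0)//.
by rewrite sqr_sqrtr ?addr_ge0.
Qed.

(** The parallelogram law, homogeneity and domination by the energy are what an argument with
    midpoints consumes. The instances are 0, when only membership in [D] is sought, and the integral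
    of Gamma over a set. *)
Record quad_form (q : (X -> R) -> R) (C : R) : Prop := QuadForm {
  qf_ge0 : forall u, D u -> 0 <= q u ;
  qf_par : forall u v, D u -> D v -> q (u \+ v) + q (u \- v) = 2 * q u + 2 * q v ;
  qf_Z : forall a u, D u -> q (a \*o u) = a ^+ 2 * q u ;
  qf_le : forall u, D u -> q u <= C * E u u
}.

Lemma quad_form0 : quad_form (fun=> 0) 1.
Proof.
split => // [u v _ _|a u _|u Du]; first by rewrite !mulr0.
  by rewrite mulr0.
by rewrite mul1r (df_ge0 hdf).
Qed.

Lemma E_par u v : D u -> D v ->
  E (u \+ v) (u \+ v) + E (u \- v) (u \- v) = 2 * E u u + 2 * E v v.
Proof. by move=> Du Dv; rewrite EDD// EBB//; ring. Qed.

(** E(u - v) = 2 E(u) + 2 E(v) - 4 E((u + v) / 2), here at most 2 a + 6 b: the error b serves both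
    for v and for the lower bound at the midpoint. *)
Lemma E_mid_gap u v (e a b : R) : D u -> D v -> 0 <= a ->
  E u u <= e + a -> E v v <= e + b ->
  e - b <= E (2^-1 \*o (u \+ v)) (2^-1 \*o (u \+ v)) ->
  E (u \- v) (u \- v) <= 6 * (a + b).
Proof.
move=> Du Dv a0; rewrite EZZ; last exact: DD.
have := E_par Du Dv; lra.
Qed.

(* A substitute for weak compactness: among the elements [v] of [D] with
   [E v v <= M] that are [e]-close to [u] in L^2 and satisfy [q v <= e], take
   almost minimisers of the energy. As [e] tends to 0 they form, by the
   parallelogram law, a Cauchy sequence for the energy norm. *)
Section Limit.
Variables (q : (X -> R) -> R) (C M : R) (u : X -> R).
Hypotheses (hq : quad_form q C) (uL2 : L2 u).

Let near_u (e : R) v := [/\ D v, E v v <= M, sqn (v \- u) <= e & q v <= e].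

Hypothesis hu : forall e, 0 < e -> exists v, near_u e v.

Let near_u_mid e v w : near_u e v -> near_u e w -> near_u e (2^-1 \*o (v \+ w)).
Proof.
move=> [Dv Ev sv qv] [Dw Ew sw qw]; split.
- exact/DZ/DD.
- rewrite EZZ//; last exact: DD.
  have := E_par Dv Dw; have := df_ge0 hdf (DB Dv Dw); lra.
- have -> : (2^-1 \*o (v \+ w)) \- u = 2^-1 \*o ((v \- u) \+ (w \- u)).
    by apply/funext => x /=; field.
  have [hv hw] := (DL2 Dv, DL2 Dw).
  rewrite sqnZ; last by apply: L2D; exact: L2B.
  have := sqnD_le (L2B hv uL2) (L2B hw uL2); lra.
- rewrite (qf_Z hq); last exact: DD.
  have := qf_par hq Dv Dw; have := qf_ge0 hq (DB Dv Dw); lra.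
Qed.

Let near_u_le e e' v : e <= e' -> near_u e v -> near_u e' v.
Proof. by move=> ee [? ? ? ?]; split => //; lra. Qed.

Let limit_energy : exists es : R, forall e, 0 < e -> exists r,
  [/\ 0 < r, r <= e, forall v, near_u r v -> es - e <= E v v &
      exists2 v, near_u r v & E v v <= es + e].
Proof.
(* The infimum of the energy over the elements [r]-near u increases as r decreases and never exceeds
   M; [sup S] is its limit as r tends to 0. *)
pose S := [set a : R | exists2 r, 0 < r & forall v, near_u r v -> a <= E v v].
have hS : has_sup S.
  split; first by exists 0, 1 => // v [Dv _ _ _]; exact: (df_ge0 hdf).
  exists M => a [r r0 h]; have [v hv] := hu r0.
  by rewrite (le_trans (h _ hv))//; case: hv.
exists (sup S) => e e0.
have [a [r r0 hr] ha] := sup_adherent e0 hS.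
exists (Num.min r e); split.
- by rewrite lt_min r0.
- by rewrite ge_min lexx orbT.
- move=> v /near_u_le -/(_ r); rewrite ge_min lexx => /(_ isT) /hr; lra.
- have mre : 0 < Num.min r e by rewrite lt_min r0.
  apply: contrapT => h.
  have /(ub_le_sup hS.2) : S (sup S + e) => [|]; last lra.
  exists (Num.min r e) => // v hv; rewrite leNgt; apply/negP => hlt.
  by apply: h; exists v => //; exact: ltW.
Qed.

Let limit_pt : exists2 w, D w & forall e, 0 < e ->
  exists v, [/\ near_u e v, E (v \- w) (v \- w) <= e & sqn (v \- w) <= e].
Proof.
have [es hes] := limit_energy.
have [r [v hrv]] : exists (r : nat -> R) (v : nat -> X -> R), forall n,
    [/\ 0 < r n, r n <= harmonic n,
     forall w, near_u (r n) w -> es - harmonic n <= E w w,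
     near_u (r n) (v n) & E (v n) (v n) <= es + harmonic n].
  have /choice[rv hrv] : forall n : nat, exists rv : R * (X -> R),
    [/\ 0 < rv.1, rv.1 <= harmonic n,
     forall v, near_u rv.1 v -> es - harmonic n <= E v v,
     near_u rv.1 rv.2 & E rv.2 rv.2 <= es + harmonic n].
    move=> n; have [r [r0 re h1 [v hv h2]]] := hes _ (harmonic_gt0 n).
    by exists (r, v).
  by exists (fun n => (rv n).1), (fun n => (rv n).2).
have Dv n : D (v n) by have [_ _ _ []] := hrv n.
(* If r i <= r j, both elements are [r j]-near u, hence so is their midpoint, whose energy is
   therefore at least es - harmonic j. *)
have key i j : E (v i \- v j) (v i \- v j) <= 6 * (harmonic i + harmonic j).
  wlog rij : i j / r i <= r j.
    move=> H; have [/H//|/ltW/H] := leP (r i) (r j).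
    by rewrite EC// [_ + harmonic j]addrC.
  have [_ _ _ ni ei] := hrv i; have [_ _ lj nj ej] := hrv j.
  apply: (E_mid_gap (Dv i) (Dv j) _ ei ej); first exact: harmonic_ge0.
  exact: lj (near_u_mid (near_u_le rij ni) nj).
have keys i j : sqn (v i \- v j) <= 2 * (harmonic i + harmonic j).
  have [_ ri _ [_ _ si _] _] := hrv i; have [_ rj _ [_ _ sj _] _] := hrv j.
  have := sqn_triangle (DL2 (Dv i)) uL2 (DL2 (Dv j)); rewrite [sqn (u \- _)]sqnC; lra.
have vC : cauchy_seq (energy_norm m E) v.
  move=> e e0; have /inv_small[N hN] : 0 < e ^+ 2 / 16 by rewrite divr_gt0 ?exprn_gt0.
  exists N => i j /hN hi /hN hj; apply: lt_energy => //; first exact: DB.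
  have := key i j; have := keys i j; lra.
have [w Dw vw] := df_closed hdf Dv vC.
exists w => // e e0.
pose e1 := Num.min e 1; have e10 : 0 < e1 by rewrite lt_min e0 ltr01.
have e1e : e1 ^+ 2 <= e.
  rewrite expr2 (le_trans (ler_wpM2r (ltW e10) (_ : _ <= 1)))// ?mul1r.
  + by rewrite ge_min lexx orbT.
  + by rewrite ge_min lexx.
move/cvgrPdist_lt : vw => /(_ e1 e10) [N _ hN].
have [N' hN'] := inv_small e0.
exists (v (maxn N N')); have [r0 rN _ nv _] := hrv (maxn N N').
have := hN (maxn N N') (leq_maxl _ _); rewrite sub0r normrN.
move=> /(le_lt_trans (ler_norm _)) /(energy_lt e10) [|hE hs]; first exact: DB.
split; [|lra|lra].
apply: near_u_le nv; rewrite (le_trans rN)// ltW//.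
by apply: hN'; rewrite leq_maxr.
Qed.

(** The almost minimisers converge in energy norm to some w, and w = u a.e. because they also
    converge to u in L^2. Being dominated by the energy and obeying the parallelogram law, [q] then
    passes to the limit. The factor 2 comes from E(v + (u - v)) <= 2 E(v) + 2 E(u - v). *)
Lemma form_limit : [/\ D u, E u u <= 2 * M & q u = 0].
Proof.
have [w Dw hw] := limit_pt.
have uw : \forall x \ae m, w x = u x.
  apply: sqn_ae0 => //; first exact: DL2.
  apply: (@le0_addgt0 _ _ 4) => e /hw [v [[Dv _ vu _] _ vw]].
  have := sqn_triangle (DL2 Dw) (DL2 Dv) uL2; rewrite [sqn (w \- v)]sqnC; lra.
have Du : D u.
  by apply: (fs_ae (df_space hdf) Dw) => //; [case: uL2|exact/eq_aeP].
have hw' e : 0 < e -> exists v, near_u e v /\ E (v \- u) (v \- u) <= e.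
  move=> /hw [v [hv hE _]]; exists v; split => //.
  have Dv : D v by case: hv.
  rewrite (@E_ae (v \- u) (v \- w)) ?DB//; try exact: DB.
  by apply: filterS uw => x /= ->.
have uv v : u = v \+ (u \- v) by apply/funext => x /=; lra.
split => //.
- rewrite -subr_le0; apply: (@le0_addgt0 _ _ 2) => e /hw'[v [[Dv Ev _ _] Euv]].
  have := EDD_le Dv (DB Du Dv); rewrite -uv [E (u \- v) _]EC//; lra.
- apply/eqP; rewrite eq_le (qf_ge0 hq Du) andbT.
  apply: (@le0_addgt0 _ _ (2 + 2 * `|C|)) => e e0; have [v [[Dv Ev _ qv] Euv]] := hw' _ e0.
  have h1 := qf_par hq Dv (DB Du Dv); rewrite -uv in h1.
  have h2 := qf_ge0 hq (DB Dv (DB Du Dv)).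
  have h3 := qf_le hq (DB Du Dv); rewrite EC// in h3.
  have h4 : C * E (v \- u) (v \- u) <= `|C| * e.
    rewrite (le_trans (ler_norm _))// normrM ler_wpM2l//.
    by rewrite ger0_norm// (df_ge0 hdf)//; exact: DB.
  lra.
Qed.
End Limit.

End Form.

(** * Truncations in the domain *)

Section Truncation.
Context {R : realType} {d : measure_display} {X : metricMeasurableType R d}.
Variable m : {finite_measure set X -> \bar R}.
Variables (D : set (X -> R)) (E : (X -> R) -> (X -> R) -> R).
Hypothesis hdf : symmetric_dirichlet_form m D E.
Implicit Types (u v w f : X -> R) (a c e : R).

(** For a >= 0, [excess] and [cut] are the two parts (u - a)^+ and min(u^+, a) of u^+ at level a;
    they add up to u^+ ([exc_cut]). *)
Definition excess a u : X -> R := fun x => Num.max (u x - a) 0.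
Definition cut c u : X -> R := fun x => Num.min (Num.max (u x) 0) c.

Lemma exc_ge0 a u x : 0 <= excess a u x.
Proof. by rewrite /excess le_max lexx orbT. Qed.

Lemma exc_lt a u x : u x <= a -> excess a u x = 0.
Proof. by move=> h; rewrite /excess max_r// subr_le0. Qed.

Lemma exc_gt a u x : a <= u x -> excess a u x = u x - a.
Proof. by move=> h; rewrite /excess max_l// subr_ge0. Qed.

Lemma exc_cut a u x : 0 <= a -> excess a u x = excess 0 u x - cut a u x.
Proof.
move=> a0; rewrite /excess /cut subr0 /Num.min /Num.max.
by do ! case: ifPn => //; rewrite ?(ltNge, negbK) => *; lra.
Qed.

Lemma meas_exc a u : measurable_fun setT u -> measurable_fun setT (excess a u).
Proof.
move=> mu; apply: measurable_maxr => //; exact: measurable_funB.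
Qed.

Lemma meas_cut c u : measurable_fun setT u -> measurable_fun setT (cut c u).
Proof.
by move=> mu; apply: measurable_minr => //; exact: measurable_maxr.
Qed.

Lemma cut_D c u : 0 < c -> D u -> D (cut c u) /\ E (cut c u) (cut c u) <= E u u.
Proof.
move=> c0 Du; have := df_markov hdf (DZ hdf c^-1 Du).
set w := _ \min _ => -[Dw Ew].
have -> : cut c u = c \*o w.
  apply/funext => x; rewrite /w /cut /=.
  rewrite minr_pMr ?(ltW c0)// maxr_pMr ?(ltW c0)// mulrA divff ?gt_eqF//.
  by rewrite mul1r mulr0 mulr1.
split; first exact: (DZ hdf).
rewrite (EZZ hdf)//; apply: (le_trans (ler_wpM2l _ Ew)); first exact: sqr_ge0.
rewrite (EZZ hdf)// mulrA -exprMn divff ?gt_eqF//.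
by rewrite expr1n mul1r.
Qed.

(** The truncations min(u^+, n + 1) have energy at most E u u and tend to u^+ in L^2, so
    [form_limit] applies with q = 0; the factor 2 is inherited from it. *)
Lemma exc0_D u : D u -> D (excess 0 u) /\ E (excess 0 u) (excess 0 u) <= 2 * E u u.
Proof.
move=> Du; have Lu := DL2 hdf Du; have mu := Dmeas hdf Du.
have [] // := @form_limit _ _ _ m D E hdf (fun=> 0) 1 (E u u) (excess 0 u) (quad_form0 hdf).
  apply: (L2_dom _ Lu) => [|x]; first exact: meas_exc.
  rewrite ger0_norm ?exc_ge0// /excess subr0 ge_max normr_ge0 andbT.
  exact: ler_norm.
move=> e e0.
suff [n hn] : exists n : nat, sqn m (cut n.+1%:R u \- excess 0 u) <= e.
  exists (cut n.+1%:R u).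
  have [|Dc Ec] := @cut_D n.+1%:R _ _ Du; first by rewrite ltr0n.
  by split => //; exact: ltW.
have h0 : \int[m]_x (0 : R) = 0 by rewrite Rintegral_cst// mul0r.
suff : (fun n : nat => sqn m (cut n.+1%:R u \- excess 0 u)) @ \oo --> (0 : R).
  move=> /cvgrPdist_lt /(_ e e0) [N _ /(_ N (leqnn _))]; rewrite sub0r normrN => h.
  by exists N; rewrite ltW// (le_lt_trans _ h)// ler_norm.
rewrite -[X in _ --> X]h0.
apply: (@intg_cvg _ _ _ m (fun n x => (cut n.+1%:R u \- excess 0 u) x ^+ 2) (fun=> 0)
  (fun x => u x ^+ 2)).
- move=> n; apply: measurable_funX; apply: measurable_funB; [exact: meas_cut|exact: meas_exc].
- exact: measurable_cst.
- by case: Lu.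
- apply: aeW => x; apply: cvg_near_cst; near=> n; rewrite /=.
  suff -> : cut n.+1%:R u x = excess 0 u x by rewrite subrr expr0n.
  rewrite /cut /excess subr0 min_l// ge_max ler0n andbT.
  rewrite (le_trans (ler_norm _))//.
  near: n; exists (Num.truncn `|u x|) => // n /= hn.
  by rewrite (le_trans (ltW (truncnS_gt _)))// ler_nat ltnS.
- move=> n; apply: aeW => x.
  rewrite ger0_norm ?sqr_ge0//= /cut /excess subr0.
  have n0 : 0 < n.+1%:R :> R by rewrite ltr0n.
  move: n0; move: (n.+1%:R) => M M0.
  rewrite /Num.min /Num.max; do ! case: ifPn => //; rewrite ?(ltNge, negbK) => *; nra.
Unshelve. all: by end_near.
Qed.

(** (u - a)^+ is the difference of u^+ and [cut a u], of energies at most 2 E u u and E u u; the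
    constant is 2 * 2 + 2 * 1. *)
Lemma exc_D a u : 0 <= a -> D u -> D (excess a u) /\ E (excess a u) (excess a u) <= 6 * E u u.
Proof.
move=> a0 Du; have [De Ee] := exc0_D Du; have Eu := df_ge0 hdf Du.
move: a0; rewrite le_eqVlt => /predU1P[<-|a0]; first by split => //; lra.
have [Dc Ec] := cut_D a0 Du.
have -> : excess a u = excess 0 u \- cut a u.
  by apply/funext => x /=; apply: exc_cut; exact: ltW.
split; first exact: (DB hdf).
have := EBB_le hdf De Dc; lra.
Qed.

(** The square root of E is a seminorm. The growth n^2 is compensated by the mesh of order 1/n when
    the sum is a Riemann sum. *)
Lemma D_sum (n : nat) (w : nat -> X -> R) (B : R) : 0 <= B ->
  (forall i, D (w i) /\ E (w i) (w i) <= B) ->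
  let s := fun x => \sum_(i < n) w i x in D s /\ E s s <= n%:R ^+ 2 * B.
Proof.
move=> B0 hw; elim: n => [|n [Ds Es]].
  have -> : (fun x => \sum_(i < 0) w i x) = cst 0.
    by apply/funext => x; rewrite big_ord0.
  by split; [exact: (D0 hdf)|rewrite (E0l hdf (D0 hdf)) expr0n/= mul0r].
have -> : (fun x => \sum_(i < n.+1) w i x) = (fun x => \sum_(i < n) w i x) \+ w n.
  by apply/funext => x; rewrite big_ord_recr.
move: Ds Es; set s := (fun x => _) => Ds Es.
have [Dn En] := hw n.
split; first exact: (DD hdf).
have [n0|n0] := posnP n.
  rewrite (_ : s \+ w n = w n) ?n0 ?expr1n ?mul1r -?n0//.
  by apply/funext => x; rewrite /s n0 /= big_ord0 add0r.
(* Non-negativity of E(s - n w) bounds 2 n E(s, w) by E(s, s) + n^2 E(w, w). Since the factor n has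
   to be cancelled, n = 0 was treated apart. *)
have h := df_ge0 hdf (DB hdf Ds (DZ hdf n%:R Dn)).
rewrite (EBB hdf Ds (DZ hdf _ Dn)) (EZZ hdf _ Dn) (EZr hdf _ Dn Ds) in h.
rewrite (EDD hdf)// -[n.+1%:R]natr1.
have {n0} : 0 < n%:R :> R by rewrite ltr0n.
move: (n%:R) (E s s) (E s (w n)) (E (w n) (w n)) Es En h => N a b c Es En h N0.
rewrite -(ler_pM2l N0).
have h1 : N * c <= N * B by rewrite ler_pM2l.
have h2 : N ^+ 2 * c <= N ^+ 2 * B by rewrite ler_pM2l// exprn_gt0.
have h3 : N * a <= N * (N ^+ 2 * B) by rewrite ler_pM2l.
lra.
Qed.

(** A left Riemann sum of mesh h for z^2 = 2 \int_0^z (z - s) ds. *)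
Lemma sum_exc_sqr (n : nat) (h z : R) : 0 <= h -> 0 <= z -> z <= n%:R * h ->
  `|2 * h * (\sum_(i < n) Num.max (z - i%:R * h) 0) - z ^+ 2| <= n%:R * h ^+ 2.
Proof.
move=> h0 z0 zn.
(* After k steps the part ((z - k h)^+)^2 of z^2 is still to be accounted for; each step adds an
   error between 0 and h^2. *)
have key k : `|2 * h * (\sum_(i < k) Num.max (z - i%:R * h) 0) - z ^+ 2
    + (Num.max (z - k%:R * h) 0) ^+ 2| <= k%:R * h ^+ 2.
  elim: k => [|k IH].
    by rewrite big_ord0 mulr0 mul0r subr0 max_l// sub0r addNr normr0 mul0r.
  rewrite big_ord_recr /= -[k.+1%:R]natr1 [leRHS]mulrDl mul1r mulrDr.
  have -> : z - (k%:R + 1) * h = (z - k%:R * h) - h by ring.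
  move: IH; move: (\sum_(i < k) _) (z - k%:R * h) (k%:R * h ^+ 2) => A t B IH.
  have : 0 <= 2 * h * Num.max t 0 - Num.max t 0 ^+ 2 + Num.max (t - h) 0 ^+ 2 <= h ^+ 2.
    have [t1|t1] := leP t 0; have [t2|t2] := leP (t - h) 0;
      by apply/andP; split; nra.
  move: IH; move: (Num.max t 0) (Num.max (t - h) 0) => a b.
  by rewrite !ler_norml => /andP[h1 h2] /andP[h3 h4]; apply/andP; split; lra.
have := key n; rewrite [X in _ + X ^+ 2]max_r ?subr_le0//.
by rewrite expr0n addr0.
Qed.

End Truncation.

(** * Squares of bounded non-negative elements of the domain *)

Section Square.
Context {R : realType} {d : measure_display} {X : metricMeasurableType R d}.
Variable m : {finite_measure set X -> \bar R}.
Variables (D : set (X -> R)) (E : (X -> R) -> (X -> R) -> R).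
Hypothesis hdf : symmetric_dirichlet_form m D E.

(* Riemann sums of u^2 = 2 \int_0^c (u - s)^+ ds have bounded energy. *)
Lemma sqr_D (c : R) (u : X -> R) : D u -> (forall x, 0 <= u x <= c) -> D (u \* u).
Proof.
move=> Du uc.
have [c0|c0] := leP c 0.
  have -> : u \* u = 0 \*o u.
    apply/funext => x /=; have /andP[h1 h2] := uc x.
    have -> : u x = 0 by lra.
    by rewrite mulr0.
  exact: (DZ hdf).
have Eu := df_ge0 hdf Du.
have mu := Dmeas hdf Du.
have [] // := @form_limit _ _ _ m D E hdf (fun=> 0) 1 (24 * c ^+ 2 * E u u) (u \* u)
  (quad_form0 hdf).
  apply: (L2_bdd m (c := c ^+ 2)) => [|x /=]; first exact: measurable_funM.
  have /andP[h1 h2] := uc x.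
  by rewrite normrM ger0_norm//; nra.
move=> e e0.
(* The Riemann sum differs from u^2 by at most n h^2 = c^2 / n everywhere, so K / n^2 bounds the
   square of their L^2 distance. *)
pose K := \int[m]_x (c ^+ 4).
have K0 : 0 <= K by apply: Rintegral_ge0 => x _; rewrite exprn_ge0// ltW.
have [n [hn n0]] : exists n : nat, K / n%:R ^+ 2 <= e /\ (0 < n)%N.
  have /inv_small[N /(_ N (leqnn _))] : 0 < e / (K + 1) by rewrite divr_gt0//; lra.
  rewrite ltr_pdivlMr; last lra.
  rewrite /harmonic/= => h; exists N.+1; split => //.
  have N0 : 0 < N.+1%:R :> R by rewrite ltr0n.
  have h1 : N.+1%:R^-1 <= 1 :> R by rewrite invf_le1// ler1n.
  have h2 : 0 < N.+1%:R^-1 :> R by rewrite invr_gt0.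
  rewrite -exprVn; move: h h1 h2; move: (N.+1%:R^-1) => a h h1 h2; nra.
pose h := c / n%:R.
have n0' : 0 < n%:R :> R by rewrite ltr0n.
have h0 : 0 < h by rewrite divr_gt0.
have nh : n%:R * h = c by rewrite mulrC divfK// gt_eqF.
have hw i : D (excess (i%:R * h) u) /\
    E (excess (i%:R * h) u) (excess (i%:R * h) u) <= 6 * E u u.
  by apply: (exc_D hdf) => //; rewrite mulr_ge0// ltW.
have [|Ds Es] := D_sum hdf n _ hw; first by lra.
move: Ds Es; set s := (fun x => _) => Ds Es.
exists ((2 * h) \*o s); split => //.
- exact: (DZ hdf).
- rewrite (EZZ hdf)// (le_trans (ler_wpM2l _ Es)) ?sqr_ge0//.
  have -> : (2 * h) ^+ 2 * (n%:R ^+ 2 * (6 * E u u)) = 24 * (n%:R * h) ^+ 2 * E u u by ring.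
  by rewrite nh.
- apply: le_trans hn.
  have -> : K / n%:R ^+ 2 = \int[m]_x ((n%:R * h ^+ 2) ^+ 2).
    rewrite /K !Rintegral_cst// mulrAC; congr (_ * _).
    by rewrite -nh; field; rewrite gt_eqF.
  have Lu : L2 m (((2 * h) \*o s) \- (u \* u)).
    apply: L2B; first exact: (DL2 hdf (DZ hdf _ Ds)).
    apply: (L2_bdd m (c := c ^+ 2)) => [|x /=]; first exact: measurable_funM.
    have /andP[h1 h2] := uc x.
    by rewrite normrM ger0_norm//; nra.
  apply: Rint_le; [by case: Lu|exact: intg_cst|move=> x /=].
  rewrite -real_normK ?num_real// lerXn2r ?nnegrE//.
    by rewrite mulr_ge0// ?sqr_ge0// ltW.
  have /andP[h1 h2] := uc x; rewrite -expr2.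
  by apply: sum_exc_sqr => //; rewrite ?nh// ltW.
- exact: ltW.
Qed.

End Square.

(** * Slopes *)

Section Gamma.
Context {R : realType} {d : measure_display} {X : metricMeasurableType R d}.
Variable m : {finite_measure set X -> \bar R}.
Variables (D : set (X -> R)) (E : (X -> R) -> (X -> R) -> R).
Hypothesis hdf : symmetric_dirichlet_form m D E.
Hypothesis hloc : strongly_local m D E.
Variable G : (X -> R) -> (X -> R) -> (X -> R).
Hypothesis hcdc : carre_du_champ m D E G.
Implicit Types (u v w f : X -> R) (a c e : R).

(** The analogue of |grad u|. Where [G u u] happens to be negative, on a null set, its value is
    0. *)
Definition slope u : X -> R := fun x => Num.sqrt (G u u x).

Lemma slope_ge0 u x : 0 <= slope u x. Proof. exact: sqrtr_ge0. Qed.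

Lemma G_intg u v : D u -> D v -> intg m (G u v).
Proof. by move=> Du Dv; apply/Lfun1_integrable; exact: (cdc_L1 hcdc). Qed.

Lemma G_meas u v : D u -> D v -> measurable_fun setT (G u v).
Proof. by move=> Du Dv; exact: intg_meas (G_intg Du Dv). Qed.

Lemma slope_meas u : D u -> measurable_fun setT (slope u).
Proof.
move=> Du; apply: (measurableT_comp (continuous_measurable_fun (@sqrt_continuous R))).
exact: G_meas.
Qed.

Lemma E_G u v : D u -> D v -> E u v = 2^-1 * \int[m]_x (G u v x).
Proof. exact: (cdc_energy hcdc). Qed.

Lemma slopeE u : D u -> \forall x \ae m, slope u x ^+ 2 = G u u x.
Proof. by move=> Du; apply: filterS (cdc_ge0 hcdc Du) => x h; rewrite sqr_sqrtr. Qed.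

Lemma G_sym u v : D u -> D v -> \forall x \ae m, G u v x = G v u x.
Proof. by move=> Du Dv; apply/eq_aeP; exact: (cdc_sym hcdc). Qed.

Lemma G_lin a u v w : D u -> D v -> D w ->
  \forall x \ae m, G ((a \*o u) \+ v) w x = a * G u w x + G v w x.
Proof. by move=> Du Dv Dw; apply/eq_aeP; exact: (cdc_lin hcdc). Qed.

Lemma GDl u v w : D u -> D v -> D w ->
  \forall x \ae m, G (u \+ v) w x = G u w x + G v w x.
Proof.
move=> Du Dv Dw; have := G_lin 1 Du Dv Dw.
have -> : (1 \*o u) \+ v = u \+ v by apply/funext => x /=; rewrite mul1r.
by apply: filterS => x ->; rewrite mul1r.
Qed.

Lemma GBl u v w : D u -> D v -> D w ->
  \forall x \ae m, G (u \- v) w x = G u w x - G v w x.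
Proof.
move=> Du Dv Dw; have := G_lin (-1) Dv Du Dw; rewrite -sub_fun_lin.
by apply: filterS => x ->; rewrite mulN1r addrC.
Qed.

Lemma GZl a u w : D u -> D w -> \forall x \ae m, G (a \*o u) w x = a * G u w x.
Proof.
move=> Du Dw; have DZu := DZ hdf a Du.
have := G_lin a Du DZu Dw; have := GDl DZu DZu Dw.
by apply: filterS2 => x /= -> /addIr.
Qed.

Lemma GDD a u v : D u -> D v -> \forall x \ae m,
  G ((a \*o u) \+ v) ((a \*o u) \+ v) x =
    a ^+ 2 * G u u x + 2 * a * G u v x + G v v x.
Proof.
move=> Du Dv; have Dw := DD hdf (DZ hdf a Du) Dv.
have h1 := G_lin a Du Dv Dw.
have h2 := G_sym Du Dw; have h3 := G_sym Dv Dw.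
have h4 := G_lin a Du Dv Du; have h5 := G_lin a Du Dv Dv; have h6 := G_sym Dv Du.
near=> x.
have -> : G ((a \*o u) \+ v) ((a \*o u) \+ v) x =
  a * G u ((a \*o u) \+ v) x + G v ((a \*o u) \+ v) x by near: x.
have -> : G u ((a \*o u) \+ v) x = G ((a \*o u) \+ v) u x by near: x.
have -> : G v ((a \*o u) \+ v) x = G ((a \*o u) \+ v) v x by near: x.
have -> : G ((a \*o u) \+ v) u x = a * G u u x + G v u x by near: x.
have -> : G ((a \*o u) \+ v) v x = a * G u v x + G v v x by near: x.
have -> : G v u x = G u v x by near: x.
ring.
Unshelve. all: by end_near.
Qed.

(** The discriminant criterion is stated for rational parameters because linearity of [G] holds a.e.
    for each fixed scalar, and only countably many null sets can be discarded together. Replacing c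
    by c + e covers c = 0. *)
Lemma quad_disc (a b c : R) : 0 <= a -> 0 <= c ->
  (forall q : rat, 0 <= (ratr q) ^+ 2 * c + 2 * ratr q * b + a) -> b ^+ 2 <= a * c.
Proof.
move=> a0 c0 h.
suff H e : 0 < e -> b ^+ 2 <= a * (c + e).
  rewrite -subr_le0; apply: (@le0_addgt0 _ _ a) => e /H; lra.
move=> e0; have ce : 0 < c + e by lra.
rewrite -subr_le0; apply: (@le0_addgt0 _ _ ((c + e) ^+ 2)) => r r0.
pose s := Num.min r 1; have s0 : 0 < s by rewrite lt_min r0 ltr01.
have sr : s ^+ 2 <= r.
  have s1 : s <= 1 by rewrite ge_min lexx orbT.
  have s2 : s <= r by rewrite ge_min lexx.
  nra.
(* The minimum of t^2 (c + e) + 2 t b + a is attained at t0 and equals a - b^2 / (c + e); a rational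
   within s of t0 attains it up to (c + e) r. *)
pose t0 := - b / (c + e).
have [q] := @rat_in_itvoo R (t0 - s) (t0 + s) ltac:(lra).
rewrite in_itv/= => /andP[q1 q2]; have := h q.
move: (ratr q : R) q1 q2 => t q1 q2 ht.
have ts : (t - t0) ^+ 2 <= r by nra.
have hb : b = - t0 * (c + e) by rewrite /t0; field; rewrite gt_eqF.
have te : 0 <= t ^+ 2 * e by rewrite mulr_ge0 ?sqr_ge0 ?ltW.
have : 0 <= (c + e) * (t ^+ 2 * (c + e) + 2 * t * b + a) by rewrite mulr_ge0; lra.
have : (c + e) ^+ 2 * (t - t0) ^+ 2 <= (c + e) ^+ 2 * r.
  by rewrite ler_wpM2l// sqr_ge0.
rewrite hb; lra.
Qed.

Lemma ae_rat (P : rat -> X -> Prop) :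
  (forall q, \forall x \ae m, P q x) -> \forall x \ae m, forall q, P q x.
Proof.
move=> h.
have : \forall x \ae m, forall n : nat, forall q, unpickle n = Some q -> P q x.
  apply/ae_foralln => n; case: (unpickle n) => [q|]; last exact: aeW.
  by apply: filterS (h q) => x hx q' [<-].
by apply: filterS => x hx q; apply: (hx (pickle q)); rewrite pickleK.
Qed.

Lemma G_CS u v : D u -> D v -> \forall x \ae m, `|G u v x| <= slope u x * slope v x.
Proof.
move=> Du Dv.
have h : \forall x \ae m, forall q : rat,
    0 <= (ratr q) ^+ 2 * G v v x + 2 * ratr q * G u v x + G u u x.
  apply: ae_rat => q.
  have Dw := DD hdf (DZ hdf (ratr q) Dv) Du.
  apply: (ae_imp3 (cdc_ge0 hcdc Dw) (GDD (ratr q) Dv Du) (G_sym Dv Du)) => x h1 h2 h3.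
  by rewrite -h3 -h2.
apply: (ae_imp3 h (cdc_ge0 hcdc Du) (cdc_ge0 hcdc Dv)) => x h1 h2 h3.
rewrite -sqrtrM// -sqrtr_sqr ler_wsqrtr//.
exact: quad_disc.
Qed.

Lemma slopeZ a u : D u -> \forall x \ae m, slope (a \*o u) x = `|a| * slope u x.
Proof.
move=> Du; have Dau := DZ hdf a Du.
apply: (ae_imp3 (GZl a Du Dau) (G_sym Du Dau) (GZl a Du Du)) => x h1 h2 h3.
by rewrite /slope h1 h2 h3 mulrA -expr2 sqrtrM ?sqr_ge0// sqrtr_sqr.
Qed.

Lemma slope_lin a u v : D u -> D v ->
  \forall x \ae m, slope ((a \*o u) \+ v) x <= `|a| * slope u x + slope v x.
Proof.
move=> Du Dv.
apply: (ae_imp2 (ae_imp3 (GDD a Du Dv) (G_CS Du Dv) (slopeE Du) (fun x h1 h2 h3 => conj h1 (conj h2 h3))) (slopeE Dv)).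
move=> x [h1 [h2 h3]] h4.
have sge : 0 <= `|a| * slope u x + slope v x.
  by rewrite addr_ge0 ?mulr_ge0 ?slope_ge0.
rewrite -(ger0_norm sge) -sqrtr_sqr ler_wsqrtr//.
rewrite h1 -h3 -h4.
have := ler_norm (a * G u v x); rewrite normrM.
have : `|a| * `|G u v x| <= `|a| * (slope u x * slope v x) by rewrite ler_wpM2l.
have : a ^+ 2 = `|a| ^+ 2 by rewrite real_normK ?num_real.
move=> ->; nra.
Qed.

Lemma slopeD u v : D u -> D v ->
  \forall x \ae m, slope (u \+ v) x <= slope u x + slope v x.
Proof.
move=> Du Dv; have := slope_lin 1 Du Dv.
have -> : (1 \*o u) \+ v = u \+ v by apply/funext => x /=; rewrite mul1r.
by apply: filterS => x; rewrite normr1 mul1r.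
Qed.

Lemma slopeB u v : D u -> D v ->
  \forall x \ae m, slope (u \- v) x <= slope u x + slope v x.
Proof.
move=> Du Dv; rewrite sub_fun_lin; apply: filterS (slope_lin (-1) Dv Du) => x.
by rewrite normrN1 mul1r addrC.
Qed.

Lemma slope_dist u v : D u -> D v ->
  \forall x \ae m, `|slope u x - slope v x| <= slope (u \- v) x.
Proof.
move=> Du Dv; have Dw := DB hdf Du Dv.
apply: (ae_imp2 (slopeD Dw Dv) (slopeB Du Dw)) => x.
have -> : (u \- v) \+ v = u by apply/funext => y /=; lra.
have -> : u \- (u \- v) = v by apply/funext => y /=; lra.
by move=> h1 h2; rewrite ler_norml; apply/andP; split; lra.
Qed.

Lemma slope_ae u v : D u -> D v -> (\forall x \ae m, u x = v x) ->
  \forall x \ae m, G u u x = G v v x.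
Proof.
move=> Du Dv uv; have uv' := (eq_aeP _ _ _).2 uv.
apply: (ae_imp3 ((eq_aeP _ _ _).1 (cdc_ae hcdc Du Dv Du uv')) (G_sym Dv Du)
  ((eq_aeP _ _ _).1 (cdc_ae hcdc Du Dv Dv uv'))) => x h1 h2 h3.
by rewrite h1 h2 h3.
Qed.

End Gamma.

(** * Locality of the slope *)

Section Support.
Context {R : realType} {d : measure_display} {X : metricMeasurableType R d}.
Variable m : {finite_measure set X -> \bar R}.
Implicit Types (u v w f : X -> R).

Lemma Lfun_bdd (c : R) u : measurable_fun setT u -> (forall x, `|u x| <= c) ->
  u \in Lfun m +oo%E.
Proof.
move=> mu uc; rewrite inE; apply/andP; split; rewrite inE//=.
rewrite /finite_norm unlock /=; case: ifP => // _.
apply: (le_lt_trans _ (ltry c)); apply/ess_supP.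
by apply: aeW => x /=; rewrite lee_fin.
Qed.

Lemma closed_ae_supp u : closed (ae_supp m u).
Proof.
rewrite -[ae_supp m u]setCK; apply: open_closedC; rewrite openE => x hx.
have [U [oU Ux hU]] : exists U : set X, [/\ open U, U x & \forall y \ae m, U y -> u y = 0].
  apply: contrapT => h; apply: hx => U oU Ux hU; apply: h.
  by exists U.
apply: filterS (open_nbhs_nbhs (conj oU Ux)) => y Uy hy.
exact: hy U oU Uy hU.
Qed.

Lemma ae_supp_sub u (F : set X) : closed F -> (forall x, ~ F x -> u x = 0) ->
  ae_supp m u `<=` F.
Proof.
move=> cF uF x hx; apply: contrapT => nF.
apply: (hx (~` F)) => //; first exact: closed_openC.
by apply: aeW => y; exact: uF.
Qed.

Lemma compact_ae_supp f u : Cc f -> (forall x, f x = 0 -> u x = 0) ->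
  compact (ae_supp m u).
Proof.
move=> [_ Kf] fu; apply: (subclosed_compact (@closed_ae_supp u) Kf).
apply: ae_supp_sub; first exact: closed_closure.
move=> x nx; apply: fu; apply: contrapT => /eqP fx; apply: nx.
exact: subset_closure.
Qed.

Lemma Cc_bounded f : Cc f -> exists2 c, 0 < c & forall x, `|f x| <= c.
Proof.
move=> [cf Kf].
have : compact (f @` closure [set x | f x != 0]).
  by apply: continuous_compact => //; exact: continuous_subspaceT.
move=> /compact_bounded [M [_ hM]].
exists (`|M| + 1); first by rewrite ltr_wpDl.
have M1 : M < `|M| + 1 by rewrite (le_lt_trans (ler_norm M))// ltrDl.
move=> x; have [->|fx] := eqVneq (f x) 0; first by rewrite normr0 addr_ge0.
by apply: (hM _ M1); exists x => //; exact: subset_closure.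
Qed.

Lemma open_gt f (a : R) : continuous f -> open [set x | a < f x].
Proof.
move=> cf; apply: (@open_comp _ _ f [set y | a < y]) => [x _|]; first exact: cf.
exact: open_gt.
Qed.

Lemma closed_ge f (a : R) : continuous f -> closed [set x | a <= f x].
Proof.
move=> cf.
suff -> : [set x | a <= f x] = ~` [set x | - a < (- f) x].
  apply: open_closedC; apply: open_gt => x.
  exact: continuousN (cf x).
apply/seteqP; split => x /=.
  by move=> h; apply/negP; rewrite -leNgt lerN2.
by move/negP; rewrite -leNgt lerN2.
Qed.

End Support.

(** * Truncations of a continuous compactly supported function at separated levels *)

Section LocalCore.
Context {R : realType} {d : measure_display} {X : metricMeasurableType R d}.
Variable m : {finite_measure set X -> \bar R}.
Variables (D : set (X -> R)) (E : (X -> R) -> (X -> R) -> R).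
Hypothesis hdf : symmetric_dirichlet_form m D E.
Hypothesis hloc : strongly_local m D E.
Variable G : (X -> R) -> (X -> R) -> (X -> R).
Hypothesis hcdc : carre_du_champ m D E G.
Implicit Types (u v w f : X -> R) (a b c e : R).

(** Both u and v vanish where f does, so their supports are compact. The support of u lies in
    [b <= f], and the gap e < b makes [e < f] an open neighbourhood of it on which v is constant. *)
Lemma local_energy f u v e b c : Cc f -> D u -> D v -> 0 < b -> e < b ->
  (forall x, f x < b -> u x = 0) -> (forall x, e < f x -> v x = c) ->
  (forall x, f x = 0 -> v x = 0) -> E u v = 0.
Proof.
move=> Cf Du Dv b0 eb ub ve v0; apply: hloc => //.
- by apply: (compact_ae_supp Cf) => x fx; apply: ub; rewrite fx.
- exact: (compact_ae_supp Cf).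
exists [set x | e < f x], c; split.
- by apply: open_gt; case: Cf.
- have h : ae_supp m u `<=` [set x | b <= f x].
    apply: ae_supp_sub; first by apply: closed_ge; case: Cf.
    by move=> x /= /negP; rewrite -ltNge; exact: ub.
  by move=> x /h /=; exact: lt_le_trans.
- by apply: aeW => x; exact: ve.
Qed.

Lemma normr_exc a f x : 0 <= a -> `|excess a f x| <= `|f x|.
Proof.
move=> a0; rewrite ger0_norm ?exc_ge0// /excess ge_max normr_ge0 andbT.
by have := ler_norm (f x); lra.
Qed.

Lemma cut_bound a f x : 0 <= a -> 0 <= cut a f x <= a.
Proof. by move=> a0; rewrite /cut le_min ge_min le_max !lexx a0 !orbT. Qed.

Lemma cut_ge a f x : a <= f x -> 0 <= a -> cut a f x = a.
Proof. by move=> h a0; rewrite /cut min_r// le_max h. Qed.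

(* With w = (f - b)^+ and g = min(f^+, e) / e, which is 1 near the support of w,
   the Leibniz formula and strong locality give
   \int g Gamma(w) = 2 E(w, w) = \int Gamma(w), where g < 1 on [f < e]. *)
Lemma G_exc_core f e b : Cc f -> D f -> 0 < e -> e < b ->
  \forall x \ae m, f x < e -> G (excess b f) (excess b f) x = 0.
Proof.
move=> Cf Df e0 eb; have b0 : 0 < b by lra.
have [c c0 fc] := Cc_bounded Cf.
pose w := excess b f; pose g := e^-1 \*o cut e f.
have Dw : D w by have [] := exc_D hdf (ltW b0) Df.
have Dg : D g by apply: (DZ hdf); have [] := cut_D hdf e0 Df.
have wc x : `|w x| <= c by rewrite (le_trans (normr_exc _ _ (ltW b0))).
have g1 x : 0 <= g x <= 1.
  have /andP[h1 h2] := cut_bound f x (ltW e0).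
  rewrite /g/= mulr_ge0 ?invr_ge0 ?(ltW e0)//=.
  by rewrite mulrC ler_pdivrMr// mul1r.
have wg : w \* g = w.
  apply/funext => x /=; rewrite /w /g /=.
  have [h|h] := leP (f x) b; first by rewrite exc_lt// mul0r.
  by rewrite cut_ge ?mulVf ?mulr1 ?gt_eqF//; lra.
have Dww : D (w \* w).
  by apply: (sqr_D hdf (c := c)) => // x; rewrite exc_ge0 (le_trans (ler_norm _) (wc x)).
have Eww : E (w \* w) g = 0.
  apply: (@local_energy f _ _ e b 1) => // x.
  - by move=> h; rewrite /= /w exc_lt ?mulr0// ltW.
  - by move=> h; rewrite /g /= cut_ge ?mulVf ?gt_eqF// ltW.
  - by move=> h; rewrite /g /= /cut h maxxx min_l ?mulr0// ltW.
have Lw : w \in Lfun m +oo%E := Lfun_bdd _ (Dmeas hdf Dw) wc.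
have Lg : g \in Lfun m +oo%E.
  apply: (@Lfun_bdd _ _ _ _ 1); first exact: (Dmeas hdf).
  by move=> x; have /andP[h1 h2] := g1 x; rewrite ger0_norm.
have := cdc_leibniz hcdc Dw Dw Dg Lw Lw Lg.
rewrite wg Eww subr0 (E_G hloc hcdc Dw Dw) => h.
have iG := G_intg hcdc Dw Dw.
have igG : intg m (fun x => g x * G w w x).
  apply: (intgM_bdd (a := 1)) => //; first exact: (Dmeas hdf).
  by apply: aeW => x; have /andP[h1 h2] := g1 x; rewrite ger0_norm.
have := Rint_ae0 (intgB iG igG) _ _.
rewrite RintB// => H; have {H} : \forall x \ae m, G w w x - g x * G w w x = 0.
  apply: H; last lra.
  apply: filterS (cdc_ge0 hcdc Dw) => x Gx; have /andP[h1 h2] := g1 x; nra.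
apply: filterS => x hx fe.
have : (1 - g x) * G w w x = 0 by rewrite mulrBl mul1r.
move/eqP; rewrite mulf_eq0 => /orP[|/eqP//].
suff : g x < 1 by move=> h1 /eqP h2; lra.
rewrite /g /= mulrC ltr_pdivrMr// mul1r /cut gt_min gt_max fe e0.
by [].
Qed.

(* With v = min(f^+, b), constant near the support of g = (f - r)^+, the Leibniz
   formula and strong locality give \int g Gamma(v) = 0. *)
Lemma G_cut_core f b r : Cc f -> D f -> 0 < b -> b < r ->
  \forall x \ae m, r < f x -> G (cut b f) (cut b f) x = 0.
Proof.
move=> Cf Df b0 br; have r0 : 0 < r by lra.
have [c c0 fc] := Cc_bounded Cf.
pose v := cut b f; pose g := excess r f.
have Dv : D v by have [] := cut_D hdf b0 Df.
have Dg : D g by have [] := exc_D hdf (ltW r0) Df.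
have vb x : 0 <= v x <= b := cut_bound f x (ltW b0).
have gc x : `|g x| <= c by rewrite (le_trans (normr_exc _ _ (ltW r0))).
have vg : v \* g = b \*o g.
  apply/funext => x /=; rewrite /v /g /=.
  have [h|h] := leP (f x) r; first by rewrite exc_lt// !mulr0.
  by rewrite cut_ge//; lra.
have Dvv : D (v \* v) by apply: (sqr_D hdf (c := b)).
have v0 x : f x = 0 -> v x = 0 by move=> h; rewrite /v /cut h maxxx min_l// ltW.
have g0 x : f x < r -> g x = 0 by move=> h; rewrite /g exc_lt// ltW.
have vb' x : b < f x -> v x = b by move=> h; rewrite /v cut_ge// ltW.
have Egv : E g v = 0 by apply: (@local_energy f _ _ b r b).
have Egvv : E (v \* v) g = 0.
  rewrite (df_sym hdf)//; apply: (@local_energy f _ _ b r (b * b)) => // x h /=.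
    by rewrite vb'.
  by rewrite v0 ?mulr0.
have Lv : v \in Lfun m +oo%E.
  apply: (@Lfun_bdd _ _ _ _ b); first exact: (Dmeas hdf).
  by move=> x; have /andP[h1 h2] := vb x; rewrite ger0_norm.
have Lg : g \in Lfun m +oo%E := Lfun_bdd _ (Dmeas hdf Dg) gc.
have := cdc_leibniz hcdc Dv Dv Dg Lv Lv Lg.
rewrite vg (EZl hdf)// Egv Egvv => h.
have iG := G_intg hcdc Dv Dv.
have igG : intg m (fun x => g x * G v v x).
  by apply: (intgM_bdd (a := c)) => //; [exact: (Dmeas hdf)|exact: aeW].
have := Rint_ae0 igG _ _ => H; have {H} : \forall x \ae m, g x * G v v x = 0.
  apply: H; last lra.
  by apply: filterS (cdc_ge0 hcdc Dv) => x Gx; rewrite mulr_ge0// exc_ge0.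
apply: filterS => x /eqP; rewrite mulf_eq0 => /orP[|/eqP//] /eqP gx rf.
by move: gx; rewrite /g exc_gt ?ltW// => gx; lra.
Qed.

End LocalCore.

(** * Closing the gap between the levels, and slopes of truncations *)

Section Local.
Context {R : realType} {d : measure_display} {X : metricMeasurableType R d}.
Variable m : {finite_measure set X -> \bar R}.
Variables (D : set (X -> R)) (E : (X -> R) -> (X -> R) -> R).
Hypothesis hdf : symmetric_dirichlet_form m D E.
Hypothesis hloc : strongly_local m D E.
Variable G : (X -> R) -> (X -> R) -> (X -> R).
Hypothesis hcdc : carre_du_champ m D E G.
Implicit Types (u v w f z : X -> R) (a b c e : R).
Local Notation slope := (slope G).

Lemma intg_ind (A : set X) f : measurable A -> intg m f ->
  intg m (fun x => \1_A x * f x).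
Proof.
move=> mA hf; apply: (intgM_bdd (a := 1)) => //.
by apply: aeW => x; rewrite indicE ger0_norm ?ler0n// lern1 leq_b1.
Qed.

Lemma measurable_bool (b : X -> bool) : measurable_fun setT b -> measurable [set x | b x].
Proof.
by move=> mb; have := mb measurableT [set true] I; rewrite setTI.
Qed.

Lemma G_addE u v : D u -> D v -> \forall x \ae m,
  G (u \+ v) (u \+ v) x = G u u x + 2 * G u v x + G v v x.
Proof.
move=> Du Dv; have := GDD hdf hcdc 1 Du Dv.
have -> : (1 \*o u) \+ v = u \+ v by apply/funext => x /=; rewrite mul1r.
by apply: filterS => x ->; ring.
Qed.

Lemma G_subE u v : D u -> D v -> \forall x \ae m,
  G (u \- v) (u \- v) x = G u u x - 2 * G u v x + G v v x.
Proof.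
move=> Du Dv; have := GDD hdf hcdc (-1) Dv Du; rewrite -sub_fun_lin => h.
by apply: (ae_imp2 h (G_sym hcdc Du Dv)) => x -> ->; ring.
Qed.

(** The constant 2 is the normalisation E(u, u) = 2^-1 \int Gamma(u). *)
Lemma quad_G (A : set X) : measurable A ->
  quad_form D E (fun u => \int[m]_x (\1_A x * G u u x)) 2.
Proof.
move=> mA.
have iA u v : D u -> D v -> intg m (fun x => \1_A x * G u v x).
  by move=> Du Dv; apply: intg_ind => //; exact: (G_intg hcdc).
have ind0 x : 0 <= \1_A x :> R by rewrite indicE ler0n.
have ind1 x : \1_A x <= 1 :> R by rewrite indicE lern1 leq_b1.
split.
- move=> u Du; apply: Rint_ae_ge0; first exact: intg_meas (iA _ _ Du Du).
  by apply: filterS (cdc_ge0 hcdc Du) => x h; rewrite mulr_ge0.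
- move=> u v Du Dv.
  have [Dp Dm] := (DD hdf Du Dv, DB hdf Du Dv).
  rewrite -(RintZ 2 (iA _ _ Du Du)) -(RintZ 2 (iA _ _ Dv Dv)).
  rewrite -(RintD (iA _ _ Dp Dp) (iA _ _ Dm Dm)).
  rewrite -(RintD (intgZ 2 (iA _ _ Du Du)) (intgZ 2 (iA _ _ Dv Dv))).
  apply: Rint_ae_eq.
  + by apply: intg_meas; apply: intgD; exact: iA.
  + by apply: intg_meas; apply: intgD; apply: intgZ; exact: iA.
  + by apply: (ae_imp2 (G_addE Du Dv) (G_subE Du Dv)) => x -> ->; ring.
- move=> a u Du; have Dau := DZ hdf a Du.
  rewrite -(RintZ (a ^+ 2) (iA _ _ Du Du)); apply: Rint_ae_eq.
  + by apply: intg_meas; exact: iA.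
  + by apply: intg_meas; apply: intgZ; exact: iA.
  + apply: (ae_imp3 (GZl hdf hcdc a Du Dau) (G_sym hcdc Du Dau) (GZl hdf hcdc a Du Du)).
    by move=> x -> -> ->; ring.
- move=> u Du; rewrite (E_G hloc hcdc Du Du) mulrA divff ?pnatr_eq0// mul1r.
  apply: Rint_ae_le; [exact: iA|exact: (G_intg hcdc)|].
  by apply: filterS (cdc_ge0 hcdc Du) => x h; rewrite ler_piMl.
Qed.

(** An L^2 limit does not by itself remember that Gamma vanishes on A. Expressed through the
    integral of Gamma over A, along approximants of bounded energy, the information survives by
    [form_limit]. *)
Lemma G_limit (A : set X) (M : R) u : measurable A -> L2 m u ->
  (forall e, 0 < e -> exists v, [/\ D v, E v v <= M, sqn m (v \- u) <= e &
     \int[m]_x (\1_A x * G v v x) <= e]) ->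
  D u /\ \forall x \ae m, A x -> G u u x = 0.
Proof.
move=> mA Lu h; have [Du Eu q0] := form_limit hdf (quad_G mA) Lu h.
split => //.
have := @Rint_ae0 _ _ _ m (fun x => \1_A x * G u u x) _ _ => H.
have {H} : \forall x \ae m, \1_A x * G u u x = 0.
  apply: H; first by apply: intg_ind => //; exact: (G_intg hcdc).
    apply: filterS (cdc_ge0 hcdc Du) => x Gx; rewrite mulr_ge0// indicE ler0n//.
  by rewrite q0.
by apply: filterS => x + Ax; rewrite indicE mem_set// mul1r.
Qed.

Lemma int_ind0 (A : set X) u : measurable A -> D u ->
  (\forall x \ae m, A x -> G u u x = 0) -> \int[m]_x (\1_A x * G u u x) = 0.
Proof.
move=> mA Du h.
have -> : 0 = \int[m]_x (0 : R) by rewrite Rintegral_cst// mul0r.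
apply: Rint_ae_eq => //.
- by apply: intg_meas; apply: intg_ind => //; exact: (G_intg hcdc).
- apply: filterS h => x h; rewrite indicE.
  have [/set_mem/h ->|_] := boolP (x \in A); first by rewrite mulr0.
  by rewrite mul0r.
Qed.

Lemma exc_lip a b u v x : `|excess a u x - excess b v x| <= `|u x - v x| + `|a - b|.
Proof.
apply: (@le_trans _ _ `|(u x - v x) - (a - b)|); last exact: ler_normB.
rewrite /excess; move: (u x) (v x) => s t.
rewrite ler_norml; have := ler_norm (s - t - (a - b)).
have := ler_norm (- (s - t - (a - b))); rewrite normrN.
by have [h1|h1] := leP (s - a) 0; have [h2|h2] := leP (t - b) 0 => h3 h4;
  apply/andP; split; lra.
Qed.

Lemma cut_lip a b u v x : `|cut a u x - cut b v x| <= `|u x - v x| + `|a - b|.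
Proof.
rewrite /cut; move: (u x) (v x) => s t.
have h1 := ler_norm (s - t); have h2 := ler_norm (- (s - t)); rewrite normrN in h2.
have h3 := ler_norm (a - b); have h4 := ler_norm (- (a - b)); rewrite normrN in h4.
rewrite ler_norml.
have [h5|h5] := leP s 0; have [h6|h6] := leP t 0.
- have [h7|h7] := leP 0 a; have [h8|h8] := leP 0 b; apply/andP; split; lra.
- have [h7|h7] := leP 0 a; have [h8|h8] := leP t b; apply/andP; split; lra.
- have [h7|h7] := leP s a; have [h8|h8] := leP 0 b; apply/andP; split; lra.
- have [h7|h7] := leP s a; have [h8|h8] := leP t b; apply/andP; split; lra.
Qed.

Definition mass : R := \int[m]_x (1 : R).

Lemma mass_ge0 : 0 <= mass. Proof. exact: Rintegral_ge0. Qed.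

Lemma Rint_cst (c : R) : \int[m]_x (c : R) = c * mass.
Proof. by rewrite /mass -RintZ ?mulr1//; exact: intg_cst. Qed.

Lemma sqn0 : sqn m (cst 0 : X -> R) = 0.
Proof.
rewrite /sqn -[RHS](mul0r mass) -Rint_cst; congr Rintegral.
by apply/funext => x; rewrite expr0n.
Qed.

Lemma sqn_lip (u v f g : X -> R) e : L2 m f -> L2 m g -> L2 m (u \- v) -> 0 <= e ->
  (forall x, `|f x - g x| <= `|u x - v x| + e) ->
  sqn m (f \- g) <= 2 * sqn m (u \- v) + 2 * e ^+ 2 * mass.
Proof.
move=> Lf Lg [_ Luv] e0 h; have [_ i] := L2B Lf Lg.
rewrite /sqn -RintZ// -Rint_cst -RintD; [|exact: intgZ|exact: intg_cst].
apply: Rint_le => //; first by apply: intgD; [exact: intgZ|exact: intg_cst].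
move=> x /=; rewrite -(real_normK (num_real (f x - g x))) -(real_normK (num_real (u x - v x))).
have := h x; have := normr_ge0 (f x - g x); have := normr_ge0 (u x - v x).
move: `|f x - g x| `|u x - v x| => p q p0 q0 pq.
have := sqr_ge0 (q - e); nra.
Qed.

Lemma small_sqr e C : 0 < e -> 0 <= C -> exists2 r, 0 < r & C * r ^+ 2 <= e /\ r <= 1.
Proof.
move=> e0 C0; exists (Num.min 1 (e / (C + 1))).
  by rewrite lt_min ltr01/= divr_gt0//; lra.
set r := Num.min _ _.
have r1 : r <= 1 by rewrite ge_min lexx.
have r0 : 0 < r by rewrite lt_min ltr01/= divr_gt0//; lra.
have : r <= e / (C + 1) by rewrite ge_min lexx orbT.
rewrite ler_pdivlMr; last lra.
split => //; nra.
Qed.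

Lemma L2_exc a u : 0 <= a -> D u -> L2 m (excess a u).
Proof. by move=> a0 Du; apply: (DL2 hdf); have [] := exc_D hdf a0 Du. Qed.

Lemma L2_cut a u : 0 < a -> D u -> L2 m (cut a u).
Proof. by move=> a0 Du; apply: (DL2 hdf); have [] := cut_D hdf a0 Du. Qed.

(** Levels b (1 - 1 / (n + 2)) approaching b from below; the shift to [harmonic n.+1] keeps the one
    at n = 0 positive. *)
Lemma seq_lt b : 0 < b -> forall n, 0 < b * (1 - harmonic n.+1) < b.
Proof.
move=> b0 n; have h0 := harmonic_gt0 n.+1 : 0 < harmonic n.+1 :> R.
have h1 : harmonic n.+1 < 1 :> R by rewrite /harmonic/= invf_lt1 ?ltr1n.
by move: (harmonic n.+1) h0 h1 => t h0 h1; apply/andP; split; nra.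
Qed.

Lemma seq_ex b t : 0 < b -> t < b -> exists n, t < b * (1 - harmonic n.+1).
Proof.
move=> b0 tb; have /inv_small[N hN] : 0 < (b - t) / b by rewrite divr_gt0// subr_gt0.
exists N; have := hN N.+1 (leqnSn _); rewrite ltr_pdivlMr//.
by move: (harmonic N.+1) => s; lra.
Qed.

(** For a level b > 0, letting the lower level tend to b yields the vanishing on [f < b]. Points
    with f = a, and the level a = 0, are reached by taking b = a + r: [f <= a] lies in [f < a + r],
    and (f - a - r)^+ is uniformly r-close to (f - a)^+. *)
Lemma G_exc_Cc f a : Cc f -> D f -> 0 <= a ->
  \forall x \ae m, f x <= a -> G (excess a f) (excess a f) x = 0.
Proof.
move=> Cf Df a0.
have core b : 0 < b -> \forall x \ae m, f x < b -> G (excess b f) (excess b f) x = 0.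
  move=> b0.
  have : \forall x \ae m, forall n, f x < b * (1 - harmonic n.+1) ->
      G (excess b f) (excess b f) x = 0.
    apply/ae_foralln => n; have /andP[h1 h2] := seq_lt b0 n.
    exact: (G_exc_core hdf hloc hcdc).
  by apply: filterS => x h /(seq_ex b0)[n]; exact: h.
have mA : measurable [set x | f x <= a].
  by apply: measurable_bool; apply: measurable_fun_ler => //; exact: (Dmeas hdf).
have [] // := @G_limit [set x | f x <= a] (6 * E f f) (excess a f) mA (L2_exc a0 Df).
move=> e e0; have [r r0 [re r1]] := small_sqr e0 (mulr_ge0 (ler0n _ 2) mass_ge0).
have b0 : 0 < a + r by lra.
have [De Ee] := exc_D hdf (ltW b0) Df.
exists (excess (a + r) f); split => //.
- have := @sqn_lip f f (excess (a + r) f) (excess a f) r (L2_exc (ltW b0) Df) (L2_exc a0 Df).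
  have -> : f \- f = cst 0 by apply/funext => x /=; rewrite subrr.
  have L0 : L2 m (cst 0 : X -> R) := DL2 hdf (D0 hdf).
  move=> /(_ L0 (ltW r0)) H; apply: (le_trans (H _)).
    move=> x; have := exc_lip (a + r) a f f x.
    have -> : a + r - a = r by ring.
    by rewrite subrr normr0 (ger0_norm (ltW r0)).
  rewrite sqn0.
  lra.
- rewrite int_ind0//; first exact: ltW.
  by apply: filterS (core _ b0) => x h /= fa; apply: h; lra.
Qed.

(** Mirror image of [G_exc_Cc]: upper levels decrease to b, and a is approached by a - r from below,
    with r <= a / 2 so that the level stays positive. *)
Lemma G_cut_Cc f a : Cc f -> D f -> 0 < a ->
  \forall x \ae m, a <= f x -> G (cut a f) (cut a f) x = 0.
Proof.
move=> Cf Df a0.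
have core b : 0 < b -> \forall x \ae m, b < f x -> G (cut b f) (cut b f) x = 0.
  move=> b0.
  have : \forall x \ae m, forall n, b + harmonic n < f x ->
      G (cut b f) (cut b f) x = 0.
    apply/ae_foralln => n; have h := harmonic_gt0 n : 0 < harmonic n :> R.
    by apply: (G_cut_core hdf hloc hcdc) => //; rewrite ltrDl.
  apply: filterS => x h bf.
  have /inv_small[N hN] : 0 < f x - b by rewrite subr_gt0.
  by apply: (h N); have := hN N (leqnn _); rewrite ltrBrDl.
have mA : measurable [set x | a <= f x].
  by apply: measurable_bool; apply: measurable_fun_ler => //; exact: (Dmeas hdf).
have [] // := @G_limit [set x | a <= f x] (E f f) (cut a f) mA (L2_cut a0 Df).
move=> e e0.
have [r0 r00 [re _]] := small_sqr e0 (mulr_ge0 (ler0n _ 2) mass_ge0).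
pose r := Num.min r0 (a / 2).
have rr0 : r <= r0 by rewrite ge_min lexx.
have ra : r <= a / 2 by rewrite ge_min lexx orbT.
have r_gt0 : 0 < r by rewrite lt_min r00 divr_gt0.
have b0 : 0 < a - r by lra.
have [De Ee] := cut_D hdf b0 Df.
exists (cut (a - r) f); split => //.
- have := @sqn_lip f f (cut (a - r) f) (cut a f) r (L2_cut b0 Df) (L2_cut a0 Df).
  have -> : f \- f = cst 0 by apply/funext => x /=; rewrite subrr.
  have L0 : L2 m (cst 0 : X -> R) := DL2 hdf (D0 hdf).
  move=> /(_ L0 (ltW r_gt0)) H; apply: (le_trans (H _)).
    move=> x; have := cut_lip (a - r) a f f x.
    have -> : a - r - a = - r by ring.
    by rewrite subrr normr0 normrN (ger0_norm (ltW r_gt0)).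
  rewrite sqn0.
  have := mass_ge0; have : r ^+ 2 <= r0 ^+ 2 by rewrite lerXn2r// ?nnegrE ltW.
  move: re; move: mass (r ^+ 2) (r0 ^+ 2) => K s t re h1 h2; nra.
- rewrite int_ind0//; first exact: ltW.
  by apply: filterS (core _ b0) => x h /= fa; apply: h; lra.
Qed.

Definition neg u : X -> R := (-1) \*o u.

Lemma neg_D u : D u -> D (neg u). Proof. exact: (DZ hdf). Qed.

(** Locality as a property of a single function. It is available first for continuous compactly
    supported functions and their opposites, which yields the slope comparisons needed to extend it
    to all of [D]. *)
Record trunc_local z : Prop := TruncLocal {
  trunc_local_exc : forall a, 0 <= a -> \forall x \ae m, z x <= a -> G (excess a z) (excess a z) x = 0 ;
  trunc_local_cut : forall a, 0 < a -> \forall x \ae m, a <= z x -> G (cut a z) (cut a z) x = 0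
}.

Lemma slope0 u x : G u u x = 0 -> slope u x = 0.
Proof. by rewrite /slope => ->; rewrite sqrtr0. Qed.

(* On [a < z], the functions z and (z - a)^+ differ by min(z^+, a) - z^-,
   whose slope vanishes there. *)
Lemma slope_sub_exc z a : D z -> trunc_local z -> trunc_local (neg z) -> 0 <= a ->
  \forall x \ae m, a < z x -> slope (z \- excess a z) x = 0.
Proof.
move=> Dz lz lnz a0.
have [Dn _] := exc_D hdf (lexx 0) (neg_D Dz).
have h2 := trunc_local_exc lnz (lexx 0).
move: a0; rewrite le_eqVlt => /predU1P[a0|a0].
  have zE : z \- excess a z = neg (excess 0 (neg z)).
    apply/funext => x; rewrite /neg /excess -a0 /= /Num.max.
    by do ! case: ifPn => //; rewrite ?(ltNge, negbK) => *; lra.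
  have Dz' := slopeZ hdf hcdc (-1) Dn.
  apply: (ae_imp2 Dz' h2) => x e1 e2 az; rewrite zE /neg e1 slope0 ?mulr0//.
  by apply: e2; rewrite /neg /=; lra.
have [Dc _] := cut_D hdf a0 Dz.
have zE : z \- excess a z = cut a z \- excess 0 (neg z).
  apply/funext => x /=; rewrite (exc_cut _ _ (ltW a0)) /neg /excess /= /Num.max.
  by do ! case: ifPn => //; rewrite ?(ltNge, negbK) => *; lra.
have h5 := slopeB hdf hcdc Dc Dn; rewrite -zE in h5.
apply: (ae_imp3 h5 (trunc_local_cut lz a0) h2) => x e1 e2 e3 az.
apply/eqP; rewrite eq_le slope_ge0 andbT (le_trans e1)//.
rewrite !slope0 ?addr0//; first by apply: e3; rewrite /neg /=; lra.
by apply: e2; exact: ltW.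
Qed.

(** On [a < z] the slopes of z and (z - a)^+ differ by at most the slope of their difference, which
    is 0 there. *)
Lemma slope_exc z a : D z -> trunc_local z -> trunc_local (neg z) -> 0 <= a ->
  \forall x \ae m, slope (excess a z) x = if a < z x then slope z x else 0.
Proof.
move=> Dz lz lnz a0; have [De _] := exc_D hdf a0 Dz.
apply: (ae_imp3 (trunc_local_exc lz a0) (slope_dist hdf hcdc Dz De) (slope_sub_exc Dz lz lnz a0)).
move=> x e1 e2 e3; case: ifPn => az.
  by move: e2; rewrite (e3 az) normr_le0 subr_eq0 => /eqP ->.
by apply: slope0; apply: e1; rewrite leNgt.
Qed.

(** On [a <= z] the left side is 0. On [z <= 0] it is bounded by the slopes of z^+ and (z - a)^+,
    both 0 there. In between, z - min(z^+, a) = (z - a)^+ - z^- has slope 0. *)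
Lemma slope_cut_le z a : D z -> trunc_local z -> trunc_local (neg z) -> 0 < a ->
  \forall x \ae m, slope (cut a z) x <= slope z x.
Proof.
move=> Dz lz lnz a0.
have [De _] := exc_D hdf (ltW a0) Dz; have [De0 _] := exc_D hdf (lexx 0) Dz.
have [Dc _] := cut_D hdf a0 Dz.
have [Dn _] := exc_D hdf (lexx 0) (neg_D Dz).
have cE : cut a z = excess 0 z \- excess a z.
  by apply/funext => x /=; rewrite (exc_cut _ _ (ltW a0)); lra.
have zE : z \- cut a z = excess a z \- excess 0 (neg z).
  apply/funext => x /=; rewrite (exc_cut _ _ (ltW a0)) /neg /excess /= /Num.max.
  by do ! case: ifPn => //; rewrite ?(ltNge, negbK) => *; lra.
have h1 := slopeB hdf hcdc De0 De; rewrite -cE in h1.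
have h2 := slopeB hdf hcdc De Dn; rewrite -zE in h2.
have h3 := slope_dist hdf hcdc Dz Dc.
have h4 := ae_imp3 h1 h2 h3 (fun x p1 p2 p3 => conj p1 (conj p2 p3)).
have h5 := ae_imp3 (trunc_local_exc lz (ltW a0)) (trunc_local_exc lz (lexx 0)) (trunc_local_exc lnz (lexx 0))
  (fun x p1 p2 p3 => conj p1 (conj p2 p3)).
apply: (ae_imp3 h4 h5 (trunc_local_cut lz a0)) => x [e1 [e2 e3]] [e4 [e5 e6]] e7.
have [az|za] := leP a (z x); first by rewrite (slope0 (e7 az)) slope_ge0.
have [z0|z0] := leP (z x) 0.
  rewrite (le_trans e1)// (slope0 (e5 z0)) (slope0 (e4 (ltW za))) addr0.
  exact: slope_ge0.
have nz : neg z x <= 0 by rewrite /neg /=; lra.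
rewrite (slope0 (e4 (ltW za))) (slope0 (e6 nz)) addr0 in e2.
have := le_trans e3 e2; rewrite normr_le0 subr_eq0 => /eqP ->.
exact: lexx.
Qed.

End Local.

(** * Passage from continuous compactly supported functions to the whole domain *)

Section Transfer.
Context {R : realType} {d : measure_display} {X : metricMeasurableType R d}.
Variable m : {finite_measure set X -> \bar R}.
Variables (D : set (X -> R)) (E : (X -> R) -> (X -> R) -> R).
Hypothesis hdf : symmetric_dirichlet_form m D E.
Hypothesis hreg : regular_form m D E.
Hypothesis hloc : strongly_local m D E.
Variable G : (X -> R) -> (X -> R) -> (X -> R).
Hypothesis hcdc : carre_du_champ m D E G.
Implicit Types (u v w f z : X -> R) (a b c e : R).
Local Notation slope := (slope G).
Local Notation trunc_local := (trunc_local m G).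
Local Notation mass := (mass m).

(** Absolute continuity of the integral in quantitative form: h <= (h - n)^+ + n, and \int (h - n)^+
    tends to 0 as n grows. *)
Lemma abs_cont (h : X -> R) e : intg m h -> 0 < e ->
  exists2 N, 0 <= N & forall A : set X, measurable A ->
    \int[m]_x (\1_A x * h x) <= e + N * \int[m]_x (\1_A x : R).
Proof.
move=> ih e0; have mh := intg_meas ih.
pose F (n : nat) := fun x => Num.max (h x - n%:R) 0.
have mF n : measurable_fun setT (F n) by apply: measurable_maxr => //; exact: measurable_funB.
have Fh n x : `|F n x| <= `|h x|.
  rewrite ger0_norm ?le_max ?lexx ?orbT// ge_max normr_ge0 andbT.
  rewrite (le_trans _ (ler_norm _))// lerBlDr lerDl ler0n//.
have iah : intg m (fun x => `|h x|) by exact: integrable_norm.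
have iF n : intg m (F n) by exact: intg_dom iah (Fh n).
have [n hn] : exists n, \int[m]_x F n x < e.
  have : (fun n => \int[m]_x F n x) @ \oo --> (0 : R).
    have h0 : \int[m]_x (0 : R) = 0 by rewrite Rint_cst mul0r.
    rewrite -[X in _ --> X]h0.
    apply: (intg_cvg (g := fun x => `|h x|)) => //.
      apply: aeW => x; apply: cvg_near_cst; near=> n.
      rewrite /F max_r// subr_le0 (le_trans (ler_norm _))//.
      near: n; exists (Num.truncn `|h x|).+1 => // n /= hn.
      by rewrite (le_trans (ltW (truncnS_gt _)))// ler_nat.
    by move=> n; exact: aeW.
  move=> /cvgrPdist_lt /(_ e e0) [N _ /(_ N (leqnn _))]; rewrite sub0r normrN => hN.
  by exists N; exact: le_lt_trans (ler_norm _) hN.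
exists n%:R; first exact: ler0n.
move=> A mA.
have iA : intg m (fun x => \1_A x : R).
  have := intg_ind mA (intg_cst m 1).
  by under eq_fun do rewrite mulr1.
apply: (@le_trans _ _ (\int[m]_x (F n x + n%:R * \1_A x))).
  apply: Rint_le; [exact: intg_ind|by apply: intgD => //; exact: intgZ|].
  move=> x; rewrite indicE; case: (x \in A); last first.
    by rewrite mul0r mulr0 addr0 le_max lexx orbT.
  by rewrite mul1r mulr1 -lerBlDr le_max lexx.
rewrite RintD//; last exact: intgZ.
by rewrite RintZ// lerD2r ltW.
Unshelve. all: by end_near.
Qed.

(** [T] is a truncation and [Te e] the same truncation at a level shifted by e, whose slope is known
    to vanish on [Pe e] for compactly supported continuous functions. With z' such a function near
    z, the points of [P z] outside [Pe r z'] satisfy |z - z'| >= r, hence form a set B of small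
    measure by Chebyshev. On the rest of [P z] the slope of Te r o z' is 0; on B it is at most slope
    z + slope (z - z'), and \int_B Gamma(z) is small by absolute continuity. *)
Lemma trunc_transfer (T : R -> R) (Te : R -> R -> R) (P : R -> bool) (Pe : R -> R -> bool) (e0 : R) z :
  0 < e0 -> D z -> L2 m (T \o z) ->
  measurable_fun setT P -> (forall e, measurable_fun setT (Pe e)) ->
  (forall e t s, 0 < e -> e < e0 -> `|Te e t - T s| <= `|t - s| + e) ->
  (forall e t s, 0 < e -> e < e0 -> P s -> ~~ Pe e t -> e <= `|t - s|) ->
  (forall e f, 0 < e -> e < e0 -> D f -> Cc f ->
    [/\ D (Te e \o f), E (Te e \o f) (Te e \o f) <= 6 * E f f,
     \forall x \ae m, Pe e (f x) -> slope (Te e \o f) x = 0 &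
     \forall x \ae m, slope (Te e \o f) x <= slope f x]) ->
  \forall x \ae m, P (z x) -> G (T \o z) (T \o z) x = 0.
Proof.
move=> e0_gt0 Dz LTz mP mPe hT hP hf.
have mz := Dmeas hdf Dz.
have mA : measurable [set x | P (z x)].
  by apply: measurable_bool; exact: measurableT_comp.
(* Bounds 6 * E z' z', as E z' z' <= 2 * E z z + 2 for an approximant z' within energy distance 1 of
   z. *)
pose M := 12 * E z z + 12.
have Ez := df_ge0 hdf Dz.
have [] // := @G_limit _ _ _ m D E hdf hloc G hcdc [set x | P (z x)] M (T \o z) mA LTz.
move=> e e_gt0.
have [r0 r00 [re _]] := small_sqr e_gt0 (mulr_ge0 (ler0n _ 4) (mass_ge0 m)).
pose r := Num.min r0 (e0 / 2).
have rr0 : r <= r0 by rewrite ge_min lexx.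
have re0 : r < e0.
  have : r <= e0 / 2 by rewrite ge_min lexx orbT.
  lra.
have r_gt0 : 0 < r by rewrite lt_min r00 divr_gt0.
have {}re : 4 * mass * r ^+ 2 <= e.
  have := mass_ge0 m; have : r ^+ 2 <= r0 ^+ 2 by rewrite lerXn2r// ?nnegrE ltW.
  move: re; move: mass (r ^+ 2) (r0 ^+ 2) => K s t re h1 h2; nra.
have e8 : 0 < e / 8 by lra.
have [N N0 hN] := abs_cont (G_intg hcdc Dz Dz) e8.
(* The constant fixes dl, chosen after r and N: 16 dl^2 controls the contribution of z - z', and 8 N
   dl^2 / r^2 that of N m(B), where m(B) <= dl^2 / r^2. *)
have C0 : 0 <= 16 + 8 * N / r ^+ 2.
  by rewrite addr_ge0// divr_ge0 ?sqr_ge0// mulr_ge0.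
have [dl dl0 [dle dl1]] := small_sqr e_gt0 C0.
have [z' [Dz' Cz'] /(energy_lt hdf dl0 (DB hdf Dz Dz'))[hE hs]] := hreg.1 z dl Dz dl0.
have dl2 : 0 < dl ^+ 2 by rewrite exprn_gt0.
have dl21 : dl ^+ 2 <= 1 by nra.
have dlA : 16 * dl ^+ 2 <= e.
  apply: le_trans dle; rewrite ler_wpM2r ?(ltW dl2)// lerDl.
  by rewrite divr_ge0 ?sqr_ge0// mulr_ge0.
have dlB : 8 * (N * (dl ^+ 2 / r ^+ 2)) <= e.
  apply: le_trans dle.
  have -> : 8 * (N * (dl ^+ 2 / r ^+ 2)) = (8 * N / r ^+ 2) * dl ^+ 2 by ring.
  by rewrite ler_wpM2r ?(ltW dl2)// lerDr.
have [Dv Ev Pv Sv] := hf r z' r_gt0 re0 Dz' Cz'.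
exists (Te r \o z').
have Ez' : E z' z' <= 2 * E z z + 2.
  have zE : z' = z \- (z \- z') by apply/funext => x /=; lra.
  rewrite zE; apply: le_trans (EBB_le hdf Dz (DB hdf Dz Dz')) _; lra.
split => //.
- apply: le_trans Ev _; rewrite /M; lra.
- have Lzz := L2B (DL2 hdf Dz') (DL2 hdf Dz).
  apply: le_trans (sqn_lip (DL2 hdf Dv) LTz Lzz (ltW r_gt0) _) _.
    by move=> x /=; exact: hT.
  rewrite sqnC; lra.
- have mB : measurable [set x | P (z x) && ~~ Pe r (z' x)].
    apply: measurable_bool; apply: measurable_and; first exact: measurableT_comp.
    apply: measurable_neg; apply: measurableT_comp => //; exact: (Dmeas hdf).
  set B := [set x | _] in mB.
  have iG := G_intg hcdc Dz Dz.
  have Dd := DB hdf Dz Dz'.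
  have iGd := G_intg hcdc Dd Dd.
  have i1 : intg m (fun x => 2 * G (z \- z') (z \- z') x + 2 * (\1_B x * G z z x)).
    by apply: intgD; apply: intgZ => //; exact: intg_ind.
  apply: (@le_trans _ _ (\int[m]_x (2 * G (z \- z') (z \- z') x + 2 * (\1_B x * G z z x)))).
    apply: Rint_ae_le => //; first by apply: intg_ind => //; exact: (G_intg hcdc).
    have k1 := ae_imp3 (slopeE hcdc Dz) (slopeE hcdc Dd) (slopeE hcdc Dv)
      (fun x p1 p2 p3 => conj p1 (conj p2 p3)).
    have k2 := slopeB hdf hcdc Dz Dd.
    have zE : z \- (z \- z') = z' by apply/funext => x /=; lra.
    rewrite zE in k2.
    have k3 := ae_imp3 k2 Pv Sv (fun x p1 p2 p3 => conj p1 (conj p2 p3)).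
    apply: (ae_imp2 k1 k3) => x [<- [<- <-]] [h1 [h2 h3]].
    have s1 := slope_ge0 G z x; have s2 := slope_ge0 G (z \- z') x.
    have s3 := slope_ge0 G (Te r \o z') x.
    rewrite !indicE /B; case: (boolP (x \in _)) => [/set_mem/= Pz|_]; last first.
      by rewrite mul0r addr_ge0 ?mulr_ge0 ?sqr_ge0.
    case: (boolP (Pe r (z' x))) => [/h2 ->|nPe].
      by rewrite expr0n mulr0 addr_ge0 ?mulr_ge0 ?sqr_ge0.
    rewrite mem_set/= ?Pz// !mul1r.
    have h4 := le_trans h3 h1.
    have : slope (Te r \o z') x ^+ 2 <= (slope z x + slope (z \- z') x) ^+ 2.
      by rewrite lerXn2r// nnegrE addr_ge0.
    have := sqr_ge0 (slope z x - slope (z \- z') x); lra.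
  rewrite RintD; [|exact: intgZ|by apply: intgZ; exact: intg_ind].
  rewrite RintZ// RintZ; last exact: intg_ind.
  have := E_G hloc hcdc Dd Dd.
  have := hN _ mB.
  have iB : intg m (fun x => \1_B x : R).
    have := intg_ind mB (intg_cst m 1).
    by under eq_fun do rewrite mulr1.
  have : \int[m]_x (\1_B x : R) <= dl ^+ 2 / r ^+ 2.
    apply: (@le_trans _ _ (\int[m]_x ((r ^+ 2)^-1 * ((z \- z') x ^+ 2)))).
      apply: Rint_le => //; first by apply: intgZ; case: (DL2 hdf Dd).
      move=> x; rewrite indicE; case: (boolP (x \in B)) => [/set_mem|_]; last first.
        by rewrite mulr_ge0 ?sqr_ge0// invr_ge0 sqr_ge0.
      rewrite /B /= => /andP[Pz nPe].
      rewrite mulrC ler_pdivlMr ?exprn_gt0// mul1r.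
      rewrite -[leRHS]real_normK ?num_real// lerXn2r ?nnegrE ?(ltW r_gt0)//.
      by rewrite distrC; exact: (hP r).
    rewrite RintZ; last by case: (DL2 hdf Dd).
    by rewrite mulrC ler_wpM2r ?invr_ge0 ?sqr_ge0// ltW.
  move=> q1 q2 q3.
  have : N * \int[m]_x (\1_B x : R) <= N * (dl ^+ 2 / r ^+ 2) by rewrite ler_wpM2l.
  lra.
Qed.

Lemma neg_Cc f : Cc f -> Cc (neg f).
Proof.
move=> [cf Kf]; split.
  by move=> x; apply: cvgM; [exact: cvg_cst|exact: cf].
suff -> : [set x | neg f x != 0] = [set x | f x != 0] by [].
by apply/funext => x; rewrite /neg /= mulN1r oppr_eq0.
Qed.

Lemma trunc_local_Cc f : D f -> Cc f -> trunc_local f.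
Proof.
move=> Df Cf; split => a a0; first exact: (G_exc_Cc hdf hloc hcdc).
exact: (G_cut_Cc hdf hloc hcdc).
Qed.

(** For (z - a)^+ the level is raised to a + e, with e < 1; for min(z^+, a) it is lowered to a - e,
    and e < a keeps it positive. In both cases [P z] lies inside the shifted condition with a margin
    e. *)
Lemma trunc_local_all z : D z -> trunc_local z.
Proof.
move=> Dz.
have lc f : D f -> Cc f -> trunc_local f /\ trunc_local (neg f).
  move=> Df Cf; split; first exact: trunc_local_Cc.
  by apply: trunc_local_Cc; [exact: (neg_D hdf)|exact: neg_Cc].
split => a a0.
- apply: (@trunc_transfer (fun t => Num.max (t - a) 0) (fun e t => Num.max (t - (a + e)) 0)
    (fun t => t <= a) (fun e t => t <= a + e) 1 z) => //.
  + exact: (L2_exc hdf a0 Dz).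
  + exact: measurable_fun_ler.
  + by move=> e; exact: measurable_fun_ler.
  (* The Lipschitz bound for functions is read on constant ones, at the default [point]. *)
  + move=> e t s e0 _; have := @exc_lip R d X (a + e) a (fun=> t) (fun=> s) point.
    rewrite /excess; have -> : a + e - a = e by ring.
    by rewrite (ger0_norm (ltW e0)).
  + move=> e t s e0 _ sa; rewrite -ltNge => ta.
    by rewrite (le_trans _ (ler_norm _))//; lra.
  + move=> e f e0 _ Df Cf; have ae : 0 <= a + e by lra.
    have [De Ee] := exc_D hdf ae Df; have [lf lnf] := lc f Df Cf.
    have h := slope_exc hdf hcdc Df lf lnf ae.
    split => //; apply: filterS h => x; rewrite -/(excess (a + e) f) => -> //.
      by rewrite leNgt => /negbTE ->.
    by case: ifP => // _; exact: slope_ge0.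
- apply: (@trunc_transfer (fun t => Num.min (Num.max t 0) a) (fun e t => Num.min (Num.max t 0) (a - e))
    (fun t => a <= t) (fun e t => a - e <= t) a z) => //.
  + exact: (L2_cut hdf a0 Dz).
  + exact: measurable_fun_ler.
  + by move=> e; exact: measurable_fun_ler.
  + move=> e t s e0 _; have := @cut_lip R d X (a - e) a (fun=> t) (fun=> s) point.
    rewrite /cut; have -> : a - e - a = - e by ring.
    by rewrite normrN (ger0_norm (ltW e0)).
  + move=> e t s e0 _ sa; rewrite -ltNge => ta.
    by rewrite distrC (le_trans _ (ler_norm _))//; lra.
  + move=> e f e0 ea Df Cf; have ae : 0 < a - e by lra.
    have [De Ee] := cut_D hdf ae Df; have [lf lnf] := lc f Df Cf.
    split => //.
    * have Ef := df_ge0 hdf Df; apply: (le_trans Ee); lra.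
    * by apply: filterS (trunc_local_cut lf ae) => x h /h; exact: slope0.
    * exact: (slope_cut_le hdf hcdc Df lf lnf ae).
Qed.

End Transfer.

(** * Inequalities between powers *)

Section Powers.
Context {R : realType}.
Implicit Types (a b c e p q r s t x y z : R).

Lemma powR_homo r x y : 0 <= r -> 0 <= x -> x <= y -> x `^ r <= y `^ r.
Proof.
by move=> r0 x0 xy; apply: ge0_ler_powR; rewrite ?nnegrE// (le_trans x0).
Qed.

Lemma powR_sqr x r : 0 <= x -> (x ^+ 2) `^ r = x `^ (2 * r).
Proof. by move=> x0; rewrite powRrM powR_mulrn. Qed.

Lemma powR_addl x r s : 0 < r -> 0 <= s -> x `^ (r + s) = x `^ r * x `^ s.
Proof. by move=> r0 s0; rewrite powRD//; apply/implyP => /eqP; lra. Qed.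

Lemma powR_m2 x p : 2 < p -> 0 <= x -> x `^ (p - 2) * x ^+ 2 = x `^ p.
Proof.
move=> p2 x0; rewrite -powR_mulrn// -powR_addl; [|lra|by rewrite ler0n].
by rewrite subrK.
Qed.

Lemma powR_le1D x r p : 0 <= x -> 0 <= r -> r <= p -> x `^ r <= 1 + x `^ p.
Proof.
move=> x0 r0 rp; have [x1|x1] := leP x 1.
  have := powR_homo r0 x0 x1; rewrite powR1 => h.
  by rewrite (le_trans h)// lerDl powR_ge0.
by rewrite (le_trans (ler_powR (ltW x1) rp))// lerDr.
Qed.

Lemma powRD_le p a b : 0 <= p -> 0 <= a -> 0 <= b ->
  (a + b) `^ p <= 2 `^ p * (a `^ p + b `^ p).
Proof.
move=> p0 a0 b0; wlog ab : a b a0 b0 / a <= b.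
  move=> H; have [/H->//|/ltW/H] := leP a b.
  by rewrite addrC [b `^ p + _]addrC; exact.
apply: (@le_trans _ _ ((2 * b) `^ p)); first by apply: powR_homo; lra.
by rewrite powRM// ler_wpM2l ?powR_ge0// lerDr powR_ge0.
Qed.

(* Compare [b] with [h * a]. *)
Lemma young_m2 p h a b : 2 < p -> 0 < h -> 0 <= a -> 0 <= b ->
  a `^ (p - 2) * b ^+ 2 <= h ^+ 2 * a `^ p + (h `^ (p - 2))^-1 * b `^ p.
Proof.
move=> p2 h0 a0 b0.
have hp : 0 < h `^ (p - 2) by rewrite powR_gt0.
have [ba|ab] := leP b (h * a).
  apply: (@le_trans _ _ (h ^+ 2 * a `^ p)); last first.
    by rewrite lerDl mulr_ge0 ?powR_ge0// invr_ge0 ltW.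
  rewrite -(powR_m2 p2 a0) [leRHS]mulrCA ler_wpM2l ?powR_ge0// -exprMn.
  by rewrite lerXn2r ?nnegrE// mulr_ge0// ltW.
apply: (@le_trans _ _ ((h `^ (p - 2))^-1 * b `^ p)); last first.
  by rewrite lerDr mulr_ge0 ?powR_ge0// sqr_ge0.
rewrite -(powR_m2 p2 b0) [leRHS]mulrA ler_wpM2r ?sqr_ge0//.
rewrite -ler_pdivrMl ?invr_gt0// invrK -powRM// ?(ltW h0)//.
by apply: powR_homo; rewrite ?mulr_ge0 ?(ltW h0)// ?(ltW ab)//; lra.
Qed.

Lemma young_m1 p a b : 1 <= p -> 0 <= a -> 0 <= b -> a `^ (p - 1) * b <= a `^ p + b `^ p.
Proof.
move=> p1 a0 b0; have p0 : 0 < p by lra.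
have p10 : 0 <= p - 1 by lra.
have [ab|ba] := leP a b.
  apply: (@le_trans _ _ (b `^ p)); last by rewrite lerDr powR_ge0.
  by rewrite -(mulr_powRB1 b0 p0) mulrC ler_wpM2l// powR_homo.
apply: (@le_trans _ _ (a `^ p)); last by rewrite lerDl powR_ge0.
by rewrite -(mulr_powRB1 a0 p0) mulrC ler_wpM2r ?powR_ge0// ltW.
Qed.

Lemma powR_superadd r x y : 1 <= r -> 0 <= x -> 0 <= y ->
  x `^ r + y `^ r <= (x + y) `^ r.
Proof.
move=> r1 x0 y0; have r0 : 0 < r by lra.
have xy : 0 <= x + y by lra.
rewrite -(mulr_powRB1 x0 r0) -(mulr_powRB1 y0 r0) -(mulr_powRB1 xy r0) mulrDl.
by rewrite lerD// ler_wpM2l// powR_homo//; lra.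
Qed.

Lemma powR_convex p l a b : 1 <= p -> 0 <= l -> l <= 1 -> 0 <= a -> 0 <= b ->
  (l * a + (1 - l) * b) `^ p <= l * a `^ p + (1 - l) * b `^ p.
Proof.
move=> p1 l0 l1 a0 b0.
have := @convex_powR R p p1 (Itv01 l0 l1) a b.
rewrite !inE /= !in_itv /= !andbT => /(_ a0 b0).
by rewrite !convRE.
Qed.

(** Superadditivity and then convexity of x^(p/2), applied to the squares. With s and t the slopes
    of (u + v) / 2 and (u - v) / 2, the hypothesis is the parallelogram identity for Gamma. *)
Lemma clarkson p a b s t : 2 <= p -> 0 <= a -> 0 <= b -> 0 <= s -> 0 <= t ->
  s ^+ 2 + t ^+ 2 = 2^-1 * (a ^+ 2 + b ^+ 2) ->
  s `^ p + t `^ p <= 2^-1 * (a `^ p + b `^ p).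
Proof.
move=> p2 a0 b0 s0 t0 h; have r1 : 1 <= p / 2 by rewrite ler_pdivlMr ?mul1r.
have e x : 0 <= x -> x `^ p = (x ^+ 2) `^ (p / 2).
  by move=> x0; rewrite powR_sqr//; congr (_ `^ _); field.
rewrite !e//; apply: (le_trans (powR_superadd r1 (sqr_ge0 s) (sqr_ge0 t))).
have := @powR_convex (p / 2) 2^-1 (a ^+ 2) (b ^+ 2) r1.
have -> : 1 - 2^-1 = 2^-1 :> R by field.
rewrite h -!mulrDr; apply; rewrite ?sqr_ge0//; lra.
Qed.

Lemma powR_cvg (u : nat -> R) a q : 0 < q -> (forall n, 0 <= u n) -> 0 <= a ->
  u @ \oo --> a -> (fun n => u n `^ q) @ \oo --> a `^ q.
Proof.
move=> q0 u0; rewrite le_eqVlt => /predU1P[<-|a0] ua.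
  rewrite powR0 ?gt_eqF//; apply/cvgrPdist_lt => e e0.
  have eq0 : 0 < e `^ q^-1 by rewrite powR_gt0.
  move/cvgrPdist_lt : ua => /(_ _ eq0); apply: filterS => n.
  rewrite !sub0r !normrN (ger0_norm (u0 n)) ger0_norm ?powR_ge0// => h.
  have : u n `^ q < (e `^ q^-1) `^ q.
    by apply: gt0_ltr_powR; rewrite ?nnegrE ?powR_ge0.
  by rewrite -powRrM mulVf ?gt_eqF// powRr1// ltW.
have : {for a, continuous (fun x : R => x `^ q)}.
  apply: differentiable_continuous; apply/derivable1_diffP.
  by apply: derivable_powR; rewrite in_itv/= a0.
by move=> h; apply: (cvg_comp _ _ ua h).
Qed.

(** * Dyadic decomposition of powers *)

Section Levels.
Variables (p e : R).
Hypotheses (p2 : 2 < p) (e0 : 0 < e).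

Definition level (k : nat) : R := e * 2 ^+ k.

Lemma level_gt0 k : 0 < level k.
Proof. by rewrite mulr_gt0// exprn_gt0. Qed.

Lemma levelS k : level k.+1 = 2 * level k.
Proof. by rewrite /level exprS; ring. Qed.

(** A single term suffices: at the largest level l < z / 2 among those summed one has z - l >= l, so
    l^(p-2) (z - l)^2 >= l^p, while the truncated value is at most 4 l. If no level qualifies, the
    truncated value is at most 2 e. *)
Lemma levels_low z n : Num.min (Num.max z 0) (2 * level n) `^ p <=
  (2 * e) `^ p +
  4 `^ p * \sum_(k < n) (level k `^ (p - 2) * Num.max (z - level k) 0 ^+ 2).
Proof.
have p2' : (2 : R) < p by [].
have e0' : (0 : R) < e by [].
have p0 : 0 <= p by lra.
elim: n => [|n IH].
  rewrite big_ord0 mulr0 addr0 /level expr0 mulr1; apply: powR_homo => //.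
    by rewrite le_min le_max lexx orbT/=; lra.
  by rewrite ge_min lexx orbT.
have l0 := level_gt0 n.
rewrite big_ord_recr /= mulrDr addrA.
have [zl|lz] := leP z (2 * level n).
  have mz : Num.max z 0 <= 2 * level n by rewrite ge_max zl; lra.
  rewrite min_l; last by rewrite levelS; lra.
  rewrite min_l// in IH; rewrite (le_trans IH)// lerDl mulr_ge0 ?powR_ge0//.
  by rewrite mulr_ge0 ?powR_ge0// sqr_ge0.
apply: (@le_trans _ _ ((4 * level n) `^ p)).
  apply: powR_homo => //.
    by rewrite le_min le_max lexx orbT/= levelS; lra.
  by rewrite ge_min levelS; apply/orP; right; lra.
rewrite powRM//; last exact: ltW.
have h0 : 0 <= (2 * e) `^ p + 4 `^ p *
    \sum_(k < n) (level k `^ (p - 2) * Num.max (z - level k) 0 ^+ 2).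
  rewrite addr_ge0 ?powR_ge0// mulr_ge0 ?powR_ge0// sumr_ge0// => i _.
  by rewrite mulr_ge0 ?powR_ge0// sqr_ge0.
apply: (@le_trans _ _ (4 `^ p * (level n `^ (p - 2) * Num.max (z - level n) 0 ^+ 2))); last lra.
rewrite ler_wpM2l ?powR_ge0// -(powR_m2 p2 (ltW l0)) ler_wpM2l ?powR_ge0//.
rewrite max_l; last lra.
by rewrite lerXn2r ?nnegrE; lra.
Qed.

(** The sum of the geometric series of ratio 2^-(p-2). *)
Definition levels_cst : R := 2 `^ (p - 2) / (2 `^ (p - 2) - 1).

Lemma two_pow_gt1 : 1 < 2 `^ (p - 2) :> R.
Proof.
have p2' : (2 : R) < p by [].
rewrite -[X in X < _](_ : 1 `^ (p - 2) = 1 :> R); last by rewrite powR1.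
by apply: gt0_ltr_powR; rewrite ?nnegrE; lra.
Qed.

Lemma levels_cst_ge0 : 0 <= levels_cst.
Proof. by have := two_pow_gt1 => h; rewrite divr_ge0// ?powR_ge0//; lra. Qed.

(** The powers l^(p-2) of the levels below z form a geometric progression, whose sum is a multiple
    of the last term, itself at most z^(p-2). *)
Lemma levels_up z n :
  \sum_(k < n) (level k `^ (p - 2) * (level k < z)%R%:R) <= levels_cst * Num.max z 0 `^ (p - 2).
Proof.
have h1 := two_pow_gt1.
have p2' : (2 : R) < p by [].
have q0 : 0 <= p - 2 by lra.
have geom k : (\sum_(i < k) level i `^ (p - 2)) * (2 `^ (p - 2) - 1) <= level k `^ (p - 2).
  elim: k => [|k IH]; first by rewrite big_ord0 mul0r powR_ge0.
  rewrite big_ord_recr /= mulrDl levelS powRM//; last exact/ltW/level_gt0.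
  lra.
elim: n => [|n IH].
  by rewrite big_ord0 mulr_ge0 ?powR_ge0// levels_cst_ge0.
have [zl|lz] := leP z (level n).
  by rewrite big_ord_recr/= ltNge zl mulr0 addr0.
apply: (@le_trans _ _ (\sum_(k < n.+1) level k `^ (p - 2))).
  by apply: ler_sum => k _; rewrite ler_piMr ?powR_ge0// lern1 leq_b1.
have l0 := level_gt0 n.
rewrite max_l; last lra.
rewrite /levels_cst mulrAC ler_pdivlMr; last lra.
apply: (le_trans (geom n.+1)); rewrite levelS powRM//; last exact: ltW.
by rewrite ler_wpM2l ?powR_ge0// powR_homo// ltW.
Qed.

End Levels.
End Powers.

(** * The L^p coercivity inequality *)

Section Poincare.
Context {R : realType} {d : measure_display} {X : metricMeasurableType R d}.
Variable m : {finite_measure set X -> \bar R}.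
Variables (D : set (X -> R)) (E : (X -> R) -> (X -> R) -> R).
Hypothesis hdf : symmetric_dirichlet_form m D E.
Hypothesis hreg : regular_form m D E.
Hypothesis hloc : strongly_local m D E.
Variable G : (X -> R) -> (X -> R) -> (X -> R).
Hypothesis hcdc : carre_du_champ m D E G.
Hypothesis hcoer : coercive_form m D E.
Variable p : R.
Hypothesis p2 : 2 < p.
Implicit Types (u v w f z : X -> R) (a b c e : R).
Local Notation slope := (slope G).
Local Notation mass := (mass m).
Local Notation Dp := (Dp m D G p).

Lemma measurable_pow u q : measurable_fun setT u -> measurable_fun setT (fun x => u x `^ q).
Proof. by move=> mu; exact: (measurableT_comp (measurable_powR q) mu). Qed.

Lemma LpP q u : 1 <= q -> u \in Lfun m q%:E <->
  measurable_fun setT u /\ intg m (fun x => `|u x| `^ q).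
Proof.
move=> q1; split.
  move=> hu; split; last exact: Lfun_integrable.
  by move: hu; rewrite inE => /andP[/[!inE]].
move=> [mu /integrableP[_ iu]]; rewrite inE; apply/andP; split; rewrite inE//=.
rewrite /finite_norm unlock poweR_lty//.
move: iu; congr (_ < _)%E; apply: eq_integral => x _ /=.
by rewrite ger0_norm ?powR_ge0.
Qed.

Lemma DpP u : Dp u <-> [/\ D u, intg m (fun x => `|u x| `^ p) &
  intg m (fun x => slope u x `^ p)].
Proof.
have p2' : (2 : R) < p by [].
have p1 : 1 <= p by lra.
have aS x : `|slope u x| = slope u x by rewrite ger0_norm ?slope_ge0.
split.
  move=> [Du /(LpP _ p1)[_ iu] /(LpP _ p1)[_ iS]]; split => //.
  by move: iS; congr (intg m _); apply/funext => x; rewrite -/(slope u x) aS.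
move=> [Du iu iS]; split => //; apply/LpP => //; split => //.
- exact: (Dmeas hdf).
- exact: (slope_meas hcdc).
- by move: iS; congr (intg m _); apply/funext => x; rewrite -/(slope u x) aS.
Qed.

Lemma coercive_real : exists2 K, 0 <= K & forall u, D u -> sqn m u <= K * E u u.
Proof.
case: hcoer => k hk; exists `|k| => // u Du.
have E0 := df_ge0 hdf Du.
suff : sqn m u <= k * E u u.
  by move=> /le_trans; apply; rewrite ler_wpM2r// ler_norm.
have := hk u Du; have := df_L2 hdf Du.
rewrite inE => /andP[_]; rewrite inE /= /finite_norm => Nlt.
have N0 := @Lnorm_ge0 _ _ _ m 2%:E (EFin \o u).
have h2 := @poweR_Lnorm _ _ _ m (EFin \o u) 2 _.
move: h2 N0 Nlt; case: (Lnorm m 2%:E (EFin \o u)) => // r h2 N0 _.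
rewrite -EFinM lee_fin -expr2; apply: le_trans.
have r0 : 0 <= r by rewrite -lee_fin.
rewrite -(powR_mulrn 2 r0) -lee_fin -poweR_EFin h2 ?pnatr_eq0//.
rewrite /sqn /Rintegral fineK; last by apply: integrable_fin_num => //; have [] := DL2 hdf Du.
rewrite le_eqVlt; apply/orP; left; apply/eqP; apply: eq_integral => x _ /=.
by rewrite powR_mulrn// real_normK ?num_real.
Qed.

Lemma ind_set (b : X -> bool) x : \1_[set y | b y] x = (b x)%:R :> R.
Proof.
rewrite indicE; case: (boolP (b x)) => bx; first by rewrite mem_set.
by rewrite memNset//; exact/negP.
Qed.

Lemma slope2_intg u : D u -> intg m (fun x => slope u x ^+ 2).
Proof.
move=> Du; apply: (intg_ae_eq _ (G_intg hcdc Du Du)); last exact: (slopeE hcdc Du).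
by apply: measurable_funX; exact: (slope_meas hcdc).
Qed.

(** L^2 coercivity of (z - a)^+, whose slope is that of z restricted to [a < z]; the 1/2 is the
    normalisation of the energy. *)
Lemma level_poincare K a z : (forall u, D u -> sqn m u <= K * E u u) -> D z -> 0 <= a ->
  intg m (fun x => (a < z x)%R%:R * slope z x ^+ 2) /\
  sqn m (excess a z) <= K / 2 * \int[m]_x ((a < z x)%R%:R * slope z x ^+ 2).
Proof.
move=> hK Dz a0; have [De _] := exc_D hdf a0 Dz.
have lz := trunc_local_all hdf hreg hloc hcdc Dz.
have lnz := trunc_local_all hdf hreg hloc hcdc (neg_D hdf Dz).
have mz := Dmeas hdf Dz.
have iS : intg m (fun x => (a < z x)%R%:R * slope z x ^+ 2).
  have mA : measurable [set x | a < z x].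
    by apply: measurable_bool; apply: measurable_fun_ltr.
  have := intg_ind mA (slope2_intg Dz).
  by under eq_fun do rewrite ind_set.
split => //.
apply: (le_trans (hK _ De)).
have -> : \int[m]_x ((a < z x)%R%:R * slope z x ^+ 2) = \int[m]_x G (excess a z) (excess a z) x.
  apply: Rint_ae_eq; [exact: intg_meas iS|exact: (G_meas hcdc)|].
  apply: (ae_imp2 (slope_exc hdf hcdc Dz lz lnz a0) (slopeE hcdc De)) => x h1 <-.
  by rewrite h1; case: ifP => _; rewrite ?mul1r// mul0r expr0n.
by rewrite (E_G hloc hcdc De De) mulrA.
Qed.

Lemma levels_poincare K e z : (forall u, D u -> sqn m u <= K * E u u) -> 0 < e -> D z ->
  forall n : nat,
  let P x := \sum_(k < n) (level e k `^ (p - 2) * excess (level e k) z x ^+ 2) in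
  let Q x := (\sum_(k < n) (level e k `^ (p - 2) * (level e k < z x)%R%:R)) * slope z x ^+ 2 in
  [/\ intg m P, intg m Q & \int[m]_x P x <= K / 2 * \int[m]_x Q x].
Proof.
move=> hK e0 Dz; elim=> [|n [iP iQ PQ]].
  have -> : (fun x => \sum_(k < 0) (level e k `^ (p - 2) * excess (level e k) z x ^+ 2)) = (fun=> 0).
    by apply/funext => x; rewrite big_ord0.
  have -> : (fun x => (\sum_(k < 0) (level e k `^ (p - 2) * (level e k < z x)%R%:R)) * slope z x ^+ 2) = (fun=> 0).
    by apply/funext => x; rewrite big_ord0 mul0r.
  move=> P Q; split; [exact: intg0|exact: intg0|].
  by rewrite /P /Q Rint_cst mul0r mulr0.
have l0 := ltW (level_gt0 e0 n).
have [De _] := exc_D hdf l0 Dz.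
have [iS hS] := level_poincare hK Dz l0.
have [_ ie] := DL2 hdf De.
have Pr : (fun x => \sum_(k < n.+1) (level e k `^ (p - 2) * excess (level e k) z x ^+ 2)) =
  (fun x => \sum_(k < n) (level e k `^ (p - 2) * excess (level e k) z x ^+ 2) +
     level e n `^ (p - 2) * excess (level e n) z x ^+ 2).
  by apply/funext => x; rewrite big_ord_recr.
have Qr : (fun x => (\sum_(k < n.+1) (level e k `^ (p - 2) * (level e k < z x)%R%:R)) * slope z x ^+ 2) =
  (fun x => (\sum_(k < n) (level e k `^ (p - 2) * (level e k < z x)%R%:R)) * slope z x ^+ 2 +
     level e n `^ (p - 2) * ((level e n < z x)%R%:R * slope z x ^+ 2)).
  by apply/funext => x; rewrite big_ord_recr/= mulrDl mulrA.
move=> P Q; rewrite /P /Q Pr Qr; split.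
- by apply: intgD => //; exact: intgZ.
- by apply: intgD => //; exact: intgZ.
- rewrite RintD//; last exact: intgZ.
  rewrite RintD//; last exact: intgZ.
  rewrite !RintZ// mulrDr lerD// mulrCA ler_wpM2l ?powR_ge0//.
Qed.

Lemma exc0E z x : excess 0 z x = Num.max (z x) 0.
Proof. by rewrite /excess subr0. Qed.

Lemma exc0_pow_intg z : Dp z -> intg m (fun x => excess 0 z x `^ p).
Proof.
move=> /DpP[Dz iz _]; have p2' : (2 : R) < p by [].
apply: (intg_dom _ iz).
  by apply: measurable_pow; apply: meas_exc; exact: (Dmeas hdf).
move=> x; rewrite ger0_norm ?powR_ge0//; apply: powR_homo; rewrite ?exc_ge0//; first lra.
by rewrite exc0E ge_max normr_ge0 andbT ler_norm.
Qed.

(* Sum the L^2 inequality for (z - l)^+ over the dyadic levels l = e 2^k with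
   weights l^(p-2), let e tend to 0, and absorb \int z^(p-2) Gamma(z). *)
Lemma poincare_pos : exists2 C, 0 <= C & forall z, Dp z ->
  \int[m]_x (excess 0 z x `^ p) <= C * \int[m]_x (slope z x `^ p).
Proof.
have p2' : (2 : R) < p by [].
have [K K0 hK] := coercive_real.
have [L L0 hL] : exists2 L, 0 <= L & forall e t (n : nat), 0 < e ->
    \sum_(k < n) (level e k `^ (p - 2) * (level e k < t)%R%:R) <= L * Num.max t 0 `^ (p - 2).
  exists (levels_cst p) => [|e t n e0]; first exact: levels_cst_ge0.
  exact: levels_up.
(* [4 ^ p] comes from [levels_low], K / 2 from the L^2 inequality at each level, L from
   [levels_up]. *)
pose c1 := 4 `^ p * (K / 2) * L.
have c10 : 0 <= c1.
  have h4 : 0 <= 4 `^ p :> R := powR_ge0 _ _.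
  by rewrite /c1; apply: mulr_ge0 => //; apply: mulr_ge0 => //; apply: mulr_ge0.
(* Makes c1 h^2 <= 1/2, so that c1 h^2 A is absorbed into A, which is finite because z is in
   [Dp]. *)
have [h h0 [hc _]] := small_sqr (ltac:(lra) : 0 < 1 / 2 :> R) c10.
exists (2 * c1 * (h `^ (p - 2))^-1).
  by apply: mulr_ge0; [exact: mulr_ge0|rewrite invr_ge0 powR_ge0].
move=> z Dpz; have iA := exc0_pow_intg Dpz.
have [Dz iz iS] := (DpP z).1 Dpz.
have mz := Dmeas hdf Dz.
set A := \int[m]_x _; set B := \int[m]_x _.
pose Y x := excess 0 z x `^ (p - 2) * slope z x ^+ 2.
have Yle x : Y x <= h ^+ 2 * excess 0 z x `^ p + (h `^ (p - 2))^-1 * slope z x `^ p.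
  by apply: young_m2; rewrite ?exc_ge0 ?slope_ge0.
have iYr : intg m (fun x => h ^+ 2 * excess 0 z x `^ p + (h `^ (p - 2))^-1 * slope z x `^ p).
  by apply: intgD; exact: intgZ.
have iY : intg m Y.
  apply: (intg_dom _ iYr).
    apply: measurable_funM; first by apply: measurable_pow; exact: meas_exc.
    by apply: measurable_funX; exact: (slope_meas hcdc).
  by move=> x; rewrite ger0_norm ?Yle// mulr_ge0 ?powR_ge0 ?sqr_ge0.
have IY : \int[m]_x Y x <= h ^+ 2 * A + (h `^ (p - 2))^-1 * B.
  apply: (le_trans (Rint_le iY iYr Yle)).
  by rewrite RintD ?RintZ//; exact: intgZ.
have main e : 0 < e -> A <= (2 * e) `^ p * mass + c1 * \int[m]_x Y x.
  move=> e0.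
  have l0 n : 0 < level e n := level_gt0 e0 n.
  pose F n x := Num.min (excess 0 z x) (2 * level e n) `^ p.
  have Fbase n x : 0 <= Num.min (excess 0 z x) (2 * level e n).
    by rewrite le_min exc_ge0/= mulr_ge0// ltW.
  have mF n : measurable_fun setT (F n).
    apply: measurable_pow; apply: measurable_minr => //; exact: meas_exc.
  have iF n : intg m (F n).
    apply: (intg_dom _ iA) => // x; rewrite ger0_norm ?powR_ge0//.
    by apply: powR_homo => //; [lra|rewrite ge_min lexx].
  have FA n : \int[m]_x F n x <= (2 * e) `^ p * mass + c1 * \int[m]_x Y x.
    have [iP iQ PQ] := levels_poincare hK e0 Dz n.
    apply: (@le_trans _ _ (\int[m]_x ((2 * e) `^ p + 4 `^ p *
        \sum_(k < n) (level e k `^ (p - 2) * excess (level e k) z x ^+ 2)))).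
      apply: Rint_le => //; first by apply: intgD; [exact: intg_cst|exact: intgZ].
      by move=> x; rewrite /F exc0E; exact: levels_low.
    rewrite RintD; [|exact: intg_cst|exact: intgZ].
    rewrite Rint_cst lerD2l RintZ// /c1 -!mulrA ler_wpM2l ?powR_ge0//.
    apply: (le_trans PQ); rewrite -!mulrA ler_wpM2l// ler_wpM2l// -RintZ//.
    apply: Rint_le => //; first exact: intgZ.
    move=> x; rewrite /Y mulrA ler_wpM2r ?sqr_ge0// exc0E.
    exact: hL.
  have [] // := @intg_trunc _ _ _ m (fun x => excess 0 z x `^ p) F
     ((2 * e) `^ p * mass + c1 * \int[m]_x Y x) (intg_meas iA) iF.
  - by move=> n x; exact: powR_ge0.
  - move=> n x; apply: powR_homo => //; first lra.
    rewrite le_min !ge_min lexx/= levelS; apply/orP; right.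
    have := l0 n; lra.
  - move=> x; apply: cvg_near_cst; near=> n.
    rewrite /F min_l//.
    have : excess 0 z x / e <= n%:R.
      near: n; exists (Num.truncn (excess 0 z x / e)).+1 => // n /= hn.
      by rewrite (le_trans (ltW (truncnS_gt _)))// ler_nat.
    rewrite ler_pdivrMr// => /le_trans; apply.
    have : n%:R <= 2 ^+ n :> R by rewrite -natrX ler_nat ltnW// ltn_expl.
    have : 0 <= n%:R :> R by [].
    rewrite /level; move: (n%:R : R) (2 ^+ n : R) => s t s0 st.
    have : s * e <= t * e by rewrite ler_pM2r.
    have : 0 <= t * e by rewrite mulr_ge0 ?(ltW e0)//; lra.
    lra.
rewrite -subr_le0; apply: (@le0_addgt0 _ _ (2 * mass)) => t t0.
(* With s <= 1 one has s^p <= s <= t: the lowest level e = s / 2 tends to 0 and the term (2 e)^p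
   disappears. *)
pose s := Num.min t 1; have s0 : 0 < s by rewrite lt_min t0 ltr01.
have s1 : s <= 1 by rewrite ge_min lexx orbT.
have st : s <= t by rewrite ge_min lexx.
have /main : 0 < s / 2 by lra.
have -> : 2 * (s / 2) = s by field.
have sp : s `^ p <= s by apply: ge1r_powR; [apply/andP|lra].
have m0 := mass_ge0 m.
have A0 : 0 <= A by apply: Rintegral_ge0 => x _; exact: powR_ge0.
have h1 : s `^ p * mass <= t * mass by rewrite ler_wpM2r// (le_trans sp).
have h2 : c1 * \int[m]_x Y x <= c1 * (h ^+ 2 * A + (h `^ (p - 2))^-1 * B).
  by rewrite ler_wpM2l.
have h3 : c1 * h ^+ 2 * A <= 1 / 2 * A by rewrite ler_wpM2r.
lra.
Unshelve. all: by end_near.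
Qed.

End Poincare.

(** * The Banach space D_p *)

Section DpSpace.
Context {R : realType} {d : measure_display} {X : metricMeasurableType R d}.
Variable m : {finite_measure set X -> \bar R}.
Variables (D : set (X -> R)) (E : (X -> R) -> (X -> R) -> R).
Hypothesis hdf : symmetric_dirichlet_form m D E.
Hypothesis hreg : regular_form m D E.
Hypothesis hloc : strongly_local m D E.
Variable G : (X -> R) -> (X -> R) -> (X -> R).
Hypothesis hcdc : carre_du_champ m D E G.
Hypothesis hcoer : coercive_form m D E.
Variable p : R.
Hypothesis p2 : 2 < p.
Implicit Types (u v w f g z : X -> R) (a b c e s t : R).
Local Notation slope := (slope G).
Local Notation mass := (mass m).
Local Notation Dp := (Dp m D G p).
Local Notation DpP := (DpP hdf hcdc p2).

Lemma Dp_D u : Dp u -> D u. Proof. by case. Qed.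

Lemma Dp_u u : Dp u -> intg m (fun x => `|u x| `^ p). Proof. by move=> /DpP[]. Qed.

Lemma Dp_S u : Dp u -> intg m (fun x => slope u x `^ p). Proof. by move=> /DpP[]. Qed.

Lemma intg_pow_le f g : measurable_fun setT f -> intg m (fun x => g x `^ p) ->
  (\forall x \ae m, 0 <= f x <= g x) -> intg m (fun x => f x `^ p).
Proof.
have p2' : (2 : R) < p by [].
move=> mf ig fg; apply: (intg_ae_dom _ ig); first exact: measurable_pow.
apply: filterS fg => x /andP[f0 fg]; rewrite ger0_norm ?powR_ge0//.
by apply: powR_homo => //; lra.
Qed.

Lemma intg_powD f g : measurable_fun setT f -> measurable_fun setT g ->
  (forall x, 0 <= f x) -> (forall x, 0 <= g x) ->
  intg m (fun x => f x `^ p) -> intg m (fun x => g x `^ p) ->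
  intg m (fun x => (f x + g x) `^ p).
Proof.
have p2' : (2 : R) < p by [].
move=> mf mg f0 g0 hf hg.
apply: (intg_dom _ (intgZ (2 `^ p) (intgD hf hg))).
  by apply: measurable_pow; exact: measurable_funD.
move=> x; rewrite ger0_norm ?powR_ge0//; apply: powRD_le => //; lra.
Qed.

Lemma Dp_dom z u : D u -> Dp z -> (forall x, `|u x| <= `|z x|) ->
  (\forall x \ae m, slope u x <= slope z x) -> Dp u.
Proof.
move=> Du /DpP[Dz iz iS] h1 h2; have mu := Dmeas hdf Du.
apply/DpP; split; [by []| |].
- apply: intg_pow_le iz _; first exact: measurableT_comp.
  by apply: aeW => x; rewrite normr_ge0 h1.
- apply: intg_pow_le iS _; first exact: (slope_meas hcdc).
  by apply: filterS h2 => x ->; rewrite slope_ge0.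
Qed.

Lemma DpD u v : Dp u -> Dp v -> Dp (u \+ v).
Proof.
move=> /DpP[Du iu iSu] /DpP[Dv iv iSv].
have mu := Dmeas hdf Du; have mv := Dmeas hdf Dv.
have Dw := DD hdf Du Dv.
apply/DpP; split; [by []| |].
- apply: (@intg_pow_le _ (fun x => `|u x| + `|v x|)).
  + by apply: measurableT_comp => //; exact: measurable_funD.
  + by apply: intg_powD => //; exact: measurableT_comp.
  + by apply: aeW => x; rewrite normr_ge0 ler_normD.
- apply: (@intg_pow_le _ (fun x => slope u x + slope v x)).
  + exact: (slope_meas hcdc).
  + by apply: intg_powD => //; [exact: (slope_meas hcdc)|exact: (slope_meas hcdc)|move=> x; exact: slope_ge0|move=> x; exact: slope_ge0].
  + by apply: filterS (slopeD hdf hcdc Du Dv) => x ->; rewrite slope_ge0.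
Qed.

Lemma powZ a f : (fun x => `|(a \*o f) x| `^ p) = (fun x => `|a| `^ p * `|f x| `^ p).
Proof. by apply/funext => x /=; rewrite normrM powRM. Qed.

Lemma slopeZ_pow a u : D u ->
  \forall x \ae m, slope (a \*o u) x `^ p = `|a| `^ p * slope u x `^ p.
Proof.
move=> Du; apply: filterS (slopeZ hdf hcdc a Du) => x ->.
by rewrite powRM// slope_ge0.
Qed.

Lemma DpZ a u : Dp u -> Dp (a \*o u).
Proof.
move=> /DpP[Du iu iSu]; have Dw := DZ hdf a Du; apply/DpP; split; [by []| |].
  by rewrite powZ; exact: intgZ.
apply: (intg_ae_eq _ (intgZ (`|a| `^ p) iSu)); last exact: slopeZ_pow.
by apply: measurable_pow; exact: (slope_meas hcdc).
Qed.

Lemma DpB u v : Dp u -> Dp v -> Dp (u \- v).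
Proof. by move=> hu hv; rewrite sub_fun_lin; apply: DpD => //; exact: DpZ. Qed.

Lemma G_0 : \forall x \ae m, G (cst 0) (cst 0) x = 0.
Proof.
have D0 := D0 hdf; have := GZl hdf hcdc 0 D0 D0.
have -> : 0 \*o cst 0 = cst 0 :> (X -> R) by apply/funext => x /=; rewrite mul0r.
by apply: filterS => x ->; rewrite mul0r.
Qed.

Lemma Dp_0 : Dp (cst 0).
Proof.
have p2' : (2 : R) < p by [].
have D0 := D0 hdf; have p0 : p != 0 by rewrite gt_eqF//; lra.
apply/DpP; split; [by []| |].
  by under eq_fun do rewrite normr0 powR0//; exact: intg0.
apply: (intg_ae_eq _ (intg0 m)).
  by apply: measurable_pow; exact: (slope_meas hcdc).
by apply: filterS G_0 => x h; rewrite (slope0 h) powR0.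
Qed.

Lemma Dp_ae u v : Dp u -> measurable_fun setT v -> u = v %[ae m] -> Dp v.
Proof.
move=> /DpP[Du iu iSu] mv uv; have Dv := fs_ae (df_space hdf) Du mv uv.
have {}uv := (eq_aeP _ _ _).1 uv.
apply/DpP; split; [by []| |].
- apply: (intg_ae_eq _ iu); first by apply: measurable_pow; exact: measurableT_comp.
  by apply: filterS uv => x ->.
- apply: (intg_ae_eq _ iSu); first by apply: measurable_pow; exact: (slope_meas hcdc).
  by apply: filterS (slope_ae hcdc Du Dv uv) => x h; rewrite /slope h.
Qed.

Lemma Dp_space : function_space m Dp.
Proof.
split.
- by move=> u /Dp_D; exact: (Dmeas hdf).
- exact: Dp_ae.
- exact: Dp_0.
- by move=> a u v Du Dv; apply: DpD => //; exact: DpZ.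
Qed.

(* Locked because [lra] compares its atoms up to conversion, which would unfold
   powers and integrals. *)
Definition upow u : R := locked (fun v => \int[m]_x (`|v x| `^ p)) u.
Definition spow u : R := locked (fun v => \int[m]_x (slope v x `^ p)) u.
Definition nrm u : R := locked (Dp_norm m G p) u.

Lemma upowE u : upow u = \int[m]_x (`|u x| `^ p).
Proof. by rewrite /upow -lock. Qed.

Lemma spowE u : spow u = \int[m]_x (slope u x `^ p).
Proof. by rewrite /spow -lock. Qed.

Lemma nrm_fun : Dp_norm m G p = nrm.
Proof. by apply/funext => u; rewrite /nrm -lock. Qed.

Local Notation N := nrm.

Definition pow_sum u : R := upow u + spow u.

Lemma upow_ge0 u : 0 <= upow u.
Proof. by rewrite upowE; apply: Rintegral_ge0 => x _; exact: powR_ge0. Qed.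

Lemma spow_ge0 u : 0 <= spow u.
Proof. by rewrite spowE; apply: Rintegral_ge0 => x _; exact: powR_ge0. Qed.

Lemma pow_sum_ge0 u : 0 <= pow_sum u.
Proof. exact: addr_ge0 (upow_ge0 u) (spow_ge0 u). Qed.

Lemma slope_powE u q : D u -> \forall x \ae m, G u u x `^ (q / 2) = slope u x `^ q.
Proof.
move=> Du; apply: filterS (slopeE hcdc Du) => x <-.
by rewrite powR_sqr ?slope_ge0//; congr (_ `^ _); field.
Qed.

Lemma normE u : D u -> N u = pow_sum u `^ p^-1.
Proof.
move=> Du; rewrite -nrm_fun /Dp_norm /pow_sum upowE spowE.
suff -> : \int[m]_x (G u u x `^ (p / 2)) = \int[m]_x (slope u x `^ p) by [].
apply: Rint_ae_eq; last exact: slope_powE.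
  by apply: measurable_pow; exact: (G_meas hcdc).
by apply: measurable_pow; exact: (slope_meas hcdc).
Qed.

Lemma p_gt0 : 0 < p.
Proof. have p2' : (2 : R) < p by []; lra. Qed.

Lemma p_ge0 : 0 <= p. Proof. exact: ltW p_gt0. Qed.

Lemma p_neq0 : p != 0. Proof. by rewrite gt_eqF// p_gt0. Qed.

Lemma nrm_pow u : D u -> N u `^ p = pow_sum u.
Proof.
by move=> Du; rewrite normE// -powRrM mulVf ?p_neq0// powRr1// pow_sum_ge0.
Qed.

Lemma nrm_ge0 u : 0 <= N u.
Proof. by rewrite -nrm_fun; exact: powR_ge0. Qed.

Lemma nrm_le u s : D u -> 0 <= s -> pow_sum u <= s `^ p -> N u <= s.
Proof.
move=> Du s0 h; rewrite normE//.
have -> : s = (s `^ p) `^ p^-1 by rewrite -powRrM mulfV ?p_neq0// powRr1.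
by apply: powR_homo; rewrite ?invr_ge0 ?p_ge0 ?pow_sum_ge0.
Qed.

Lemma pow_sum_le u s : D u -> N u <= s -> pow_sum u <= s `^ p.
Proof. by move=> Du h; rewrite -nrm_pow//; apply: powR_homo; rewrite ?p_ge0 ?nrm_ge0. Qed.

Lemma pow_sumZ a u : Dp u -> pow_sum (a \*o u) = `|a| `^ p * pow_sum u.
Proof.
move=> /DpP[Du iu iSu]; rewrite /pow_sum !upowE !spowE powZ RintZ// mulrDr; congr (_ + _).
rewrite -(RintZ _ iSu); apply: Rint_ae_eq; last exact: slopeZ_pow.
  by apply: measurable_pow; apply: (slope_meas hcdc); exact: (DZ hdf).
exact: intg_meas (intgZ _ iSu).
Qed.

Lemma nrm_scale a u : Dp u -> N (a \*o u) = `|a| * N u.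
Proof.
move=> hu; have Du := Dp_D hu.
rewrite !normE ?pow_sumZ//; last exact: (DZ hdf).
rewrite powRM ?powR_ge0 ?pow_sum_ge0// -powRrM mulfV ?p_neq0// powRr1//.
Qed.

Lemma powRV s : 0 <= s -> s^-1 `^ p = (s `^ p)^-1.
Proof. by move=> s0; rewrite -[s^-1]powR_inv1// powRAC powR_inv1// powR_ge0. Qed.

(** Convexity of x^p at s / a and t / b with weights a / (a + b) and b / (a + b), the pointwise half
    of Minkowski's inequality. *)
Lemma pow_add a b s t : 0 < a -> 0 < b -> 0 <= s -> 0 <= t ->
  (s + t) `^ p <=
  (a + b) `^ p * (a / (a + b) / a `^ p * s `^ p + b / (a + b) / b `^ p * t `^ p).
Proof.
move=> a0 b0 s0 t0; have ab : 0 < a + b by lra.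
have p1 : 1 <= p by have p2' : (2 : R) < p by []; lra.
have l0 : 0 <= a / (a + b) by rewrite divr_ge0// ltW.
have l1 : a / (a + b) <= 1 by rewrite ler_pdivrMr//; lra.
have sa : 0 <= s / a by rewrite divr_ge0// ltW.
have tb : 0 <= t / b by rewrite divr_ge0// ltW.
have := powR_convex p1 l0 l1 sa tb.
have -> : 1 - a / (a + b) = b / (a + b) by field; rewrite gt_eqF.
have -> : a / (a + b) * (s / a) + b / (a + b) * (t / b) = (s + t) / (a + b).
  by field; rewrite !gt_eqF.
move=> h.
have {1}-> : s + t = (a + b) * ((s + t) / (a + b)) by field; rewrite gt_eqF.
rewrite powRM; [|exact: ltW|by rewrite divr_ge0//; lra].
rewrite ler_wpM2l ?powR_ge0//; apply: (le_trans h).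
have e x y : 0 <= x -> 0 < y -> (x / y) `^ p = (y `^ p)^-1 * x `^ p.
  by move=> x0 y0; rewrite powRM ?invr_ge0 ?(ltW y0)// powRV ?(ltW y0)// mulrC.
by rewrite !e// !mulrA.
Qed.

(** The same weights serve for the functions and for their slopes, so both integrals add up to a
    triangle inequality for the combined norm. *)
Lemma pow_sumD u v a b : Dp u -> Dp v -> 0 < a -> 0 < b ->
  pow_sum u <= a `^ p -> pow_sum v <= b `^ p -> pow_sum (u \+ v) <= (a + b) `^ p.
Proof.
move=> hu hv a0 b0 hua hvb; have hw := DpD hu hv.
have [[Du iu iSu] [Dv iv iSv]] := ((DpP u).1 hu, (DpP v).1 hv).
have [Dw iw iSw] := (DpP _).1 hw.
set A := a / (a + b) / a `^ p; set B := b / (a + b) / b `^ p.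
set C := (a + b) `^ p.
have ab : 0 < a + b by exact: addr_gt0.
have h1 : upow (u \+ v) <= C * (A * upow u + B * upow v).
  rewrite !upowE -!RintZ// -RintD; [|exact: intgZ|exact: intgZ].
  rewrite -RintZ; last by apply: intgD; exact: intgZ.
  apply: Rint_le => //; first by apply: intgZ; apply: intgD; exact: intgZ.
  move=> x /=; apply: le_trans (pow_add a0 b0 (normr_ge0 (u x)) (normr_ge0 (v x))).
  by apply: powR_homo; rewrite ?p_ge0 ?ler_normD.
have h2 : spow (u \+ v) <= C * (A * spow u + B * spow v).
  rewrite !spowE -!RintZ// -RintD; [|exact: intgZ|exact: intgZ].
  rewrite -RintZ; last by apply: intgD; exact: intgZ.
  apply: Rint_ae_le => //; first by apply: intgZ; apply: intgD; exact: intgZ.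
  apply: filterS (slopeD hdf hcdc Du Dv) => x h.
  apply: le_trans (pow_add a0 b0 (slope_ge0 G u x) (slope_ge0 G v x)).
  by apply: powR_homo; rewrite ?p_ge0 ?slope_ge0.
have h3 : C * (A * pow_sum u + B * pow_sum v) <= C.
  rewrite -[leRHS]mulr1 ler_wpM2l ?powR_ge0//.
  have ap : 0 < a `^ p by rewrite powR_gt0.
  have bp : 0 < b `^ p by rewrite powR_gt0.
  have -> : 1 = A * a `^ p + B * b `^ p.
    by rewrite /A /B; field; rewrite !gt_eqF.
  by rewrite lerD// ler_wpM2l// !divr_ge0// ltW.
apply: le_trans h3; rewrite {1}/pow_sum; apply: (le_trans (lerD h1 h2)).
by rewrite -mulrDr addrACA -!mulrDr.
Qed.

Lemma nrm_triangle u v : Dp u -> Dp v -> N (u \+ v) <= N u + N v.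
Proof.
move=> hu hv; rewrite -subr_le0; apply: (@le0_addgt0 _ _ 2) => e e0.
(* [pow_sumD] divides by the radii, which must be positive even when a norm is 0. *)
have a0 : 0 < N u + e by have := nrm_ge0 u; lra.
have b0 : 0 < N v + e by have := nrm_ge0 v; lra.
suff : N (u \+ v) <= (N u + e) + (N v + e) by lra.
apply: nrm_le; [exact: Dp_D (DpD hu hv)|lra|].
by apply: pow_sumD => //; apply: pow_sum_le; rewrite ?lerDl ?(ltW e0)//; exact: Dp_D.
Qed.

Lemma nrm_eq0 u : Dp u -> N u = 0 <-> u = cst 0 %[ae m].
Proof.
move=> /DpP[Du iu iSu]; rewrite normE//; split.
  move=> /eqP; rewrite powR_eq0 => /andP[/eqP h _].
  have : \forall x \ae m, `|u x| `^ p = 0.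
    apply: Rint_ae0 => //; first by apply: aeW => x; exact: powR_ge0.
    by rewrite -upowE; have := spow_ge0 u; move: h; rewrite /pow_sum; lra.
  move=> {}h; apply/eq_aeP; apply: filterS h => x /eqP.
  by rewrite powR_eq0 normr_eq0 => /andP[/eqP].
move=> /eq_aeP u0.
have h1 : upow u = 0.
  rewrite upowE -(mul0r mass) -Rint_cst; apply: Rint_ae_eq => //; first exact: intg_meas iu.
  by apply: filterS u0 => x -> /=; rewrite normr0 powR0 ?p_neq0.
have h2 : spow u = 0.
  rewrite spowE -(mul0r mass) -Rint_cst; apply: Rint_ae_eq => //; first exact: intg_meas iSu.
  apply: (ae_imp2 (slope_ae hcdc Du (D0 hdf) u0) G_0) => x e1 e2.
  by rewrite slope0 ?e1// powR0 ?p_neq0.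
by rewrite /pow_sum h1 h2 addr0 powR0// invr_eq0 p_neq0.
Qed.

(** Scaling into the unit ball lets t <= 1 + t^p and t^2 <= 1 + t^p stand in for Hölder's
    inequality. A strict bound s > N u is used because N u may be 0; [le_scale] then returns to N
    u. *)
Lemma pow_sum_unit u s : Dp u -> N u < s -> pow_sum (s^-1 \*o u) <= 1.
Proof.
move=> hu us; have s0 : 0 < s by exact: le_lt_trans (nrm_ge0 u) us.
rewrite pow_sumZ// ger0_norm ?invr_ge0 ?(ltW s0)//.
rewrite powRV ?(ltW s0)// mulrC ler_pdivrMr ?powR_gt0// mul1r.
by apply: pow_sum_le; [exact: Dp_D|exact: ltW].
Qed.

Lemma scale_back u s : s != 0 -> u = s \*o (s^-1 \*o u).
Proof. by move=> s0; apply/funext => x /=; rewrite mulrA mulfV// mul1r. Qed.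

Lemma le_scale (x y C : R) : (forall s, y < s -> x <= C * s) -> x <= C * y.
Proof.
move=> h; rewrite -subr_le0; apply: (@le0_addgt0 _ _ C) => e e0.
have /h : y < y + e by rewrite ltrDl.
lra.
Qed.

(** After scaling, t^2 <= 1 + t^p bounds the energy and the squared L^2 norm. It turns Cauchy
    sequences of [Dp] into Cauchy sequences for the energy norm. *)
Lemma energy_bound u s : Dp u -> N u < s -> E u u + sqn m u <= s ^+ 2 * (2 * mass + 1).
Proof.
move=> hu us; have s0 : 0 < s by exact: le_lt_trans (nrm_ge0 u) us.
have hv := DpZ s^-1 hu; have hP := pow_sum_unit hu us.
rewrite {1 2 3}(scale_back u (lt0r_neq0 s0)).
move: hv hP; set v := s^-1 \*o u => hv hP.
have [Dv iv iSv] := (DpP v).1 hv.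
rewrite (EZZ hdf)// sqnZ; last exact: (DL2 hdf).
rewrite -mulrDr ler_wpM2l ?sqr_ge0//.
have sq x : 0 <= x -> x ^+ 2 <= 1 + x `^ p.
  move=> x0; rewrite -powR_mulrn//; apply: powR_le1D => //.
  exact: ltW.
have h1 : sqn m v <= mass + upow v.
  rewrite upowE -[X in X + _]mul1r -Rint_cst -RintD//; last exact: intg_cst.
  apply: Rint_le; [by case: (DL2 hdf Dv)|by apply: intgD => //; exact: intg_cst|].
  by move=> x; rewrite -[leLHS]real_normK ?num_real//; exact: sq.
have h2 : \int[m]_x G v v x <= mass + spow v.
  rewrite spowE -[X in X + _]mul1r -Rint_cst -RintD//; last exact: intg_cst.
  apply: Rint_ae_le; [exact: (G_intg hcdc)|by apply: intgD => //; exact: intg_cst|].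
  by apply: filterS (slopeE hcdc Dv) => x <-; apply: sq; exact: slope_ge0.
have h3 := E_G hloc hcdc Dv Dv; have h4 := df_ge0 hdf Dv.
rewrite /pow_sum in hP; lra.
Qed.

Lemma embed_L1 u : Dp u -> u \in Lfun m 1 /\
  ('N[m]_1[EFin \o u] <= ((mass + 1) * nrm u)%:E)%E.
Proof.
move=> hu; have [Du iu iSu] := (DpP u).1 hu.
have mu := Dmeas hdf Du.
have i1 : intg m (fun x => `|u x|).
  apply: (intg_dom _ (intgD (intg_cst m 1) iu)); first exact: measurableT_comp.
  move=> x; rewrite normr_id -[leLHS]powRr1//; apply: powR_le1D => //.
  have p2' : (2 : R) < p by []; lra.
have iu1 : intg m u by apply: (intg_dom mu i1).
split; first exact/Lfun1_integrable.
rewrite Lnorm1.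
have -> : (\int[m]_x `|(EFin \o u) x| = (\int[m]_x `|u x|)%:E)%E.
  by rewrite /Rintegral fineK//; exact: integrable_fin_num i1.
rewrite lee_fin; apply: le_scale => s us.
have s0 : 0 < s by exact: le_lt_trans (nrm_ge0 u) us.
have hv := DpZ s^-1 hu; have hP := pow_sum_unit hu us.
have [Dv iv iSv] := (DpP _).1 hv.
have -> : \int[m]_x `|u x| = s * \int[m]_x (s^-1 * `|u x|).
  by rewrite RintZ// mulrA mulfV ?mul1r// gt_eqF.
rewrite mulrC ler_wpM2r ?(ltW s0)//.
apply: (@le_trans _ _ (\int[m]_x (1 + `|(s^-1 \*o u) x| `^ p))).
  apply: Rint_le; [exact: intgZ|by apply: intgD => //; exact: intg_cst|move=> x].
  rewrite /= normrM (ger0_norm (_ : 0 <= s^-1)) ?invr_ge0 ?(ltW s0)//.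
  rewrite -[leLHS]powRr1 ?mulr_ge0 ?invr_ge0 ?(ltW s0)//; apply: powR_le1D => //.
    by rewrite mulr_ge0 ?invr_ge0 ?(ltW s0).
  have p2' : (2 : R) < p by []; lra.
rewrite RintD ?Rint_cst ?mul1r//; last exact: intg_cst.
by rewrite lerD2l -upowE (le_trans _ hP)// /pow_sum lerDl spow_ge0.
Qed.

(* min(h, n)^p <= 2^p (h'^p + n^(p-2) |h - h'|^2). *)
Lemma Lp_closed (h : X -> R) c : measurable_fun setT h -> (forall x, 0 <= h x) -> 0 <= c ->
  (forall e, 0 < e -> exists h' g, [/\ intg m (fun x => h' x `^ p),
     forall x, 0 <= h' x, \int[m]_x (h' x `^ p) <= c,
     intg m (fun x => g x ^+ 2) /\ \int[m]_x (g x ^+ 2) <= e &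
     \forall x \ae m, `|h x - h' x| <= g x]) ->
  intg m (fun x => h x `^ p) /\ \int[m]_x (h x `^ p) <= 2 `^ p * c.
Proof.
move=> mh h0 c0 H.
have p2' : (2 : R) < p by [].
pose F (n : nat) x := Num.min (h x) n%:R `^ p.
have F0 n x : 0 <= Num.min (h x) n%:R by rewrite le_min h0 ler0n.
have mF n : measurable_fun setT (F n).
  by apply: measurable_pow; apply: measurable_minr.
have iF n : intg m (F n).
  apply: (intg_dom _ (intg_cst m (n%:R `^ p))) => // x.
  rewrite ger0_norm ?powR_ge0//; apply: powR_homo => //; first lra.
  by rewrite ge_min lexx orbT.
apply: (@intg_trunc _ _ _ m (fun x => h x `^ p) F) => //.
- exact: measurable_pow.
- by move=> n x; exact: powR_ge0.
- move=> n x; apply: powR_homo => //; first lra.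
  by rewrite le_min !ge_min lexx/= ler_nat leqnSn orbT.
- move=> x; apply: cvg_near_cst; near=> n; rewrite /F min_l//.
  near: n; exists (Num.truncn (h x)).+1 => // n /= hn.
  by rewrite (le_trans (ltW (truncnS_gt _)))// ler_nat.
- move=> n; rewrite -subr_le0; apply: (@le0_addgt0 _ _ (2 `^ p * n%:R `^ (p - 2))) => e e0.
  have [h' [g [ih' h'0 hc [ig ge] hg]]] := H _ e0.
  suff : \int[m]_x F n x <= \int[m]_x (2 `^ p * (h' x `^ p + n%:R `^ (p - 2) * g x ^+ 2)).
    rewrite RintZ; last by apply: intgD => //; exact: intgZ.
    rewrite RintD//; last exact: intgZ.
    rewrite RintZ//.
    move=> /le_trans hh; rewrite lerBlDl; apply: hh.
    rewrite -mulrA -mulrDr ler_wpM2l ?powR_ge0// lerD// ler_wpM2l ?powR_ge0//.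
  apply: Rint_ae_le => //.
    by apply: intgZ; apply: intgD => //; exact: intgZ.
  apply: filterS hg => x hx; rewrite /F.
  set t := `|h x - h' x| in hx.
  have t0 : 0 <= t by exact: normr_ge0.
  have ht : h x <= h' x + t by rewrite /t; have := ler_norm (h x - h' x); lra.
  set M := n%:R; have M0 : 0 <= M by exact: ler0n.
  have mt0 : 0 <= Num.min t M by rewrite le_min t0.
  have h1 : Num.min (h x) M <= h' x + Num.min t M.
    have [tM|Mt] := leP t M; first by rewrite ge_min ht.
    by rewrite ge_min; apply/orP; right; rewrite lerDr.
  apply: (@le_trans _ _ ((h' x + Num.min t M) `^ p)).
    by apply: powR_homo; [exact: p_ge0|exact: (F0 n)|exact: h1].
  apply: (le_trans (powRD_le _ (h'0 x) mt0)); first lra.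
  rewrite ler_wpM2l ?powR_ge0// lerD2l -(powR_m2 p2 mt0).
  apply: ler_pM; rewrite ?powR_ge0 ?sqr_ge0//.
    by apply: powR_homo => //; [lra|rewrite ge_min lexx orbT].
  by rewrite lerXn2r ?nnegrE ?(le_trans t0 hx)// ge_min hx.
Unshelve. all: by end_near.
Qed.

(** The limit w is provided by completeness of [D] in energy norm. Bounds on u_n - u_k in [Dp] pass
    to u_n - w by [Lp_closed], with u_k - w as the L^2 error; the factor 2^p lost in each of the two
    integrals is covered by (4 e)^p. *)
Lemma Dp_complete : complete_space Dp N.
Proof.
move=> u hu uC.
have p2' : (2 : R) < p by [].
have Du n : D (u n) := Dp_D (hu n).
have K0 : 0 < 2 * mass + 2 by have := mass_ge0 m; lra.
have uCE : cauchy_seq (energy_norm m E) u.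
  move=> e e0.
  have [s s0 es] : exists2 s, 0 < s & e = s * (2 * mass + 2).
    by exists (e / (2 * mass + 2)); rewrite ?divr_gt0// divfK// gt_eqF.
  have [n0 hn] := uC _ s0; exists n0 => i j hi hj.
  apply: (lt_energy hdf) => //; first exact: (DB hdf).
  apply: (le_lt_trans (energy_bound (DpB (hu i) (hu j)) (hn _ _ hi hj))).
  rewrite es exprMn ltr_pM2l ?exprn_gt0//.
  have := mass_ge0 m; move: mass => M M0; nra.
have [w Dw uw] := df_closed hdf Du uCE.
have key e : 0 < e -> exists n0, forall n, (n0 <= n)%N ->
    Dp (u n \- w) /\ pow_sum (u n \- w) <= (4 * e) `^ p.
  move=> e0; have [n0 hn] := uC _ e0; exists n0 => n n0n.
  have Dnw := DB hdf (Du n) Dw.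
  have approx r : 0 < r -> exists k, [/\ pow_sum (u n \- u k) <= e `^ p,
      sqn m (u k \- w) <= r & \int[m]_x (slope (u k \- w) x ^+ 2) <= r].
    move=> r0; have [t t0 [tr t1]] := small_sqr r0 (ler0n _ 2).
    move/cvgrPdist_lt : uw => /(_ t t0) [N0 _ hN].
    have := hN (maxn n0 N0) (leq_maxr _ _); rewrite sub0r normrN.
    have Dkw := DB hdf (Du (maxn n0 N0)) Dw.
    move=> /(le_lt_trans (ler_norm _)) /(energy_lt hdf t0 Dkw)[hE hs].
    exists (maxn n0 N0); split.
    - apply: pow_sum_le; [exact: (DB hdf)|].
      by apply: ltW; apply: hn => //; exact: leq_maxl.
    - have := sqr_ge0 t; lra.
    - have -> : \int[m]_x (slope (u (maxn n0 N0) \- w) x ^+ 2) =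
          \int[m]_x G (u (maxn n0 N0) \- w) (u (maxn n0 N0) \- w) x.
        apply: Rint_ae_eq; last exact: (slopeE hcdc).
          exact: intg_meas (slope2_intg hcdc Dkw).
        exact: (G_meas hcdc).
      have := E_G hloc hcdc Dkw Dkw; lra.
  have ep : 0 <= e `^ p by exact: powR_ge0.
  have [] := @Lp_closed (fun x => `|(u n \- w) x|) (e `^ p) _ _ ep _.
  - by apply: measurableT_comp => //; exact: (Dmeas hdf).
  - by move=> x; exact: normr_ge0.
  - move=> r /approx[k [h1 h2 h3]].
    exists (fun x => `|(u n \- u k) x|), (fun x => `|(u k \- w) x|); split => //.
    + exact: Dp_u (DpB (hu n) (hu k)).
    + by rewrite -upowE; have := spow_ge0 (u n \- u k); rewrite /pow_sum in h1; lra.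
    + have sE : (fun x => `|(u k \- w) x| ^+ 2) = (fun x => (u k \- w) x ^+ 2).
        by apply/funext => x; rewrite real_normK ?num_real.
      by rewrite sE; split => //; case: (DL2 hdf (DB hdf (Du k) Dw)).
    + apply: aeW => x /=; apply: (le_trans (ler_dist_dist _ _)).
      by rewrite le_eqVlt; apply/orP; left; apply/eqP; congr (`|_|); ring.
  rewrite -upowE => i1 b1.
  have [] := @Lp_closed (slope (u n \- w)) (e `^ p) _ _ ep _.
  - exact: (slope_meas hcdc).
  - by move=> x; exact: slope_ge0.
  - move=> r /approx[k [h1 h2 h3]].
    exists (slope (u n \- u k)), (slope (u k \- w)); split => //.
    + exact: Dp_S (DpB (hu n) (hu k)).
    + by move=> x; exact: slope_ge0.
    + by rewrite -spowE; have := upow_ge0 (u n \- u k); rewrite /pow_sum in h1; lra.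
    + by split => //; exact: (slope2_intg hcdc (DB hdf (Du k) Dw)).
    + have := slope_dist hdf hcdc Dnw (DB hdf (Du n) (Du k)).
      by have -> : (u n \- w) \- (u n \- u k) = u k \- w by apply/funext => x /=; ring.
  rewrite -spowE => i2 b2; split; first exact/DpP.
  rewrite powRM ?(ltW e0)//.
  have -> : (4 : R) = 2 * 2 by ring.
  rewrite powRM//.
  have : (2 : R) <= 2 `^ p by apply: le1r_powR; lra.
  have : 0 <= 2 `^ p * e `^ p by rewrite mulr_ge0 ?powR_ge0.
  rewrite /pow_sum; move: b1 b2; move: (2 `^ p) (e `^ p) => A B; nra.
have Dpw : Dp w.
  have [n0 /(_ n0 (leqnn _))[h _]] := key 1 ltr01.
  have -> : w = u n0 \- (u n0 \- w) by apply/funext => x /=; ring.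
  exact: DpB.
exists w => //; apply/cvgrPdist_lt => e e0.
have /key[n0 hn] : 0 < e / 8 by lra.
exists n0 => // n /hn[hnw hP]; rewrite sub0r normrN ger0_norm ?nrm_ge0//.
have : N (u n \- w) <= 4 * (e / 8) by apply: nrm_le; [exact: Dp_D|lra|].
lra.
Qed.

Lemma Dp_banach : banach_in_L1 m Dp (Dp_norm m G p).
Proof.
rewrite nrm_fun; split.
- exact: Dp_space.
- by move=> u _; exact: nrm_ge0.
- exact: nrm_eq0.
- by move=> a u; exact: nrm_scale.
- exact: nrm_triangle.
- exact: Dp_complete.
- by exists (mass + 1) => u; exact: embed_L1.
Qed.

(** [poincare_pos] for u and -u bounds the two parts of |u|^p, whence 2 C; the slope term of
    [pow_sum] adds 1. *)
Lemma poincare : exists2 C, 0 < C & forall u, Dp u -> pow_sum u <= C * spow u.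
Proof.
have [C C0 hC] := poincare_pos hdf hreg hloc hcdc hcoer p2.
exists (2 * C + 1) => [|u hu]; first lra.
have hn : Dp (neg u) := DpZ (-1) hu.
have iS := Dp_S hu; have Du := Dp_D hu.
have := hC _ hu; have := hC _ hn; rewrite -!spowE => h2 h1.
have h3 : spow (neg u) = spow u.
  rewrite !spowE.
  apply: Rint_ae_eq; [exact: intg_meas (Dp_S hn)|exact: intg_meas iS|].
  by apply: filterS (slopeZ hdf hcdc (-1) Du) => x ->; rewrite normrN1 mul1r.
have h4 : upow u <= \int[m]_x (excess 0 u x `^ p) + \int[m]_x (excess 0 (neg u) x `^ p).
  have j1 := exc0_pow_intg hdf hcdc p2 hu; have j2 := exc0_pow_intg hdf hcdc p2 hn.
  rewrite upowE -RintD//; apply: Rint_le; [exact: Dp_u|exact: intgD|move=> x].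
  rewrite !exc0E /neg /=; have [u0|u0] := leP (u x) 0.
    by rewrite ler0_norm// max_l ?mulN1r ?oppr_ge0// lerDr powR_ge0.
  by rewrite ger0_norm ?(ltW u0)// lerDl powR_ge0.
rewrite h3 in h2; apply: (le_trans (lerD (le_trans h4 (lerD h1 h2)) (lexx _))).
by rewrite le_eqVlt; apply/orP; left; apply/eqP; ring.
Qed.

End DpSpace.

(** * The p-form *)

Section PForm.
Context {R : realType} {d : measure_display} {X : metricMeasurableType R d}.
Variable m : {finite_measure set X -> \bar R}.
Variables (D : set (X -> R)) (E : (X -> R) -> (X -> R) -> R).
Hypothesis hdf : symmetric_dirichlet_form m D E.
Hypothesis hreg : regular_form m D E.
Hypothesis hloc : strongly_local m D E.
Variable G : (X -> R) -> (X -> R) -> (X -> R).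
Hypothesis hcdc : carre_du_champ m D E G.
Hypothesis hcoer : coercive_form m D E.
Variable p : R.
Hypothesis p2 : 2 < p.
Implicit Types (u v w f g z : X -> R) (a b c e s t : R).
Local Notation slope := (slope G).
Local Notation mass := (mass m).
Local Notation Dp := (Dp m D G p).
Local Notation N := (nrm m G p).
Local Notation spow := (spow m G p).
Local Notation pow_sum := (pow_sum m G p).
Local Notation DpD := (DpD hdf hcdc p2).
Local Notation DpB := (DpB hdf hcdc p2).
Local Notation DpZ := (DpZ hdf hcdc p2).
Local Notation Dp_S := (Dp_S hdf hcdc p2).

Definition pform u v : R := locked (p_form m G p) u v.

Lemma pform_fun : p_form m G p = pform.
Proof. by apply/funext => u; apply/funext => v; rewrite /pform -lock. Qed.

Lemma pformE u v : D u -> D v -> pform u v = \int[m]_x (slope u x `^ (p - 2) * G u v x).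
Proof.
move=> Du Dv; rewrite -pform_fun /p_form; apply: Rint_ae_eq.
- apply: measurable_funM; last exact: (G_meas hcdc).
  by apply: measurable_pow; exact: (G_meas hcdc).
- apply: measurable_funM; last exact: (G_meas hcdc).
  by apply: measurable_pow; exact: (slope_meas hcdc).
- by apply: filterS (slope_powE hcdc (p - 2) Du) => x ->.
Qed.

Lemma pform_dom u v : D u -> D v -> \forall x \ae m,
  `|slope u x `^ (p - 2) * G u v x| <= slope u x `^ (p - 1) * slope v x.
Proof.
have p2' : (2 : R) < p by [].
move=> Du Dv; apply: filterS (G_CS hdf hcdc Du Dv) => x h.
rewrite normrM (ger0_norm (powR_ge0 _ _)).
apply: (le_trans (ler_wpM2l (powR_ge0 _ _) h)).
have -> : p - 1 = (p - 2) + 1 by ring.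
rewrite (@powR_addl _ _ (p - 2) 1); [|lra|exact: ler01].
by rewrite powRr1 ?slope_ge0// mulrA.
Qed.

Lemma pform_young u v : D u -> D v -> \forall x \ae m,
  `|slope u x `^ (p - 2) * G u v x| <= slope u x `^ p + slope v x `^ p.
Proof.
have p2' : (2 : R) < p by [].
move=> Du Dv; apply: filterS (pform_dom Du Dv) => x /le_trans; apply.
by apply: young_m1; rewrite ?slope_ge0//; lra.
Qed.

Lemma pform_meas u v : D u -> D v ->
  measurable_fun setT (fun x => slope u x `^ (p - 2) * G u v x).
Proof.
move=> Du Dv; apply: measurable_funM; last exact: (G_meas hcdc).
by apply: measurable_pow; exact: (slope_meas hcdc).
Qed.

Lemma pform_intg u v : Dp u -> Dp v -> intg m (fun x => slope u x `^ (p - 2) * G u v x).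
Proof.
move=> hu hv; have [Du Dv] := (Dp_D hu, Dp_D hv).
apply: (intg_ae_dom _ (intgD (Dp_S hu) (Dp_S hv))); first exact: pform_meas.
exact: pform_young.
Qed.

Lemma pform_bound u v : Dp u -> Dp v -> `|pform u v| <= spow u + spow v.
Proof.
move=> hu hv; have [Du Dv] := (Dp_D hu, Dp_D hv).
have i := pform_intg hu hv.
rewrite pformE// !spowE -(RintD (Dp_S hu) (Dp_S hv)).
apply: (le_trans (le_normr_Rintegral _ i)) => //.
apply: Rint_ae_le; [exact: integrable_norm i|exact: intgD (Dp_S hu) (Dp_S hv)|].
exact: pform_young.
Qed.

Lemma slope_m2 u x : slope u x `^ (p - 2) * slope u x ^+ 2 = slope u x `^ p.
Proof. by apply: powR_m2 => //; exact: slope_ge0. Qed.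

Lemma pform_diag u : Dp u -> pform u u = spow u.
Proof.
move=> hu; have Du := Dp_D hu; rewrite pformE// spowE; apply: Rint_ae_eq.
- exact: pform_meas.
- exact: intg_meas (Dp_S hu).
- by apply: filterS (slopeE hcdc Du) => x <-; exact: slope_m2.
Qed.

Lemma pform_lin u a v w : Dp u -> Dp v -> Dp w ->
  pform u ((a \*o v) \+ w) = a * pform u v + pform u w.
Proof.
move=> hu hv hw; have [[Du Dv] Dw] := (Dp_D hu, Dp_D hv, Dp_D hw).
have Dz : D ((a \*o v) \+ w) := Dp_D (DpD (DpZ a hv) hw).
rewrite !pformE// -(RintZ a (pform_intg hu hv)) -(RintD (intgZ a (pform_intg hu hv)) (pform_intg hu hw)).
apply: Rint_ae_eq; first exact: pform_meas.
  exact: intg_meas (intgD (intgZ a (pform_intg hu hv)) (pform_intg hu hw)).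
apply: (ae_imp3 (G_sym hcdc Du Dz) (G_lin hcdc a Dv Dw Du)
  (ae_imp2 (G_sym hcdc Dv Du) (G_sym hcdc Dw Du) (fun x h1 h2 => conj h1 h2))).
by move=> x -> -> [-> ->]; ring.
Qed.

Lemma pformD u v w : Dp u -> Dp v -> Dp w -> pform u (v \+ w) = pform u v + pform u w.
Proof.
move=> hu hv hw; have := pform_lin 1 hu hv hw; rewrite mul1r => <-; congr pform.
by apply/funext => x /=; rewrite mul1r.
Qed.

Lemma pform0 u : Dp u -> pform u (cst 0) = 0.
Proof.
move=> hu; have h0 := Dp_0 hdf hcdc p2; have := pformD hu h0 h0.
have -> : cst 0 \+ cst 0 = cst 0 :> (X -> R) by apply/funext => x /=; rewrite addr0.
by move/eqP; rewrite -subr_eq0 opprD addrA subrr add0r oppr_eq0 => /eqP.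
Qed.

Lemma pformZ u a v : Dp u -> Dp v -> pform u (a \*o v) = a * pform u v.
Proof.
move=> hu hv; have h0 := Dp_0 hdf hcdc p2; have := pform_lin a hu hv h0.
rewrite pform0// addr0 => <-; congr pform.
by apply/funext => x /=; rewrite addr0.
Qed.

Lemma pformB u v w : Dp u -> Dp v -> Dp w -> pform u (v \- w) = pform u v - pform u w.
Proof.
move=> hu hv hw; rewrite sub_fun_lin pform_lin//.
by rewrite mulN1r addrC.
Qed.

(** By scaling it is enough to bound the form on v with [pow_sum] at most 1, where Young's
    inequality gives spow u + 1. *)
Lemma pform_dual u : Dp u -> in_dual Dp N (pform u).
Proof.
move=> hu; split; first by move=> a v w; exact: pform_lin.
exists (spow u + 1) => v hv; apply: le_scale => s vs.
have s0 : 0 < s by exact: le_lt_trans (nrm_ge0 _ _ _ v) vs.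
have hv' := DpZ s^-1 hv.
have hP := pow_sum_unit hdf hcdc p2 hv vs.
rewrite {1}(scale_back v (lt0r_neq0 s0)) pformZ// normrM (gtr0_norm s0) mulrC.
rewrite ler_wpM2r ?(ltW s0)// (le_trans (pform_bound hu hv'))// lerD2l.
by apply: le_trans hP; rewrite /pow_sum lerDr upow_ge0.
Qed.

Lemma pform_ae u u' v : Dp u -> Dp u' -> Dp v -> u = u' %[ae m] -> pform u v = pform u' v.
Proof.
move=> hu hu' hv uu'; have [[Du Du'] Dv] := (Dp_D hu, Dp_D hu', Dp_D hv).
rewrite !pformE//; apply: Rint_ae_eq; [exact: pform_meas|exact: pform_meas|].
have h1 := (eq_aeP _ _ _).1 (cdc_ae hcdc Du Du' Dv uu').
have h2 := slope_ae hcdc Du Du' ((eq_aeP _ _ _).1 uu').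
by apply: (ae_imp2 h1 h2) => x e1 e2; rewrite /slope e1 e2.
Qed.

Lemma pform_cst0 v : Dp v -> pform (cst 0) v = 0.
Proof.
move=> hv; have h0 := Dp_0 hdf hcdc p2; have [D0 Dv] := (Dp_D h0, Dp_D hv).
have p2' : (2 : R) < p by [].
rewrite pformE//; apply: (@eq_trans _ _ (\int[m]_x (0 : R))); last by rewrite Rint_cst mul0r.
apply: Rint_ae_eq; [exact: (pform_meas D0 Dv)|exact: measurable_cst|].
apply: filterS (G_0 hdf hcdc) => x h.
by rewrite (slope0 h) powR0 ?mul0r// gt_eqF//; lra.
Qed.

Lemma pform_coercive : exists c q : R,
  [/\ 0 < c, 0 < q & forall u, Dp u -> c * N u `^ q <= pform u u].
Proof.
have [C C0 hC] := poincare hdf hreg hloc hcdc hcoer p2.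
exists C^-1, p; split; [by rewrite invr_gt0|exact: p_gt0|].
move=> u hu; rewrite (nrm_pow hcdc p2 (Dp_D hu)) pform_diag// ler_pdivrMl//.
exact: hC.
Qed.

(** With a, b the slopes of u, v and c = Gamma(u, v), J is the integrand of <A u - A v, u - v>. It
    splits as half of (a^q + b^q) Gamma(u - v) plus half of (a^q - b^q) (a^2 - b^2), both
    non-negative. If J = 0 and a^q + b^q = 0, then a = b = 0 and Cauchy-Schwarz gives c = 0. *)
Lemma mono_pt (a b c q : R) : 0 < q -> 0 <= a -> 0 <= b ->
  0 <= a ^+ 2 - 2 * c + b ^+ 2 -> `|c| <= a * b ->
  let J := a `^ q * (a ^+ 2 - c) - b `^ q * (c - b ^+ 2) in
  0 <= J /\ (J = 0 -> a ^+ 2 - 2 * c + b ^+ 2 = 0).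
Proof.
move=> q0 a0 b0 w0 hc J.
have aq := powR_ge0 a q; have bq := powR_ge0 b q.
have mono : 0 <= (a `^ q - b `^ q) * (a ^+ 2 - b ^+ 2).
  have [ab|ba] := leP a b.
    have h1 : a `^ q <= b `^ q by apply: powR_homo => //; exact: ltW.
    rewrite mulr_le0// subr_le0//.
    by rewrite lerXn2r ?nnegrE.
  have h1 : b `^ q <= a `^ q by apply: powR_homo; rewrite ?(ltW q0) ?(ltW ba).
  rewrite mulr_ge0// subr_ge0//.
  by rewrite lerXn2r ?nnegrE// ltW.
have JE : J = 2^-1 * ((a `^ q + b `^ q) * (a ^+ 2 - 2 * c + b ^+ 2)) +
    2^-1 * ((a `^ q - b `^ q) * (a ^+ 2 - b ^+ 2)) by rewrite /J; field.
have h2 : 0 <= (a `^ q + b `^ q) * (a ^+ 2 - 2 * c + b ^+ 2).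
  by rewrite mulr_ge0// addr_ge0.
split; first by rewrite JE addr_ge0// mulr_ge0.
move=> J0; have : (a `^ q + b `^ q) * (a ^+ 2 - 2 * c + b ^+ 2) = 0.
  move: h2 JE mono; rewrite J0.
  move: ((a `^ q + b `^ q) * _) ((a `^ q - b `^ q) * _) => x y; lra.
move=> /eqP; rewrite mulf_eq0 => /orP[|/eqP//].
rewrite paddr_eq0// !powR_eq0 => /andP[/andP[/eqP a00 _] /andP[/eqP b00 _]].
move: hc; rewrite a00 mul0r normr_le0 => /eqP ->.
by rewrite b00; ring.
Qed.

(** If the pairing were at most 0, its non-negative integrand would vanish, hence Gamma(u - v) = 0
    a.e. and E(u - v) = 0; L^2 coercivity then gives u = v a.e. *)
Lemma pform_strict u v : Dp u -> Dp v -> ~ (u = v %[ae m]) ->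
  0 < pform u (u \- v) - pform v (u \- v).
Proof.
move=> hu hv uv; have hw := DpB hu hv.
have p2' : (2 : R) < p by [].
have [[Du Dv] Dw] := (Dp_D hu, Dp_D hv, Dp_D hw).
have iu := pform_intg hu hw; have iv := pform_intg hv hw.
rewrite ltNge; apply/negP => hle; apply: uv.
rewrite !pformE// -(RintB iu iv) in hle.
have pt : \forall x \ae m,
    0 <= slope u x `^ (p - 2) * G u (u \- v) x - slope v x `^ (p - 2) * G v (u \- v) x /\
    (slope u x `^ (p - 2) * G u (u \- v) x - slope v x `^ (p - 2) * G v (u \- v) x = 0 ->
     G (u \- v) (u \- v) x = 0).
  have k1 := ae_imp3 (slopeE hcdc Du) (slopeE hcdc Dv) (G_CS hdf hcdc Du Dv)
    (fun x h1 h2 h3 => conj h1 (conj h2 h3)).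
  have k2 := ae_imp3 (G_sym hcdc Du Dw) (G_sym hcdc Dv Dw) (G_sym hcdc Dv Du)
    (fun x h1 h2 h3 => conj h1 (conj h2 h3)).
  have k3 := ae_imp3 (GBl hcdc Du Dv Du) (GBl hcdc Du Dv Dv) (G_subE hdf hcdc Du Dv)
    (fun x h1 h2 h3 => conj h1 (conj h2 h3)).
  have k4 := ae_imp3 k1 k2 k3 (fun x h1 h2 h3 => conj h1 (conj h2 h3)).
  apply: (ae_imp2 k4 (cdc_ge0 hcdc Dw)) => x [[e1 [e2 e3]] [[e4 [e5 e6]] [e7 [e8 e9]]]] e10.
  rewrite e4 e5 e7 e8 e6 -e1 -e2.
  have e9' : G (u \- v) (u \- v) x = slope u x ^+ 2 - 2 * G u v x + slope v x ^+ 2.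
    by rewrite e9 e1 e2.
  rewrite e9' in e10 *.
  apply: mono_pt => //; [lra|exact: slope_ge0|exact: slope_ge0].
have J0 : \forall x \ae m,
    slope u x `^ (p - 2) * G u (u \- v) x - slope v x `^ (p - 2) * G v (u \- v) x = 0.
  apply: Rint_ae0 hle; first exact: intgB.
  by apply: filterS pt => x [].
have Gw0 : \forall x \ae m, G (u \- v) (u \- v) x = 0.
  by apply: (ae_imp2 pt J0) => x [_ h] /h.
have Ew : E (u \- v) (u \- v) = 0.
  rewrite (E_G hloc hcdc Dw Dw); have -> : \int[m]_x G (u \- v) (u \- v) x = 0.
    rewrite -(mul0r mass) -Rint_cst; apply: Rint_ae_eq => //; exact: (G_meas hcdc).
  by rewrite mulr0.
have [K K0 hK] := coercive_real hdf hcoer.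
apply/eq_aeP; apply: (sqn_ae0 (DL2 hdf Du) (DL2 hdf Dv)).
by rewrite (le_trans (hK _ Dw))// Ew mulr0.
Qed.

(** [pform u] is the derivative at u of the convex functional p^-1 \int Gamma^(p/2), which lies
    above its tangent. Pointwise this is Young's inequality with exponents p / (p - 1) and p. *)
Lemma pform_tangent u v : Dp u -> Dp v -> pform u (v \- u) <= p^-1 * (spow v - spow u).
Proof.
move=> hu hv; have p2' : (2 : R) < p by [].
have [Du Dv] := (Dp_D hu, Dp_D hv).
have p0 : 0 < p by lra.
rewrite pformB// pform_diag//.
suff h : pform u v <= p^-1 * spow v + (1 - p^-1) * spow u.
  rewrite mulrBr lerBlDr (le_trans h)// mulrBl mul1r.
  by rewrite le_eqVlt; apply/orP; left; apply/eqP; ring.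
rewrite pformE// !spowE -(RintZ _ (Dp_S hv)) -(RintZ _ (Dp_S hu)).
rewrite -(RintD (intgZ _ (Dp_S hv)) (intgZ _ (Dp_S hu))).
apply: Rint_ae_le; first exact: pform_intg.
  exact: intgD (intgZ _ (Dp_S hv)) (intgZ _ (Dp_S hu)).
apply: filterS (pform_dom Du Dv) => x h; apply: (le_trans (ler_norm _)); apply: (le_trans h).
have s1 := slope_ge0 G u x; have s2 := slope_ge0 G v x.
have p1 : 0 < p - 1 by lra.
have := @conjugate_powR R (slope u x `^ (p - 1)) (slope v x) (p / (p - 1)) p.
rewrite powR_ge0 s2 divr_gt0// p0 => /(_ isT isT isT isT).
have -> : (p / (p - 1))^-1 + p^-1 = 1 by field; rewrite !gt_eqF.
move=> /(_ erefl) /le_trans; apply.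
rewrite -powRrM; have -> : (p - 1) * (p / (p - 1)) = p by field; rewrite gt_eqF.
have -> : slope u x `^ p / (p / (p - 1)) = (1 - p^-1) * slope u x `^ p.
  by field; rewrite !gt_eqF.
by rewrite addrC [slope v x `^ p / p]mulrC.
Qed.

Lemma spow_clarkson u v : Dp u -> Dp v ->
  spow (2^-1 \*o (u \+ v)) + spow (2^-1 \*o (u \- v)) <= 2^-1 * (spow u + spow v).
Proof.
move=> hu hv; have p2' : (2 : R) < p by [].
have [Du Dv] := (Dp_D hu, Dp_D hv).
have hp := DpZ 2^-1 (DpD hu hv); have hm := DpZ 2^-1 (DpB hu hv).
have [Dp' Dm'] := (DD hdf Du Dv, DB hdf Du Dv).
have iuv := intgD (Dp_S hu) (Dp_S hv).
have -> : 2^-1 * (spow u + spow v) =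
    \int[m]_x (2^-1 * (slope u x `^ p + slope v x `^ p)).
  by rewrite (RintZ _ iuv) (RintD (Dp_S hu) (Dp_S hv)) !spowE.
rewrite (spowE _ _ _ (2^-1 \*o (u \+ v))) (spowE _ _ _ (2^-1 \*o (u \- v))).
rewrite -(RintD (Dp_S hp) (Dp_S hm)).
apply: Rint_ae_le; [exact: intgD (Dp_S hp) (Dp_S hm)|exact: intgZ (intgD (Dp_S hu) (Dp_S hv))|].
have k1 := ae_imp3 (slopeE hcdc Du) (slopeE hcdc Dv) (slopeE hcdc Dp')
  (fun x h1 h2 h3 => conj h1 (conj h2 h3)).
have k2 := ae_imp3 (slopeE hcdc Dm') (slopeZ hdf hcdc 2^-1 Dp') (slopeZ hdf hcdc 2^-1 Dm')
  (fun x h1 h2 h3 => conj h1 (conj h2 h3)).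
have k3 := ae_imp2 (G_addE hdf hcdc Du Dv) (G_subE hdf hcdc Du Dv) (fun x h1 h2 => conj h1 h2).
apply: (ae_imp3 k1 k2 k3) => x [e1 [e2 e3]] [e4 [e5 e6]] [e7 e8].
apply: clarkson; rewrite ?slope_ge0//; first exact: ltW.
rewrite e5 e6 !exprMn e3 e4 e7 e8 e1 e2 ger0_norm//.
by field.
Qed.

Lemma exc_Dp a z : 0 <= a -> Dp z -> Dp (excess a z).
Proof.
move=> a0 hz; have Dz := Dp_D hz; have [De _] := exc_D hdf a0 Dz.
have lz := trunc_local_all hdf hreg hloc hcdc Dz.
have lnz := trunc_local_all hdf hreg hloc hcdc (neg_D hdf Dz).
apply: (Dp_dom hdf hcdc p2 De hz); first by move=> x; exact: normr_exc.
apply: filterS (slope_exc hdf hcdc Dz lz lnz a0) => x ->.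
by case: ifP => // _; exact: slope_ge0.
Qed.

(** Reduces every lattice operation in the definition of a nonlinear Dirichlet form to the
    truncation (u - v - a)^+. *)
Lemma min_exc a u v : u \min (v \+ cst a) = u \- excess a (u \- v).
Proof.
apply/funext => x; rewrite /excess /=.
by have [h1|h1] := leP (u x) (v x + a); have [h2|h2] := leP (u x - v x - a) 0; lra.
Qed.

Lemma min_exc0 u v : u \min v = u \- excess 0 (u \- v).
Proof.
by rewrite -min_exc; apply/funext => x /=; rewrite addr0.
Qed.

(* With w = (u - v - a)^+, the truncated function u - w has the same slopes as v
   on [w != 0], so the integrand of <A (u - w), w> is that of <A v, w>. *)
Lemma pform_trunc u v a : 0 <= a -> Dp u -> Dp v ->
  pform (u \- excess a (u \- v)) (excess a (u \- v)) = pform v (excess a (u \- v)).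
Proof.
move=> a0 hu hv; have p2' : (2 : R) < p by [].
have hz := DpB hu hv; have hw := exc_Dp a0 hz; have ht := DpB hu hw.
have [[Du Dv] [Dz [Dw Dt]]] := ((Dp_D hu, Dp_D hv), (Dp_D hz, (Dp_D hw, Dp_D ht))).
have lz := trunc_local_all hdf hreg hloc hcdc Dz.
have lnz := trunc_local_all hdf hreg hloc hcdc (neg_D hdf Dz).
rewrite !pformE//; apply: Rint_ae_eq; [exact: pform_meas|exact: pform_meas|].
set w := excess a (u \- v) in hw ht Dw Dt *.
have Dtv := DB hdf Dt Dv.
have tvE : (u \- w) \- v = (u \- v) \- w by apply/funext => x /=; ring.
have k1 := ae_imp3 (slope_exc hdf hcdc Dz lz lnz a0) (slope_sub_exc hdf hcdc Dz lz lnz a0)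
  (slope_dist hdf hcdc Dt Dv) (fun x h1 h2 h3 => conj h1 (conj h2 h3)).
have k2 := ae_imp3 (G_CS hdf hcdc Dt Dw) (G_CS hdf hcdc Dv Dw) (G_CS hdf hcdc Dtv Dw)
  (fun x h1 h2 h3 => conj h1 (conj h2 h3)).
apply: (ae_imp3 k1 k2 (GBl hcdc Dt Dv Dw)) => x [e1 [e2 e3]] [e4 [e5 e6]] e7.
have [az|za] := ltP a ((u \- v) x).
  rewrite tvE (e2 az) in e3; rewrite tvE (e2 az) mul0r in e6.
  move: e3 e6 e7; rewrite !normr_le0 subr_eq0 tvE => /eqP -> /eqP -> /esym/eqP.
  by rewrite subr_eq0 => /eqP ->.
have w0 : slope w x = 0 by rewrite e1 ltNge za.
move: e4 e5; rewrite w0 !mulr0 !normr_le0 => /eqP -> /eqP ->.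
by rewrite !mulr0.
Qed.

Lemma pform_potential u v a : 0 <= a -> Dp u -> potential m Dp pform v ->
  0 <= pform (u \- excess a (u \- v)) (u \- (u \- excess a (u \- v))).
Proof.
move=> a0 hu [hv pv].
have -> : u \- (u \- excess a (u \- v)) = excess a (u \- v) by apply/funext => x /=; ring.
rewrite pform_trunc//; apply: pv; first exact/exc_Dp/DpB.
by apply: aeW => x; exact: exc_ge0.
Qed.

End PForm.

(** * The Browder property *)

Section Browder.
Context {R : realType} {d : measure_display} {X : metricMeasurableType R d}.
Variable m : {finite_measure set X -> \bar R}.
Variables (D : set (X -> R)) (E : (X -> R) -> (X -> R) -> R).
Hypothesis hdf : symmetric_dirichlet_form m D E.
Hypothesis hreg : regular_form m D E.
Hypothesis hloc : strongly_local m D E.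
Variable G : (X -> R) -> (X -> R) -> (X -> R).
Hypothesis hcdc : carre_du_champ m D E G.
Hypothesis hcoer : coercive_form m D E.
Variable p : R.
Hypothesis p2 : 2 < p.
Implicit Types (u v w f g z : X -> R) (a b c e s t : R).
Local Notation slope := (slope G).
Local Notation Dp := (Dp m D G p).
Local Notation N := (nrm m G p).
Local Notation spow := (spow m G p).
Local Notation pow_sum := (pow_sum m G p).
Local Notation DpD := (DpD hdf hcdc p2).
Local Notation DpB := (DpB hdf hcdc p2).
Local Notation DpZ := (DpZ hdf hcdc p2).
Local Notation Dp_S := (Dp_S hdf hcdc p2).
Local Notation pform := (pform m G p).

Lemma cvg_harmonicM (s : R) : (fun n => harmonic n * s) @ \oo --> (0 : R).
Proof. by rewrite -[X in _ --> X](mul0r s); apply: cvgMl; exact: cvg_harmonic. Qed.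

Lemma harmonic_le1 n : harmonic n <= 1 :> R.
Proof. by rewrite /harmonic/= invf_le1 ?ltr0n// ler1n. Qed.

(** Dominated convergence: the slopes of u + w / (n + 1) converge a.e. and, the steps being at most
    1, stay below slope u + slope w. *)
Lemma pform_hemi u w : Dp u -> Dp w ->
  (fun n => pform ((harmonic n \*o w) \+ u) w) @ \oo --> pform u w.
Proof.
move=> hu hw; have p2' : (2 : R) < p by [].
have [Du Dw] := (Dp_D hu, Dp_D hw).
pose z n : X -> R := (harmonic n \*o w) \+ u.
have hz n : Dp (z n) := DpD (DpZ (harmonic n) hw) hu.
have Dz n : D (z n) := Dp_D (hz n).
have -> : (fun n => pform ((harmonic n \*o w) \+ u) w) =
    (fun n => \int[m]_x (slope (z n) x `^ (p - 2) * G (z n) w x)).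
  by apply/funext => n; rewrite (pformE hcdc p (Dz n) Dw).
rewrite (pformE hcdc p Du Dw).
have iS : intg m (fun x => (slope u x + slope w x) `^ p).
  by apply: intg_powD => //; [exact: (slope_meas hcdc)|exact: (slope_meas hcdc)
    |move=> x; exact: slope_ge0|move=> x; exact: slope_ge0|exact: Dp_S|exact: Dp_S].
have h0 n : 0 <= harmonic n :> R := harmonic_ge0 n.
apply: (intg_cvg (g := fun x => (slope u x + slope w x) `^ p + slope w x `^ p)).
- by move=> n; exact: (pform_meas hcdc).
- exact: (pform_meas hcdc).
- exact: intgD iS (Dp_S hw).
- have k1 : \forall x \ae m, forall n, `|slope (z n) x - slope u x| <= harmonic n * slope w x.
    apply/ae_foralln => n.
    have Sz : \forall x \ae m, slope (z n \- u) x = harmonic n * slope w x.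
      have -> : z n \- u = harmonic n \*o w by apply/funext => x; rewrite /z /=; ring.
      by apply: filterS (slopeZ hdf hcdc (harmonic n) Dw) => x ->; rewrite (ger0_norm (h0 n)).
    by apply: (ae_imp2 (slope_dist hdf hcdc (Dz n) Du) Sz) => x h1 <-.
  have k2 : \forall x \ae m, forall n, G (z n) w x = harmonic n * G w w x + G u w x.
    by apply/ae_foralln => n; exact: (G_lin hcdc).
  apply: (ae_imp2 k1 k2) => x e1 e2; apply: cvgM.
    apply: powR_cvg; [lra|by move=> n; exact: slope_ge0|exact: slope_ge0|].
    apply/cvgrPdist_lt => e e0.
    move/cvgrPdist_lt : (cvg_harmonicM (slope w x)) => /(_ e e0).
    apply: filterS => n; rewrite sub0r normrN => h.
    by rewrite distrC (le_lt_trans (e1 n))// (le_lt_trans (ler_norm _)).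
  have -> : (fun n => G (z n) w x) = (fun n => harmonic n * G w w x + G u w x).
    by apply/funext => n; exact: e2.
  rewrite -[X in _ --> X]add0r; apply: cvgD; [exact: cvg_harmonicM|exact: cvg_cst].
- move=> n; have h := slope_lin hdf hcdc (harmonic n) Dw Du.
  apply: (ae_imp2 (pform_young hdf hcdc p2 (Dz n) Dw) h) => x h1 h2.
  apply: (le_trans h1); rewrite lerD2r; apply: powR_homo; rewrite ?slope_ge0 ?(p_ge0 p2)//.
  apply: (le_trans h2); rewrite addrC lerD2l ger0_norm// ler_piMl ?slope_ge0//.
  exact: harmonic_le1.
Qed.

(** * Minimisation over a closed convex set *)

Section Minimisation.
Variables (F : (X -> R) -> R) (W : set (X -> R)).
Hypotheses (hF : in_dual Dp N F) (W0 : W !=set0) (WD : W `<=` Dp)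
  (Wc : norm_closed Dp N W) (Wv : convex_subset W).

Let FB u v : Dp u -> Dp v -> F (u \- v) = F u - F v.
Proof. by move=> hu hv; rewrite sub_fun_lin hF.1// mulN1r addrC. Qed.

Let FD u v : Dp u -> Dp v -> F (u \+ v) = F u + F v.
Proof.
move=> hu hv; have := hF.1 1 _ _ hu hv; rewrite mul1r => <-; congr F.
by apply/funext => x /=; rewrite mul1r.
Qed.

Let FZ a u : Dp u -> F (a \*o u) = a * F u.
Proof.
move=> hu; have hz := DpZ a hu.
have := hF.1 a _ _ hu hz; rewrite FD// => /addIr.
by [].
Qed.

(** The convex functional whose derivative is A - F. *)
Let J u : R := p^-1 * spow u - F u.

(** The L^p inequality bounds p^-1 spow u below by k (N u)^p, hence by k ((N u)^2 - 1). Against the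
    linear term C N u, completing the square gives the constant. *)
Let J_lower : exists M, forall u, Dp u -> M <= J u.
Proof.
have [K K0 hK] := poincare hdf hreg hloc hcdc hcoer p2.
have [C hC] := hF.2.
have p0 := p_gt0 p2.
pose k := (K * p)^-1; have k0 : 0 < k by rewrite invr_gt0 mulr_gt0.
exists (- k - C ^+ 2 / (4 * k)) => u hu.
have h1 : k * (N u ^+ 2 - 1) <= p^-1 * spow u.
  have -> : p^-1 * spow u = k * (K * spow u).
    by rewrite /k; field; rewrite !gt_eqF.
  rewrite ler_wpM2l ?(ltW k0)// (le_trans _ (hK _ hu))//.
  rewrite -(nrm_pow hcdc p2 (Dp_D hu)) lerBlDl -powR_mulrn ?nrm_ge0//.
  by apply: powR_le1D; [exact: nrm_ge0|exact: ler0n|exact: ltW].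
have h2 := le_trans (ler_norm _) (hC _ hu).
have h3 : 0 <= k * (N u - C / (2 * k)) ^+ 2 by rewrite mulr_ge0 ?sqr_ge0 ?ltW.
have h4 : k * (N u - C / (2 * k)) ^+ 2 = k * N u ^+ 2 - C * N u + C ^+ 2 / (4 * k).
  by field; rewrite gt_eqF.
rewrite h4 in h3; rewrite /J; move: h1 h2 h3.
move: (spow u) (F u) (N u) (C ^+ 2 / (4 * k)) => a b c e; lra.
Qed.

Let j0 := inf [set J u | u in W].

Let hinf : has_inf [set J u | u in W].
Proof.
split; first by have [u Wu] := W0; exists (J u), u.
by have [M hM] := J_lower; exists M => _ [u /WD/hM ? <-].
Qed.

Let j0_le u : W u -> j0 <= J u.
Proof. by move=> Wu; apply: ge_inf; [exact: hinf.2|exists u]. Qed.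

Let j0_adh e : 0 < e -> exists2 u, W u & J u <= j0 + e.
Proof.
by move=> e0; have [_ [u Wu <-] h] := inf_adherent e0 hinf; exists u => //; exact: ltW.
Qed.

Let J_mid u v : Dp u -> Dp v ->
  p^-1 * spow (2^-1 \*o (u \- v)) <= 2^-1 * (J u + J v) - J (2^-1 \*o (u \+ v)).
Proof.
move=> hu hv; have h := spow_clarkson hdf hcdc p2 hu hv.
have q0 : 0 <= p^-1 by rewrite invr_ge0 (p_ge0 p2).
rewrite /J FZ; last exact: DpD.
rewrite FD//; have := ler_wpM2l q0 h; rewrite mulrDr.
move: (spow _) (spow _) (spow u) (spow v) (F u) (F v) => a b c e s t; lra.
Qed.

Let W_mid u v : W u -> W v -> W (2^-1 \*o (u \+ v)).
Proof.
move=> Wu Wv'; have := @Wv 2^-1 u v.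
have -> : (2^-1 \*o u) \+ ((1 - 2^-1) \*o v) = 2^-1 \*o (u \+ v).
  by apply/funext => x /=; field.
by apply => //; rewrite invr_ge0 invf_le1 ?ler1n ?ltr0n// ler0n.
Qed.

Let J_tangent u v : Dp u -> Dp v -> pform u (v \- u) - F (v \- u) <= J v - J u.
Proof.
move=> hu hv; have := pform_tangent hdf hcdc p2 hu hv.
rewrite FB// /J mulrBr.
move: (pform _ _) (p^-1 * _) (p^-1 * _) (F u) (F v) => a b c e s; lra.
Qed.

Let minimiser : exists2 u, W u & forall v, W v -> J u <= J v.
Proof.
have [K K0 hK] := poincare hdf hreg hloc hcdc hcoer p2.
have p0 := p_gt0 p2.
have /choice[u hu] : forall n : nat, exists u, W u /\ J u <= j0 + harmonic n.
  by move=> n; have [u Wu Ju] := j0_adh (harmonic_gt0 n); exists u.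
have Wu n : W (u n) := (hu n).1.
have Du n : Dp (u n) := WD (Wu n).
have gap i j : spow (2^-1 \*o (u i \- u j)) <= p * (harmonic i + harmonic j).
  rewrite -ler_pdivrMl//; apply: (le_trans (J_mid (Du i) (Du j))).
  have := j0_le (W_mid (Wu i) (Wu j)); have := (hu i).2; have := (hu j).2.
  have := harmonic_gt0 i : 0 < harmonic i :> R; have := harmonic_gt0 j : 0 < harmonic j :> R.
  move: (J (u i)) (J (u j)) (J (2^-1 \*o (u i \+ u j))) (harmonic i) (harmonic j).
  by move=> a b c s t; move: j0 => k; lra.
have uC : cauchy_seq N u.
  move=> e e0; have e4 : 0 < e / 4 by lra.
  (* Two errors below this threshold, multiplied by K p, make (e / 4)^p. The estimate is for half
     the difference, so N (u_i - u_j) <= e / 2. *)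
  have /inv_small[n0 hn0] : 0 < (e / 4) `^ p / (2 * (K * p)).
    by rewrite divr_gt0 ?powR_gt0 ?mulr_gt0.
  exists n0 => i j /hn0 hi /hn0 hj.
  have hij := DpB (Du i) (Du j); have hw := DpZ 2^-1 hij.
  have le4 : N (2^-1 \*o (u i \- u j)) <= e / 4.
    apply: (nrm_le hcdc p2 (Dp_D hw) (ltW e4)); apply: (le_trans (hK _ hw)).
    apply: (le_trans (ler_wpM2l (ltW K0) (gap i j))).
    rewrite mulrA -ler_pdivlMl ?mulr_gt0//.
    rewrite (le_trans (ltW (ltrD hi hj)))// le_eqVlt; apply/orP; left; apply/eqP.
    by field; rewrite !gt_eqF.
  have two0 : (2 : R)^-1 != 0 by rewrite invr_eq0 pnatr_eq0.
  rewrite (scale_back (u i \- u j) (s := 2)) ?pnatr_eq0//.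
  rewrite (nrm_scale hdf hcdc p2 _ hw) ger0_norm//.
  by move: (N _) le4 => t; lra.
have [w hw uw] := Dp_complete hdf hloc hcdc p2 Du uC.
have Ww : W w := Wc Wu hw uw.
exists w => // v /j0_le; apply: le_trans.
(* Lower semicontinuity along u_n is enough: the tangent inequality at w bounds J w - J (u n) by the
   two bounded functionals evaluated at u_n - w. *)
have [C1 hC1] := (pform_dual hdf hcdc p2 hw).2; have [C2 hC2] := hF.2.
rewrite -subr_le0; apply: (@le0_addgt0 _ _ (1 + `|C1| + `|C2|)) => e e0.
move/cvgrPdist_lt : uw => /(_ e e0) [n1 _ hn1].
have [n2 hn2] := inv_small e0.
pose n := maxn n1 n2.
have h1 : harmonic n < e by apply: hn2; exact: leq_maxr.
have h2 : N (u n \- w) < e.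
  have := hn1 n (leq_maxl _ _); rewrite sub0r normrN.
  exact: le_lt_trans (ler_norm _).
have hnw := DpB (Du n) hw.
have N0 := nrm_ge0 m G p (u n \- w).
have bd (C x : R) : `|x| <= C * N (u n \- w) -> `|x| <= `|C| * e.
  move=> /le_trans; apply; apply: (le_trans (ler_wpM2r N0 (ler_norm C))).
  by rewrite ler_wpM2l// ltW.
have h3 := bd _ _ (hC1 _ hnw); have h4 := bd _ _ (hC2 _ hnw).
have h5 := J_tangent hw (Du n); have h6 := (hu n).2.
move: h1 h3 h4 h5 h6; rewrite !ler_norml.
move: (pform w (u n \- w)) (F (u n \- w)) (J w) (J (u n)) (harmonic n) `|C1| `|C2| => a b c1 c2 h k1 k2.
by move: j0 => j h1 /andP[h3 h3'] /andP[h4 h4'] h5 h6; lra.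
Qed.

(** Minty's device: at z between u and v, J lies above its tangent and J u <= J z, so <A z - F, u -
    z> <= 0; dividing by the step gives the inequality with A z in place of A u, and hemicontinuity
    lets z tend to u. *)
Lemma browder : exists2 u, W u & forall v, W v -> 0 <= pform u (v \- u) - F (v \- u).
Proof.
have [u Wu hu] := minimiser; exists u => // v Wv'.
have [Du Dv] := (WD Wu, WD Wv'); have Dw := DpB Dv Du.
rewrite subr_ge0.
have key n : F (v \- u) <= pform ((harmonic n \*o (v \- u)) \+ u) (v \- u).
  have h0 := harmonic_gt0 n : 0 < harmonic n :> R; have h1 := harmonic_le1 n.
  set z := _ \+ u.
  have Wz : W z.
    have -> : z = (harmonic n \*o v) \+ ((1 - harmonic n) \*o u).
      by apply/funext => x; rewrite /z /=; ring.
    by apply: Wv => //; rewrite (ltW h0).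
  have Dz := WD Wz.
  have := le_trans (J_tangent Dz Du) _ => /(_ 0); rewrite subr_le0 => /(_ (hu _ Wz)).
  have -> : u \- z = (- harmonic n) \*o (v \- u).
    by apply/funext => x; rewrite /z /=; ring.
  rewrite (pformZ hdf hcdc p2)// FZ// -mulrBr mulNr oppr_le0 pmulr_rge0// subr_ge0.
  by [].
have hc := pform_hemi Du Dw.
rewrite -(cvg_lim _ hc)//; apply: limr_ge; first exact: (cvgP _ hc).
by apply: nearW => n; exact: key.
Qed.

End Minimisation.
End Browder.

Theorem theorem3p8 (R : realType) (d : measure_display)
    (X : metricMeasurableType R d)
    (hlc : locally_compact [set: X]) (hsep : separable_space X)
    (hborel : borel_sigma_algebra X)
    (m : {finite_measure set X -> \bar R})
    (hradon : radon_measure m) (hsupp : full_support m)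
    (D : set (X -> R)) (E : (X -> R) -> (X -> R) -> R)
    (G : (X -> R) -> (X -> R) -> (X -> R))
    (hdf : symmetric_dirichlet_form m D E)
    (hreg : regular_form m D E)
    (hloc : strongly_local m D E)
    (hcdc : carre_du_champ m D E G)
    (p : R) (hp : 2 < p)
    (hcoer : coercive_form m D E) :
  nonlinear_dirichlet_form m
    (Dp m D G p) (Dp_norm m G p) (Dp m D G p) (p_form m G p).
Proof.
have exD a u v : 0 <= a -> Dp m D G p u -> Dp m D G p v ->
    Dp m D G p (u \- excess a (u \- v)).
  move=> a0 hu hv; apply: (DpB hdf hcdc hp hu).
  exact: (exc_Dp hdf hreg hloc hcdc hp a0 (DpB hdf hcdc hp hu hv)).
have conv t u v : Dp m D G p u -> Dp m D G p v ->
    Dp m D G p ((t \*o u) \+ ((1 - t) \*o v)).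
  move=> hu hv; apply: (DpD hdf hcdc hp); exact: (DpZ hdf hcdc hp).
rewrite pform_fun; split.
- split.
  + exact: (Dp_banach hdf hloc hcdc hp).
  + by [].
  + by move=> u_ u _ Vu _.
  + by move=> t u v _; exact: conv.
  + by move=> t u _; exact: (DpZ hdf hcdc hp).
  + exact: (Dp_0 hdf hcdc hp).
  + by move=> u v hu hv; rewrite min_exc0; exact: exD.
  + by move=> u v a hu hv a0; rewrite min_exc; exact: exD.
  + by move=> u hu; rewrite nrm_fun; exact: (pform_dual hdf hcdc hp).
  + by move=> u u' v; exact: (pform_ae hcdc).
  + by move=> v; exact: (pform_cst0 hdf hcdc hp).
  + by rewrite nrm_fun; exact: (pform_coercive hdf hreg hloc hcdc hcoer hp).
  + by move=> u v; exact: (pform_strict hdf hloc hcdc hcoer hp).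
  + by rewrite nrm_fun => F W; exact: (browder hdf hreg hloc hcdc hcoer hp).
- move=> u v [hu _] hv; rewrite min_exc0.
  exact: (pform_potential hdf hreg hloc hcdc hp).
- move=> u v a [hu _] hv a0; rewrite min_exc.
  exact: (pform_potential hdf hreg hloc hcdc hp (ltW a0)).
Qed.
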